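(* Deciding whether a given planar digraph is $2$-dicolourable is NP-complete.
   Context: Digraphs are finite, without loops and without parallel arcs, but digons (pairs of oppositely directed arcs between the same two vertices) are allowed. A digraph is planar if its underlying simple graph is planar. A digraph is $2$-dicolourable if its vertex set can be partitioned into $2$ subsets each inducing an acyclic subdigraph (no directed cycle; a digon is a directed cycle of length $2$). *)

(* Defs.v *)
From HB Require Import structures.
From mathcomp Require Import all_boot all_order all_algebra.
From mathcomp Require Import all_classical all_reals all_analysis.

Set Implicit Arguments.
Unset Strict Implicit.
Unset Printing Implicit Defensive.

Import Order.TTheory GRing.Theory Num.Theory.
Import numFieldNormedType.Exports.

Local Open Scope nat_scope.

(** * Polynomial time and NP *)

Definition word := seq bool.
Definition language := word -> Prop.

Inductive move := MoveLeft | Stay | MoveRight.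

(* Deterministic Turing machines with [ntapes.+1] two-way infinite tapes.
   A cell is blank ([None]), holds a bit ([Some (inl b)]) or one of finitely
   many auxiliary symbols ([Some (inr a)]). The machine halts when [delta]
   returns [None]; otherwise [delta] gives the new state and, for each tape,
   the symbol written and the head move. *)
Record tm := TM {
  ntapes : nat;
  state : finType;
  aux : finType;
  start : state;
  delta : state -> {ffun 'I_ntapes.+1 -> option (bool + aux)} ->
    option (state * {ffun 'I_ntapes.+1 -> option (bool + aux) * move})
}.

Definition cell (M : tm) : Type := option (bool + aux M).

(* Cells left of the head (nearest first), scanned cell, cells right of the
   head; all cells beyond the two lists are blank. *)
Definition tape (M : tm) : Type := (seq (cell M) * cell M * seq (cell M))%type.

Definition config (M : tm) : Type :=
  (state M * {ffun 'I_(ntapes M).+1 -> tape M})%type.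

Definition scanned M (t : tape M) : cell M := let: (_, a, _) := t in a.

Definition write_move M (am : cell M * move) (t : tape M) : tape M :=
  let: (l, _, r) := t in
  let: (a, m) := am in
  match m with
  | MoveLeft => (behead l, head None l, a :: r)
  | Stay => (l, a, r)
  | MoveRight => (a :: l, head None r, behead r)
  end.

Definition step M (c : config M) : option (config M) :=
  let: (q, ts) := c in
  if delta q [ffun i => scanned (ts i)] is Some (q', acts)
  then Some (q', [ffun i => write_move (acts i) (ts i)])
  else None.

(* The halting configuration, provided it is reached in at most [n] steps. *)
Fixpoint run M (n : nat) (c : config M) : option (config M) :=
  if step c is Some c' then (if n is n'.+1 then run n' c' else None)
  else Some c.

Definition input_tape M (w : word) : tape M :=
  let s : seq (cell M) := [seq Some (inl b) | b <- w] in
  ([::], head None s, behead s).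

(* The i-th input word is on tape i, the other tapes are blank. *)
Definition init M (ws : seq word) : config M :=
  (start M, [ffun i : 'I_(ntapes M).+1 => input_tape M (nth [::] ws i)]).

Fixpoint read_bits M (s : seq (cell M)) : word :=
  if s is Some (inl b) :: s' then b :: read_bits s' else [::].

(* The output is the maximal block of bits that starts at the head of tape 0
   and extends to the right. *)
Definition output M (c : config M) : word :=
  let: (_, a, r) := c.2 ord0 in read_bits (a :: r).

Definition result_within M (n : nat) (ws : seq word) : option word :=
  omap (@output M) (run n (init M ws)).

Definition poly_time_fun (f : word -> word) : Prop :=
  exists (M : tm) (p : {poly nat}), forall x : word,
    result_within M p.[size x]%R [:: x] = Some (f x).

Definition poly_time_rel (V : word -> word -> bool) : Prop :=
  exists (M : tm) (p : {poly nat}), forall x y : word,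
    result_within M p.[size x + size y]%R [:: x; y] = Some [:: V x y].

Definition in_NP (L : language) : Prop :=
  exists (V : word -> word -> bool) (q : {poly nat}), poly_time_rel V /\
    forall x : word, L x <-> exists y : word, size y <= q.[size x]%R /\ V x y.

Definition poly_reducible (L L' : language) : Prop :=
  exists f : word -> word, poly_time_fun f /\ forall x, L x <-> L' (f x).

Definition NP_hard (L : language) : Prop :=
  forall L' : language, in_NP L' -> poly_reducible L' L.

Definition NP_complete (L : language) : Prop := in_NP L /\ NP_hard L.

(** * Digraphs *)

Record digraph := Digraph {
  nvert : nat;
  darc : rel 'I_nvert;
  darc_irr : irreflexive darc
}.

(* The adjacency matrix, row by row; its length [nvert D ^ 2] determines the
   number of vertices, so the encoding is unambiguous. *)
Definition encode (D : digraph) : word :=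
  [seq darc (d := D) u v | u <- enum 'I_(nvert D), v <- enum 'I_(nvert D)].

Definition induces_acyclic (D : digraph) (A : {set 'I_(nvert D)}) : Prop :=
  ~ exists p : seq 'I_(nvert D),
      [/\ p != [::], {subset p <= A} & ucycle (darc (d := D)) p].

Definition dicolourable (k : nat) (D : digraph) : Prop :=
  exists c : 'I_(nvert D) -> 'I_k,
    forall i : 'I_k, induces_acyclic [set v | c v == i]%SET.

Definition underlying (D : digraph) : rel 'I_(nvert D) :=
  fun u v => darc u v || darc v u.

(** * Planarity *)

Section Planarity.
Local Open Scope classical_set_scope.
Local Open Scope ring_scope.

Definition is_arc (R : realType) (a b : R * R) (A : set (R * R)) : Prop :=
  exists g : R -> R * R,
    [/\ {within `[0, 1], continuous g}, {in `[0, 1] &, injective g},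
        g 0 = a, g 1 = b & g @` `[0, 1] = A].

(* [G [set u; v]] is the curve representing the edge uv. *)
Definition planar_graph (R : realType) (V : finType) (adj : rel V) : Prop :=
  exists (pt : V -> R * R) (G : {set V} -> set (R * R)),
    [/\ injective pt,
        forall u v, adj u v -> is_arc (pt u) (pt v) (G [set u; v]%SET),
        forall u v w, adj u v -> G [set u; v]%SET (pt w) -> w = u \/ w = v &
        forall u v x y, adj u v -> adj x y ->
          [set u; v]%SET != [set x; y]%SET ->
          G [set u; v]%SET `&` G [set x; y]%SET `<=` range pt].

Definition planar (R : realType) (D : digraph) : Prop :=
  planar_graph R (@underlying D).

End Planarity.

Definition planar_dicolourability (R : realType) (k : nat) : language :=
  fun w => exists D : digraph, [/\ w = encode D, planar R D & dicolourable k D].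

(* Main.v *)
Require Import Defs.
From mathcomp Require Import all_boot all_order all_algebra.
From mathcomp Require Import all_classical all_reals all_analysis.
From mathcomp Require Import zify ring lra.

Set Implicit Arguments.
Unset Strict Implicit.
Unset Printing Implicit Defensive.

Import Order.TTheory GRing.Theory Num.Theory.
Import numFieldNormedType.Exports.

Local Open Scope nat_scope.

(** Membership. A 2-colouring whose colour classes are acyclic is certified by
    the colouring and a strict order that contains the monochromatic arcs.
    Planarity has a certificate of polynomial size as well, and one made of truth
    values only: sweep a plane drawing from left to right with a vertical line,
    and record the order [lt] in which the vertices are met, and for two items
    (vertices or edges) that the line meets together, which of them comes first
    along the line, [O]. The axioms of [orderly] say that these two relations look as
    if they came from a drawing, and then they do: put the vertices at abscissas
    [0, 1, 2, ...], let the height of an item over an abscissa be its place in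
    the order [O] there, and draw the edges as polygonal lines
    ([orderly_planar]).

    Conversely a drawing by arbitrary arcs has no useful sweep, since an arc can
    turn back, or oscillate, infinitely often. So the arcs are replaced by walks
    in a fine square lattice. Near a vertex the walks may mix; contracting for each
    vertex the lattice points of the walks near it, together with the first part
    of each walk that leaves it, exhibits the graph as a minor of a finite piece
    of the lattice ([curves_sweepable]). The lattice has an evident sweep,
    described by a word of strands in which each vertex rewrites a block
    ([deriv]), and the graphs with a sweep are closed under minors
    ([sweepable_minor]): to contract an edge, its first end is made the start of
    the sweep, and the strands at its second end are led back along the edge;
    that this can be done without crossings is a statement about words
    ([rotatableP]). A sweep of the graph itself is the wanted certificate
    ([sweep_orderly]).

    The certificate is checked by an arithmetical formula with bounded quantifiers
    and access to the bits of its arguments. Such formulas are evaluated in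
    polynomial time ([PN_ueval]), by programs on finitely many stacks that are
    compiled to Turing machines ([compile_correct]).

    Hardness. A path of digons alternates between the two colours, so it is a wire
    that carries a truth value. A strip of parallel wires is crossed by directed
    cycles that go down and come back up through some consecutive wires; the
    columns where a cycle meets the wires decide which pattern of values makes the
    cycle monochromatic. So the strip can be coloured if and only if the wires
    carry values that, read next to each cycle, agree neither with the pattern of
    the cycle nor with its complement ([strip_dicolourable]). The strip is drawn
    on the grid with moves of a chess king, and no two diagonals cross
    ([strip_planar]): all constraints concern neighbouring wires, so no wire has
    to cross another one.

    This suffices for computations. A polynomial-time verifier accepts some
    certificate if and only if there is a tableau, over a fixed finite alphabet,
    each of whose 2 by 2 windows is allowed ([accepting_tableau]). A row of the
    tableau is held by groups of wires that carry codes of its entries, the rows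
    of two consecutive times being interleaved; then a window is a block of
    consecutive wires, and the cycles next to it exclude the patterns that do not
    encode an allowed window. Along the strip, the wires of the older row are cut
    and used again for the row of the next time ([tableau_dicolourable]). The
    adjacency matrix of the strip is a polynomial-time function of the input,
    again by means of stack programs ([poly_time_instance]). *)

(** * Stack programs and their Turing machines *)

Definition store := nat -> word.

Definition upd (s : store) (r : nat) (w : word) : store :=
  fun r' => if r' == r then w else s r'.

Inductive cmd :=
  | Nop
  | Push of nat & bool
  | Pop of nat
  | Seq of cmd & cmd
  | If of nat & cmd & cmd & cmd
  | While of nat & cmd.

Definition branch (T : Type) (w : word) (x y z : T) : T :=
  match w with [::] => z | b :: _ => if b then x else y end.

(** The cost is the number of steps of the compiled machine, hence two for a push
    (move, then write) and one for each test and each jump between commands. *)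
Inductive exec : cmd -> store -> nat -> store -> Prop :=
  | ENop s : exec Nop s 0 s
  | EPush r b s : exec (Push r b) s 2 (upd s r (b :: s r))
  | EPop r s : exec (Pop r) s 1 (upd s r (behead (s r)))
  | ESeq c1 c2 s s1 s2 t1 t2 :
      exec c1 s t1 s1 -> exec c2 s1 t2 s2 -> exec (Seq c1 c2) s (t1 + t2.+1) s2
  | EIf r c1 c2 c3 s t s' :
      exec (branch (s r) c1 c2 c3) s t s' -> exec (If r c1 c2 c3) s t.+1 s'
  | EWhileE r c s : s r = [::] -> exec (While r c) s 0 s
  | EWhileS r c s t1 s1 t2 s2 :
      s r <> [::] -> exec c s t1 s1 -> exec (While r c) s1 t2 s2 ->
      exec (While r c) s (t1.+2 + t2) s2.

Fixpoint regs_le (n : nat) (c : cmd) : bool :=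
  match c with
  | Nop => true
  | Push r _ | Pop r => r <= n
  | Seq c1 c2 => regs_le n c1 && regs_le n c2
  | If r c1 c2 c3 => [&& r <= n, regs_le n c1, regs_le n c2 & regs_le n c3]
  | While r c => (r <= n) && regs_le n c
  end.

Lemma regs_leW n m c : n <= m -> regs_le n c -> regs_le m c.
Proof.
move=> nm; elim: c => //= [r b|r|c1 h1 c2 h2|r c1 h1 c2 h2 c3 h3|r c h].
- by move/leq_trans; apply.
- by move/leq_trans; apply.
- by case/andP=> /h1 -> /h2 ->.
- by case/and4P=> /leq_trans -> // /h1 -> /h2 -> /h3 ->.
- by case/andP=> /leq_trans -> // /h ->.
Qed.

Fixpoint maxreg (c : cmd) : nat :=
  match c with
  | Nop => 0
  | Push r _ | Pop r => r
  | Seq c1 c2 => maxn (maxreg c1) (maxreg c2)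
  | If r c1 c2 c3 => maxn r (maxn (maxreg c1) (maxn (maxreg c2) (maxreg c3)))
  | While r c => maxn r (maxreg c)
  end.

Lemma regs_le_max c : regs_le (maxreg c) c.
Proof.
elim: c => //= [c1 h1 c2 h2|r c1 h1 c2 h2 c3 h3|r c h].
- by rewrite (regs_leW _ h1) ?(regs_leW _ h2) ?leq_maxr ?leq_maxl.
- rewrite leq_maxl (regs_leW _ h1) ?(regs_leW _ h2) ?(regs_leW _ h3) //;
  by rewrite !leq_max leqnn ?orbT.
- by rewrite leq_maxl (regs_leW _ h) // leq_maxr.
Qed.

Inductive reach (M : tm) : nat -> config M -> config M -> Prop :=
  | Reach0 c : reach 0 c c
  | ReachS c c1 c2 k : step c = Some c1 -> reach k c1 c2 -> reach k.+1 c c2.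

Lemma reach_trans M k1 k2 (c1 c2 c3 : config M) :
  reach k1 c1 c2 -> reach k2 c2 c3 -> reach (k1 + k2) c1 c3.
Proof.
by elim=> // {k1} {c2}c c1' c2 k h1 _ IH /IH; rewrite addSn; apply: ReachS h1.
Qed.

Lemma run_reach M k n (c c' : config M) :
  k <= n -> reach k c c' -> step c' = None -> run n c = Some c'.
Proof.
move=> kn r; elim: r n kn => {c c'} [c [|n] _ /= -> //|c c1 c2 {}k h _ IH [//|n]].
by rewrite ltnS /= h; apply: IH.
Qed.

Section Compile.
Variable n : nat.

Local Notation sym := (option (bool + void)).
Local Notation scan := {ffun 'I_n.+1 -> sym}.
Local Notation acts := {ffun 'I_n.+1 -> sym * move}.
Local Notation tapes := {ffun 'I_n.+1 -> seq sym * sym * seq sym}.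

(** A fragment halts when its transition function returns [None]; composing
    fragments turns these halts into jumps. *)
Record frag := Frag {
  fstate : finType;
  fstart : fstate;
  fdelta : fstate -> scan -> option (fstate * acts)
}.

Definition machine (F : frag) : tm := @TM n (fstate F) void (fstart F) (@fdelta F).

Definition stay (a : scan) : acts := [ffun i => (a i, Stay)].

Definition act_on (r : nat) (x : sym) (m : move) (a : scan) : acts :=
  [ffun i : 'I_n.+1 => if i == r :> nat then (x, m) else (a i, Stay)].

Definition fnop : frag := @Frag unit tt (fun _ _ => None).

(* A stack lies on its tape with the top under the head and blanks to the left,
   so popping erases and moves to the right. *)
Definition fpop (r : nat) : frag :=
  @Frag bool true (fun q a => if q then Some (false, act_on r None MoveRight a) else None).

Definition fpush (r : nat) (b : bool) : frag :=
  @Frag (option bool) (Some true) (fun q a =>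
    match q with
    | Some true => Some (Some false, act_on r (a (inord r)) MoveLeft a)
    | Some false => Some (None, act_on r (Some (inl b)) Stay a)
    | None => None
    end).

Definition fseq (F G : frag) : frag :=
  @Frag (fstate F + fstate G)%type (inl (fstart F)) (fun q a =>
    match q with
    | inl q => if fdelta q a is Some (q', x) then Some (inl q', x)
               else Some (inr (fstart G), stay a)
    | inr q => if fdelta q a is Some (q', x) then Some (inr q', x) else None
    end).

Definition fif (r : nat) (F G H : frag) : frag :=
  @Frag (option (fstate F + (fstate G + fstate H)))%type None (fun q a =>
    match q with
    | None => Some (Some (match a (inord r) with
                          | Some (inl true) => inl (fstart F)
                          | Some (inl false) => inr (inl (fstart G))
                          | _ => inr (inr (fstart H))
                          end), stay a)
    | Some (inl q) => if fdelta q a is Some (q', x) then Some (Some (inl q'), x) else None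
    | Some (inr (inl q)) =>
        if fdelta q a is Some (q', x) then Some (Some (inr (inl q')), x) else None
    | Some (inr (inr q)) =>
        if fdelta q a is Some (q', x) then Some (Some (inr (inr q')), x) else None
    end).

Definition fwhile (r : nat) (F : frag) : frag :=
  @Frag (option (fstate F)) None (fun q a =>
    match q with
    | None => if a (inord r) is None then None else Some (Some (fstart F), stay a)
    | Some q => if fdelta q a is Some (q', x) then Some (Some q', x)
                else Some (None, stay a)
    end).

Fixpoint compile (c : cmd) : frag :=
  match c with
  | Nop => fnop
  | Push r b => fpush r b
  | Pop r => fpop r
  | Seq c1 c2 => fseq (compile c1) (compile c2)
  | If r c1 c2 c3 => fif r (compile c1) (compile c2) (compile c3)
  | While r c => fwhile r (compile c)
  end.

Definition scans (ts : tapes) : scan := [ffun i => let: (_, a, _) := ts i in a].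

Lemma step_machine (F : frag) (q : fstate F) (ts : tapes) :
  @step (machine F) (q, ts) =
  if fdelta q (scans ts) is Some (q', x)
  then Some (q', [ffun i => @write_move (machine F) (x i) (ts i)]) else None.
Proof. by []. Qed.

Lemma write_stay (F : frag) (ts : tapes) :
  [ffun i => @write_move (machine F) (stay (scans ts) i) (ts i)] = ts.
Proof.
by apply/ffunP=> i; rewrite !ffunE; case: (ts i) => [[l a] r].
Qed.

Lemma reach_embed (F G : frag) (f : fstate F -> fstate G) k q q' (ts ts' : tapes) :
  (forall q a q' x, fdelta q a = Some (q', x) -> fdelta (f q) a = Some (f q', x)) ->
  @reach (machine F) k (q, ts) (q', ts') -> @reach (machine G) k (f q, ts) (f q', ts').
Proof.
move=> fd; move e: (q, ts) => c; move e': (q', ts') => c' r.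
elim: r q ts e e' => {c c'} [c q ts <- [-> ->]|c c1 c2 {}k + _ IH q ts ec e'].
  exact: Reach0.
rewrite -ec step_machine; case ed: (fdelta q (scans ts)) => [[q1 x]|] // [e1].
by apply: ReachS (IH _ _ e1 e'); rewrite step_machine (fd _ _ _ _ ed).
Qed.

(** Blanks may be stored explicitly on both sides, since moves leave them behind. *)
Definition tape_holds (w : word) (t : seq sym * sym * seq sym) : Prop :=
  let: (l, a, r) := t in
  (exists j, l = nseq j None) /\
  (exists j, a :: r = [seq Some (inl b) | b <- w] ++ nseq j None).

Definition holds (s : store) (ts : tapes) : Prop := forall i : 'I_n.+1, tape_holds (s i) (ts i).

Lemma scans_holds s ts r : holds s ts -> r <= n ->
  scans ts (inord r) = if s r is b :: _ then Some (inl b) else None.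
Proof.
move=> h rn; rewrite ffunE; have := h (inord r); rewrite inordK ?ltnS //.
case: (ts _) => [[l a] q] /= [_ [j]].
by case: (s r) => [|b w] /= => [|[->]] //; case: j => // j [->].
Qed.

Lemma hold_pop (F : frag) s ts r : holds s ts ->
  holds (upd s r (behead (s r)))
    [ffun i => @write_move (machine F) (act_on r None MoveRight (scans ts) i) (ts i)].
Proof.
move=> h i; rewrite !ffunE /upd; have := h i.
case: ifP => [/eqP <-|_]; case: (ts i) => [[l a] q] //= [[jl ->] [j]].
case: (s i) => [|b w] /= e; (split; first by exists jl.+1).
  case: j e => [//|[|j]] [_ ->]; first by exists 1.
  by exists j.+1.
case: e => _ e; rewrite e; case: w {e} => [|b' w] /=.
  by case: j => [|j]; [exists 1|exists j.+1].
by exists j.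
Qed.

Lemma hold_push (F G : frag) s ts r b : holds s ts -> r <= n ->
  let ts1 := [ffun i =>
    @write_move (machine F) (act_on r (scans ts (inord r)) MoveLeft (scans ts) i) (ts i)] in
  holds (upd s r (b :: s r))
    [ffun i => @write_move (machine G) (act_on r (Some (inl b)) Stay (scans ts1) i) (ts1 i)].
Proof.
move=> h rn ts1 i; rewrite !ffunE /upd; have := h i.
case: ifP => [/eqP e|_]; last by case: (ts i) => [[l a] q].
have -> : inord r = i by apply: val_inj; rewrite /= inordK // -e.
rewrite -e; case: (ts i) => [[l a] q] //= [[jl ->] [j ->]] /=; split; last by exists j.
by case: jl => [|jl]; [exists 0|exists jl].
Qed.

(** The machine stops where its transition function is undefined, which is where an
    enclosing fragment takes over. *)
Lemma compile_correct c s t s' : exec c s t s' -> regs_le n c ->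
  forall ts : tapes, holds s ts ->
  exists (q' : fstate (compile c)) (ts' : tapes),
    [/\ @reach (machine (compile c)) t (fstart (compile c), ts) (q', ts'),
        fdelta q' (scans ts') = None & holds s' ts'].
Proof.
elim=> {c s t s'} /= [s|r b s|r s|c1 c2 s s1 s2 t1 t2 _ IH1 _ IH2|
   r c1 c2 c3 s t s' _ IH|r c s s0|r c s t1 s1 t2 s2 sn _ IH1 _ IH2].
- by move=> _ ts h; exists tt, ts; split=> //; apply: Reach0.
- move=> rn ts h; eexists; eexists; split; last exact: (hold_push (fpush r b) (fpush r b)).
    apply: ReachS; first by rewrite step_machine.
    by apply: ReachS; [rewrite step_machine|apply: Reach0].
  by [].
- move=> rn ts h; eexists; eexists; split; last exact: (hold_pop (fpop r)).
    by apply: ReachS; [rewrite step_machine|apply: Reach0].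
  by [].
- case/andP=> r1 r2 ts /(IH1 r1)[q1 [ts1 [h1 d1 h]]].
  have [q2 [ts2 [h2 d2 h']]] := IH2 r2 ts1 h.
  exists (inr q2), ts2; split=> //=; last by rewrite d2.
  apply: (@reach_trans (machine (fseq (compile c1) (compile c2))) _ _ _ (inl q1, ts1)).
    by apply: (@reach_embed (compile c1) (fseq (compile c1) (compile c2)) inl) h1 => q a q' x /= ->.
  apply: (@ReachS (machine (fseq (compile c1) (compile c2))) _ (inr (fstart _), ts1)).
    by rewrite step_machine /= d1 write_stay.
  by apply: (@reach_embed (compile c2) (fseq (compile c1) (compile c2)) inr) h2 => q a q' x /= ->.
- case/and4P=> rn r1 r2 r3 ts h.
  have [|q' [ts' [hr hd hh]]] := IH _ ts h; first by case: (s r) => [//|[]].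
  have sc := scans_holds h rn.
  move: q' hr hd; rewrite /branch; case: (s r) sc => [|[] w] sc q' hr hd;
   [exists (Some (inr (inr q'))), ts'|exists (Some (inl q')), ts'|
    exists (Some (inr (inl q'))), ts']; (split=> //=; last by rewrite hd);
   (apply: ReachS; first by rewrite step_machine /= write_stay sc).
  + by apply: (@reach_embed (compile c3) (fif r (compile c1) (compile c2) (compile c3)) (fun q => Some (inr (inr q)))) hr => q a q1 x /= ->.
  + by apply: (@reach_embed (compile c1) (fif r (compile c1) (compile c2) (compile c3)) (fun q => Some (inl q))) hr => q a q1 x /= ->.
  + by apply: (@reach_embed (compile c2) (fif r (compile c1) (compile c2) (compile c3)) (fun q => Some (inr (inl q)))) hr => q a q1 x /= ->.
- case/andP=> rn _ ts h; exists None, ts; split=> //=; first exact: Reach0.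
  by rewrite (scans_holds h rn) s0.
- case/andP=> rn rc ts h; have [q1 [ts1 [h1 d1 hh1]]] := IH1 rc ts h.
  have [|q2 [ts2 [h2 d2 hh2]]] := IH2 _ ts1 hh1; first by rewrite rn.
  exists q2, ts2; split=> //; have -> : t1.+2 + t2 = (t1 + t2.+1).+1 by lia.
  apply: (@ReachS (machine (fwhile r (compile c))) _ (Some (fstart _), ts)).
    by rewrite step_machine /= (scans_holds h rn); case: (s r) sn => // b w _; rewrite write_stay.
  apply: (@reach_trans (machine (fwhile r (compile c))) _ _ _ (Some q1, ts1)).
    by apply: (@reach_embed (compile c) (fwhile r (compile c)) Some) h1 => q a q' x /= ->.
  by apply: ReachS h2; rewrite step_machine /= d1 write_stay.
Qed.

Lemma init_holds (F : frag) (ws : seq word) :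
  holds (nth [::] ws) (init (machine F) ws).2.
Proof.
move=> i; rewrite /= ffunE /input_tape /=; split; first by exists 0.
by case: (nth _ _ _) => [|b w] /=; [exists 1|exists 0; rewrite cats0].
Qed.

Lemma output_holds (F : frag) (s : store) (c : config (machine F)) :
  holds s c.2 -> output c = s 0.
Proof.
move=> /(_ ord0); rewrite /output /=; case: (c.2 ord0) => [[l a] r] [_ [j /= e]].
change (read_bits (M := machine F) (a :: r) = s 0); rewrite e {e}.
by elim: (s 0) => [|b w IH] /=; [case: j|rewrite IH].
Qed.

End Compile.

Lemma program_result (c : cmd) (ws : seq word) (t n : nat) (s' : store) :
  exec c (nth [::] ws) t s' -> t <= n ->
  result_within (machine (compile (maxreg c) c)) n ws = Some (s' 0).
Proof.
move=> ex tn; rewrite /result_within.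
have [||q' [ts' [hr hd hh]]] := compile_correct (n := maxreg c) ex _ (ts := (init (machine (compile (maxreg c) c)) ws).2).
- exact: regs_le_max.
- exact: init_holds.
set c0 := init _ _ in hr *.
have -> : c0 = (fstart (compile (maxreg c) c), c0.2) by [].
rewrite (run_reach tn hr).
  by rewrite /omap /obind /oapp (@output_holds _ (compile (maxreg c) c) s' (q', ts') hh).
by rewrite (step_machine (F := compile _ c)) hd.
Qed.

(** * Polynomial-time functions of several words *)

(** Powers of [n.+2] are closed under sums and products up to a larger exponent,
    as the base is at least 2, and they bound every constant. *)
Definition poly_le (B : nat -> nat) : Prop := exists c, forall n, B n <= n.+2 ^ c.

Lemma poly_le_const k : poly_le (fun=> k).
Proof.
exists k => n; apply: leq_trans (ltnW (ltn_expl k (ltnSn 1))) _.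
by case: k => // k; rewrite leq_exp2r.
Qed.

Lemma poly_le_id : poly_le id.
Proof. by exists 1 => n; rewrite expn1; lia. Qed.

Lemma poly_leD B1 B2 : poly_le B1 -> poly_le B2 -> poly_le (fun n => B1 n + B2 n).
Proof.
move=> [c1 h1] [c2 h2]; exists (maxn c1 c2).+1 => n.
have e1 : n.+2 ^ c1 <= n.+2 ^ maxn c1 c2 by rewrite leq_exp2l // leq_maxl.
have e2 : n.+2 ^ c2 <= n.+2 ^ maxn c1 c2 by rewrite leq_exp2l // leq_maxr.
have := h1 n; have := h2 n; rewrite expnS; set X := _ ^ maxn _ _ in e1 e2 *; nia.
Qed.

Lemma poly_leM B1 B2 : poly_le B1 -> poly_le B2 -> poly_le (fun n => B1 n * B2 n).
Proof.
by move=> [c1 h1] [c2 h2]; exists (c1 + c2) => n; rewrite expnD leq_mul.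
Qed.

Lemma poly_leX B c : poly_le B -> poly_le (fun n => B n ^ c).
Proof.
move=> [d h]; exists (d * c) => n; rewrite expnM.
by case: c => // c; rewrite leq_exp2r.
Qed.

Lemma poly_le_exp c : poly_le (fun n => n.+2 ^ c).
Proof. by exists c. Qed.

Lemma poly_leW B1 B2 : (forall n, B1 n <= B2 n) -> poly_le B2 -> poly_le B1.
Proof. by move=> h [c hc]; exists c => n; apply: leq_trans (h n) (hc n). Qed.

Definition execb (c : cmd) (s : store) (B : nat) (s' : store) : Prop :=
  exists2 t, t <= B & exec c s t s'.

Lemma execbW c s B B' s' : B <= B' -> execb c s B s' -> execb c s B' s'.
Proof. by move=> h [t ht e]; exists t => //; apply: leq_trans ht h. Qed.

Lemma execb_seq c1 c2 s s1 s2 B1 B2 :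
  execb c1 s B1 s1 -> execb c2 s1 B2 s2 -> execb (Seq c1 c2) s (B1 + B2.+1) s2.
Proof.
move=> [t1 h1 e1] [t2 h2 e2]; exists (t1 + t2.+1); last exact: ESeq e1 e2.
by rewrite leq_add.
Qed.

Lemma store_ext (s1 s2 : store) : s1 =1 s2 -> s1 = s2.
Proof. by move=> h; apply: funext. Qed.

(** Programs are reused inside larger ones by an injective renaming of their
    registers; the other registers are left alone. *)
Fixpoint ren (f : nat -> nat) (c : cmd) : cmd :=
  match c with
  | Nop => Nop
  | Push r b => Push (f r) b
  | Pop r => Pop (f r)
  | Seq c1 c2 => Seq (ren f c1) (ren f c2)
  | If r c1 c2 c3 => If (f r) (ren f c1) (ren f c2) (ren f c3)
  | While r c => While (f r) (ren f c)
  end.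

Lemma exec_ren f c s t s' : injective f -> exec c s t s' ->
  forall S : store, S \o f =1 s ->
  exists S' : store, [/\ exec (ren f c) S t S', S' \o f =1 s' &
    forall r, (forall r0, f r0 <> r) -> S' r = S r].
Proof.
move=> fi; have hu S s0 r w : S \o f =1 s0 -> upd S (f r) w \o f =1 upd s0 r w.
  by move=> h r'; rewrite /upd /= (inj_eq fi) -h.
have hn (S : store) r0 w r : (forall r0, f r0 <> r) -> upd S (f r0) w r = S r.
  by move=> /(_ r0) h; rewrite /upd; case: eqP => // e; case: h.
elim=> {c s t s'} /= [s|r b s|r s|c1 c2 s s1 s2 t1 t2 _ IH1 _ IH2|
   r c1 c2 c3 s t s' _ IH|r c s s0|r c s t1 s1 t2 s2 sn _ IH1 _ IH2] S hS.
- by exists S; split=> //; apply: ENop.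
- exists (upd S (f r) (b :: s r)); split; [|exact: hu|by move=> *; apply: hn].
  by rewrite -hS; apply: EPush.
- exists (upd S (f r) (behead (s r))); split; [|exact: hu|by move=> *; apply: hn].
  by rewrite -hS; apply: EPop.
- have [S1 [e1 h1 n1]] := IH1 S hS; have [S2 [e2 h2 n2]] := IH2 S1 h1.
  by exists S2; split=> [|//|r hr]; [apply: ESeq e1 e2|rewrite n2 ?n1].
- have [S1 [e1 h1 n1]] := IH S hS; exists S1; split=> //; apply: EIf.
  by have /= -> := hS r; case: (s r) e1 => // [[]].
- by exists S; split=> //; apply: EWhileE; have /= -> := hS r.
- have [S1 [e1 h1 n1]] := IH1 S hS; have [S2 [e2 h2 n2]] := IH2 S1 h1.
  exists S2; split=> [|//|r' hr]; last by rewrite n2 ?n1.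
  by apply: EWhileS e1 e2; have /= -> := hS r.
Qed.

Definition clear (r : nat) : cmd := While r (Pop r).

Definition shovel (r1 r2 : nat) : cmd :=
  While r1 (If r1 (Seq (Push r2 true) (Pop r1)) (Seq (Push r2 false) (Pop r1)) Nop).

Lemma upd_id s r : upd s r (s r) = s.
Proof. by apply: store_ext => r'; rewrite /upd; case: eqP => // ->. Qed.

Lemma upd_upd s r v w : upd (upd s r v) r w = upd s r w.
Proof. by apply: store_ext => r'; rewrite /upd; case: eqP. Qed.

Lemma upd_eq s r w : upd s r w r = w.
Proof. by rewrite /upd eqxx. Qed.

Lemma upd_neq s r r' w : r' != r -> upd s r w r' = s r'.
Proof. by rewrite /upd => /negbTE ->. Qed.

Ltac upd_cases :=
  apply: store_ext => ?; rewrite /upd;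
  repeat match goal with
  | |- context [?x == ?x] => rewrite (eqxx x)
  | H : is_true (?x != ?y) |- context [?x == ?y] => rewrite (negbTE H)
  | H : is_true (?x != ?y) |- context [?y == ?x] => rewrite [y == x]eq_sym (negbTE H)
  end; repeat (case: eqP => [?|?]; subst => //=); try by congruence.

Ltac upd_val := rewrite /upd; repeat (case: eqP => [?|?]); try done; try lia; try congruence.

Lemma exec_clear r s : execb (clear r) s (3 * size (s r)) (upd s r [::]).
Proof.
move e: (s r) => w; elim: w s e => [|b w IH] s e.
  by exists 0 => //; have -> : upd s r [::] = s; [rewrite -e upd_id|apply: EWhileE].
have [|t ht ex] := IH (upd s r w); first by rewrite upd_eq.
exists (3 + t); first by rewrite /=; lia.
rewrite upd_upd in ex; apply: EWhileS ex; first by rewrite e.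
by have := EPop r s; rewrite e.
Qed.

Lemma exec_shovel r1 r2 s : r1 != r2 ->
  execb (shovel r1 r2) s (7 * size (s r1)) (upd (upd s r1 [::]) r2 (catrev (s r1) (s r2))).
Proof.
move=> ne; move e: (s r1) => w; elim: w s e => [|b w IH] s e.
  exists 0 => //=; have -> : upd s r1 [::] = s by rewrite -e upd_id.
  by rewrite upd_id; apply: EWhileE.
have [|t ht ex] := IH (upd (upd s r2 (b :: s r2)) r1 w); first by rewrite upd_eq.
exists (7 + t); first by rewrite /=; lia.
have e2 : upd (upd s r2 (b :: s r2)) r1 w r2 = b :: s r2.
  by rewrite upd_neq ?upd_eq // eq_sym.
rewrite e2 upd_upd in ex.
have -> : upd (upd s r1 [::]) r2 (catrev (b :: w) (s r2)) =
    upd (upd (upd s r2 (b :: s r2)) r1 [::]) r2 (catrev w (b :: s r2)) by upd_cases.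
apply: (EWhileS _ _ ex); first by rewrite e.
apply: EIf; rewrite e /=.
have H b' : exec (Seq (Push r2 b') (Pop r1)) s 4 (upd (upd s r2 (b' :: s r2)) r1 w).
  apply: (ESeq (t1 := 2) (t2 := 1)); first exact: EPush.
  have -> : w = behead (upd s r2 (b' :: s r2) r1) by rewrite upd_neq // e.
  exact: EPop.
by case: b {e IH e2 ex} H => H; apply: H.
Qed.

(* Moving twice restores the order of the bits. *)
Definition mv (r1 r2 tmp : nat) : cmd := Seq (shovel r1 tmp) (shovel tmp r2).

Lemma exec_mv r1 r2 tmp s : r1 != tmp -> r2 != tmp -> r1 != r2 ->
  s tmp = [::] -> s r2 = [::] ->
  execb (mv r1 r2 tmp) s (14 * size (s r1) + 1) (upd (upd s r1 [::]) r2 (s r1)).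
Proof.
move=> n1 n2 n3 e1 e2; set w := s r1.
have h1 := exec_shovel s n1; have := exec_shovel (upd (upd s r1 [::]) tmp (catrev w (s tmp))) (r1 := tmp) (r2 := r2) _.
rewrite upd_eq => /(_ _)[|t2 ht2 x2]; first by rewrite eq_sym.
have [t1 ht1 x1] := h1; exists (t1 + t2.+1).
  by move: ht1 ht2; rewrite -/w e1 catrevE cats0 size_rev /=; lia.
have -> : upd (upd s r1 [::]) r2 w = upd (upd (upd (upd s r1 [::]) tmp (catrev w (s tmp))) tmp [::]) r2 (catrev (catrev w (s tmp)) (upd (upd s r1 [::]) tmp (catrev w (s tmp)) r2)).
  rewrite upd_upd [upd (upd _ _ _) tmp _ r2]upd_neq // [upd s r1 _ r2]upd_neq 1?eq_sym // e1 e2.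
  by rewrite !catrevE !cats0 revK; upd_cases.
exact: ESeq x1 x2.
Qed.

Definition replace (r1 r2 tmp : nat) : cmd := Seq (clear r1) (mv r2 r1 tmp).

Lemma exec_replace r1 r2 tmp s : r1 != tmp -> r2 != tmp -> r1 != r2 -> s tmp = [::] ->
  execb (replace r1 r2 tmp) s (3 * size (s r1) + (14 * size (s r2) + 1).+1)
    (upd (upd s r2 [::]) r1 (s r2)).
Proof.
move=> n1 n2 n3 e.
have := @exec_mv r2 r1 tmp (upd s r1 [::]) n2 n1.
rewrite eq_sym n3 upd_eq [upd _ _ _ tmp]upd_neq 1?eq_sym // [upd _ _ _ r2]upd_neq 1?eq_sym //.
move=> /(_ isT e erefl) h.
have -> : upd (upd s r2 [::]) r1 (s r2) = upd (upd (upd s r1 [::]) r2 [::]) r1 (s r2).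
  by upd_cases.
exact: execb_seq (exec_clear r1 s) h.
Qed.

Definition dup (r1 r2 tmp : nat) : cmd :=
  Seq (shovel r1 tmp)
    (While tmp (If tmp (Seq (Push r1 true) (Seq (Push r2 true) (Pop tmp)))
                       (Seq (Push r1 false) (Seq (Push r2 false) (Pop tmp))) Nop)).

Lemma exec_dup r1 r2 tmp s : r1 != tmp -> r2 != tmp -> r1 != r2 ->
  s tmp = [::] -> s r2 = [::] ->
  execb (dup r1 r2 tmp) s (17 * size (s r1) + 1) (upd s r2 (s r1)).
Proof.
move=> n1 n2 n3 e1 e2.
have H s0 : execb (While tmp (If tmp (Seq (Push r1 true) (Seq (Push r2 true) (Pop tmp)))
                       (Seq (Push r1 false) (Seq (Push r2 false) (Pop tmp))) Nop)) s0
    (10 * size (s0 tmp)) (upd (upd (upd s0 tmp [::]) r1 (catrev (s0 tmp) (s0 r1)))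
        r2 (catrev (s0 tmp) (s0 r2))).
  move e: (s0 tmp) => w; elim: w s0 e => [|b w IH] s0 e.
    exists 0 => //=; have -> : upd s0 tmp [::] = s0 by rewrite -e upd_id.
    by rewrite !upd_id; apply: EWhileE.
  pose s3 := upd (upd (upd s0 r1 (b :: s0 r1)) r2 (b :: s0 r2)) tmp w.
  have [|t ht ex] := IH s3; first by rewrite /s3 upd_eq.
  exists (10 + t); first by rewrite /=; lia.
  set s4 := upd _ _ _ in ex.
  set s5 := upd _ _ _; have e5 : s5 = s4.
    by rewrite /s5 /s4 /s3; upd_cases.
  rewrite e5; apply: (EWhileS (t1 := 8) _ _ ex); first by rewrite e.
  apply: EIf; rewrite e /=.
  have K b' : exec (Seq (Push r1 b') (Seq (Push r2 b') (Pop tmp))) s0 7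
      (upd (upd (upd s0 r1 (b' :: s0 r1)) r2 (b' :: s0 r2)) tmp w).
    apply: (ESeq (t1 := 2) (t2 := 4)); first exact: EPush.
    apply: (ESeq (t1 := 2) (t2 := 1)).
      by have := EPush r2 b' (upd s0 r1 (b' :: s0 r1)); rewrite upd_neq 1?eq_sym //; apply.
    have -> : w = behead (upd (upd s0 r1 (b' :: s0 r1)) r2 (b' :: s0 r2) tmp).
      by rewrite !upd_neq 1?eq_sym // e.
    exact: EPop.
  by rewrite /s3; case: b {e s3 IH ex s4 s5 e5} K => K; apply: K.
have [t1 ht1 x1] := exec_shovel s n1; have := H (upd (upd s r1 [::]) tmp (catrev (s r1) (s tmp))).
rewrite upd_eq => -[t2 ht2 x2]; exists (t1 + t2.+1).
  by move: ht1 ht2; rewrite e1 catrevE cats0 size_rev /=; lia.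
have -> : upd s r2 (s r1) = upd (upd (upd (upd (upd s r1 [::]) tmp (catrev (s r1) (s tmp))) tmp [::]) r1
     (catrev (catrev (s r1) (s tmp)) (upd (upd s r1 [::]) tmp (catrev (s r1) (s tmp)) r1))) r2
    (catrev (catrev (s r1) (s tmp)) (upd (upd s r1 [::]) tmp (catrev (s r1) (s tmp)) r2)).
  rewrite upd_upd ![upd (upd _ _ _) tmp _ _]upd_neq // upd_eq [upd s r1 _ r2]upd_neq 1?eq_sym // e1 e2.
  by rewrite !catrevE !cats0 revK; upd_cases.
exact: ESeq x1 x2.
Qed.

Definition tot (a : seq word) : nat := sumn (map size a).

Definition st (a : seq word) : store := nth [::] a.

Lemma tot_rcons a w : tot (rcons a w) = tot a + size w.
Proof. by rewrite /tot map_rcons sumn_rcons. Qed.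

Lemma tot_cat a b : tot (a ++ b) = tot a + tot b.
Proof. by rewrite /tot map_cat sumn_cat. Qed.

Lemma size_nth_tot a i : size (nth [::] a i) <= tot a.
Proof.
elim: a i => [|w a IH] [|i] //=; first exact: leq_addr.
exact: leq_trans (IH i) (leq_addl _ _).
Qed.

Lemma st_rcons a w : st (rcons a w) = upd (st a) (size a) w.
Proof.
apply: store_ext => r; rewrite /st /upd nth_rcons.
by case: ltngtP => // h; rewrite nth_default // ltnW.
Qed.

(** Programs of this kind compose, because the arguments are still there afterwards
    and every register beyond the result is empty again. *)
Definition PT (k : nat) (F : seq word -> word) : Prop :=
  exists p c, forall a, size a = k ->
    execb p (st a) ((tot a).+2 ^ c) (st (rcons a (F a))) /\
    size (F a) <= (tot a).+2 ^ c.

Lemma PT_intro k F p B1 B2 : poly_le B1 -> poly_le B2 ->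
  (forall a, size a = k -> execb p (st a) (B1 (tot a)) (upd (st a) k (F a)) /\
    size (F a) <= B2 (tot a)) -> PT k F.
Proof.
move=> h1 h2 h; have [c hc] := poly_leD h1 h2; exists p, c => a sa.
have [e s] := h a sa; have := hc (tot a) => le; split; last by apply: leq_trans s _; lia.
by rewrite st_rcons sa; apply: execbW e; lia.
Qed.

Lemma PT_ext k F G : (forall a, size a = k -> F a = G a) -> PT k F -> PT k G.
Proof.
by move=> e [p [c h]]; exists p, c => a sa; rewrite -e //; apply: h.
Qed.

Lemma execb_call f p a w B (S : store) : injective f ->
  execb p (st a) B (st (rcons a w)) -> S \o f =1 st a ->
  execb (ren f p) S B (upd S (f (size a)) w).
Proof.
move=> fi [t ht ex] hS; exists t => //.
have [S' [ex' h1 h2]] := exec_ren fi ex hS.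
suff <- : S' = upd S (f (size a)) w by [].
apply: store_ext => r; have [[r0 <-]|n] := pselect (exists r0, f r0 = r).
  rewrite /upd (inj_eq fi); have /= -> := h1 r0; rewrite st_rcons /upd.
  by case: eqP => // _; have /= <- := hS r0.
rewrite h2 => [|r0 e]; last by apply: n; exists r0.
by rewrite upd_neq //; apply/eqP => e; apply: n; exists (size a).
Qed.

(** The first [k] registers stay, the others move up by [d]: this makes room for
    local variables of the caller behind the arguments. *)
Definition gap (k d r : nat) : nat := if r < k then r else r + d.

Lemma gap_inj k d : injective (gap k d).
Proof. by move=> r1 r2; rewrite /gap; case: ifP; case: ifP => *; lia. Qed.

Lemma tot_take k a : tot (take k a) <= tot a.
Proof. by rewrite -{2}(cat_take_drop k a) tot_cat leq_addr. Qed.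

Lemma tot_drop k a : tot (drop k a) <= tot a.
Proof. by rewrite -{2}(cat_take_drop k a) tot_cat leq_addl. Qed.

Lemma PT_weaken k d F : PT k F -> PT (k + d) (fun a => F (take k a)).
Proof.
move=> [p [c h]].
apply: (@PT_intro _ _ (ren (gap k d) p) _ _ (poly_le_exp c) (poly_le_exp c)) => a sa.
have st_ : size (take k a) = k by rewrite size_takel // sa leq_addr.
have [e s] := h _ st_; have le : (tot (take k a)).+2 ^ c <= (tot a).+2 ^ c.
  by case: c {h e s} => // c; rewrite leq_exp2r // !ltnS tot_take.
split; last exact: leq_trans s le.
have -> : k + d = gap k d (size (take k a)) by rewrite st_ /gap ltnn.
apply: execbW le _; apply: execb_call => //; first exact: gap_inj.
move=> r /=; rewrite /st /gap; case: ltnP => hr; first by rewrite nth_take.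
by rewrite !nth_default // ?st_ // sa; lia.
Qed.

Lemma PT_arg k i : i < k -> PT k (fun a => nth [::] a i).
Proof.
move=> ik; apply: (@PT_intro _ _ (dup i k k.+1) (fun n => 17 * n + 1) id) => [||a sa].
- by apply: poly_leD (poly_le_const _); apply: poly_leM (poly_le_const _) poly_le_id.
- exact: poly_le_id.
split; last exact: size_nth_tot.
have := @exec_dup i k k.+1 (st a); rewrite /st => H.
apply: (execbW _ (H _ _ _ _ _)); try (by rewrite nth_default ?sa); try lia.
by rewrite leq_add2r leq_mul2l size_nth_tot orbT.
Qed.

Lemma PT_nil k : PT k (fun=> [::]).
Proof.
apply: (@PT_intro _ _ Nop (fun=> 0) (fun=> 0)) => [||a sa]; try exact: poly_le_const.
split=> //; have -> : upd (st a) k [::] = upd (st a) k (st a k) by rewrite /st [nth _ _ k]nth_default ?sa.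
by rewrite upd_id; exists 0 => //; apply: ENop.
Qed.

Lemma PT_cons k b F : PT k F -> PT k (fun a => b :: F a).
Proof.
move=> [p [c h]].
apply: (@PT_intro _ _ (Seq p (Push k b)) (fun n => n.+2 ^ c + 3) (fun n => 1 + n.+2 ^ c)) => [||a sa].
- exact: poly_leD (poly_le_exp _) (poly_le_const _).
- exact: poly_leD (poly_le_const _) (poly_le_exp _).
have [e s] := h a sa; split; last by rewrite /=; lia.
apply: execb_seq e _; exists 2 => //; have := EPush k b (st (rcons a (F a))).
by rewrite st_rcons sa upd_upd upd_eq.
Qed.

Lemma PT_const k w : PT k (fun=> w).
Proof. by elim: w => [|b w IH]; [exact: PT_nil|exact: PT_cons]. Qed.

Lemma PT_behead k F : PT k F -> PT k (fun a => behead (F a)).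
Proof.
move=> [p [c h]].
apply: (@PT_intro _ _ (Seq p (Pop k)) (fun n => n.+2 ^ c + 2) (fun n => n.+2 ^ c)) => [||a sa].
- exact: poly_leD (poly_le_exp _) (poly_le_const _).
- exact: poly_le_exp.
have [e s] := h a sa; split; last by rewrite size_behead; lia.
apply: execb_seq e _; exists 1 => //; have := EPop k (st (rcons a (F a))).
by rewrite st_rcons sa upd_upd upd_eq.
Qed.

Lemma PT_branch k F G1 G2 G3 : PT k F -> PT k G1 -> PT k G2 -> PT k G3 ->
  PT k (fun a => branch (F a) (G1 a) (G2 a) (G3 a)).
Proof.
move=> [p [c h]] [p1 [c1 h1]] [p2 [c2 h2]] [p3 [c3 h3]].
pose E n := (n.+2 ^ c1 + n.+2 ^ c2) + n.+2 ^ c3.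
have hE : poly_le E by do 2?[apply: poly_leD]; apply: poly_le_exp.
apply: (@PT_intro _ _ (Seq p (If k (Seq (clear k) p1) (Seq (clear k) p2) (Seq (clear k) p3)))
  (fun n => n.+2 ^ c + (3 * n.+2 ^ c + (E n).+1).+2) E) => // [|a sa].
  apply: (poly_leW (B2 := fun n => n.+2 ^ c + (3 * n.+2 ^ c + (E n + 3)))); first by move=> n; lia.
  apply: (poly_leD (poly_le_exp _)); apply: poly_leD.
    by apply: poly_leM (poly_le_const _) (poly_le_exp _).
  exact: poly_leD hE (poly_le_const _).
have [e s] := h a sa; have [e1 s1] := h1 a sa; have [e2 s2] := h2 a sa.
have [e3 s3] := h3 a sa; split; last first.
  by rewrite /E /branch; case: (F a) => [|[] w]; lia.
apply: execb_seq e _; set s0 := st (rcons _ _).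
have cl : execb (clear k) s0 (3 * (tot a).+2 ^ c) (st a).
  have x := exec_clear k s0; have e0 : s0 k = F a by rewrite /s0 /st nth_rcons sa ltnn eqxx.
  rewrite e0 in x.
  have -> : st a = upd s0 k [::]; last by apply: execbW x; lia.
  rewrite /s0 st_rcons sa upd_upd; apply: store_ext => r; rewrite /upd.
  by case: eqP => // ->; rewrite /st nth_default ?sa.
have H q w C : execb q (st a) C (st (rcons a w)) -> C <= E (tot a) ->
  execb (Seq (clear k) q) s0 (3 * (tot a).+2 ^ c + (E (tot a)).+1) (upd (st a) k w).
  move=> ex le; apply: (execbW (B := 3 * (tot a).+2 ^ c + C.+1)); first by lia.
  by rewrite -[in upd _ k]sa -st_rcons; apply: execb_seq cl ex.
have {}H : execb (branch (F a) (Seq (clear k) p1) (Seq (clear k) p2) (Seq (clear k) p3)) s0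
   (3 * (tot a).+2 ^ c + (E (tot a)).+1) (upd (st a) k (branch (F a) (G1 a) (G2 a) (G3 a))).
  by rewrite /branch; case: (F a) => [|[] w]; [apply: H e3 _|apply: H e1 _|apply: H e2 _]; rewrite /E; lia.
case: H => t ht ex; exists t.+1 => //; apply: EIf.
by rewrite {1}/s0 /st nth_rcons sa ltnn eqxx.
Qed.

(** The intermediate result is one more argument, removed at the end. *)
Lemma PT_let k F G : PT k F -> PT k.+1 G -> PT k (fun a => G (rcons a (F a))).
Proof.
move=> [p [c h]] [q [d g]].
pose E n := (n + n.+2 ^ c + 2) ^ d.
have hE : poly_le E.
  apply: poly_leX; apply: poly_leD (poly_le_const _).
  exact: poly_leD poly_le_id (poly_le_exp _).
apply: (@PT_intro _ _ (Seq p (Seq q (replace k k.+1 k.+2)))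
   (fun n => n.+2 ^ c + (E n + (3 * n.+2 ^ c + (14 * E n + 1).+1).+1).+1) E) => // [|a sa].
  apply: (poly_leW (B2 := fun n => n.+2 ^ c + (E n + (3 * n.+2 ^ c + (14 * E n + 4))))).
    by move=> n; lia.
  apply: (poly_leD (poly_le_exp _)); apply: (poly_leD hE); apply: poly_leD.
    by apply: poly_leM (poly_le_const _) (poly_le_exp _).
  apply: (fun h => poly_leD h (poly_le_const _)); exact: poly_leM (poly_le_const _) hE.
have [e s] := h a sa; have [|ex sz] := g (rcons a (F a)); first by rewrite size_rcons sa.
set w := F a in s e ex sz *; set v := G _ in ex sz *.
have le : (tot (rcons a w)).+2 ^ d <= E (tot a).
  by rewrite tot_rcons /E; case: d {g ex sz hE} @E => // d; rewrite leq_exp2r // ; lia.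
split; last exact: leq_trans sz le.
apply: execb_seq e _; apply: execb_seq (execbW le ex) _.
have nk : st a k = [::] by rewrite /st nth_default ?sa.
have nk1 : st a k.+1 = [::] by rewrite /st nth_default ?sa.
have nk2 : st a k.+2 = [::] by rewrite /st nth_default ?sa //; lia.
have := @exec_replace k k.+1 k.+2 (st (rcons (rcons a w) v)).
rewrite !st_rcons size_rcons sa.
have -> : upd (upd (st a) k w) k.+1 v k.+1 = v by rewrite upd_eq.
have -> : upd (upd (st a) k w) k.+1 v k = w by rewrite upd_neq ?upd_eq //; lia.
have -> : upd (upd (st a) k w) k.+1 v k.+2 = [::] by rewrite !upd_neq //; lia.
move=> /(_ _ _ _ erefl) H.
have -> : upd (st a) k v = upd (upd (upd (upd (st a) k w) k.+1 v) k.+1 [::]) k v.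
  by upd_cases.
have {}H := H ltac:(lia) ltac:(lia) ltac:(lia).
by have := leq_trans sz le => szE; apply: execbW H; lia.
Qed.

Lemma PT_weak1 k F : PT k F -> PT k.+1 (fun a => F (take k a)).
Proof. by move=> h; have := PT_weaken 1 h; rewrite addn1. Qed.

Lemma PT_weak2 k F : PT k F -> PT k.+2 (fun a => F (take k a)).
Proof. by move=> h; have := PT_weaken 2 h; rewrite addn2. Qed.

(** The general loop: iteration along a word. Without the bound on the accumulator
    its length could be squared in every round. The word being read is in
    register [k], the accumulator in [k.+1], the current bit in [k.+2]. *)
Lemma PT_fold k F I G c0 : PT k F -> PT k I -> PT k.+2 G ->
  (forall a i, size a = k ->
     size (foldl (fun acc b => G (a ++ [:: acc; [:: b]])) (I a) (take i (F a)))
       <= (tot a).+2 ^ c0) ->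
  PT k (fun a => foldl (fun acc b => G (a ++ [:: acc; [:: b]])) (I a) (F a)).
Proof.
move=> [p [c h]] hI [q [d g]] hacc.
have [pI [e hI1]] := PT_weak1 hI.
pose N n := (n + n.+2 ^ c0 + 3) ^ d.
have hN : poly_le N.
  apply: poly_leX; apply: (fun h => poly_leD h (poly_le_const _)).
  exact: poly_leD poly_le_id (poly_le_exp _).
pose body := Seq (If k (Seq (Push k.+2 true) (Pop k)) (Seq (Push k.+2 false) (Pop k)) Nop)
  (Seq (ren (gap k 1) q) (Seq (clear k.+2) (replace k.+1 k.+3 k.+2))).
pose C n := N n + 3 * n.+2 ^ c0 + 14 * n.+2 ^ c0 + 20.
have hC : poly_le C.
  apply: (fun h => poly_leD h (poly_le_const _)); apply: poly_leD; first apply: poly_leD => //.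
    by apply: poly_leM (poly_le_const _) (poly_le_exp _).
  by apply: poly_leM (poly_le_const _) (poly_le_exp _).
pose D n := (n + n.+2 ^ c).+2 ^ e.
have hD : poly_le D.
  apply: (poly_leW (B2 := fun n => (n + n.+2 ^ c + 2) ^ e)); first by move=> n; rewrite addn2.
  apply: poly_leX; apply: (fun h => poly_leD h (poly_le_const _)).
  exact: poly_leD poly_le_id (poly_le_exp _).
apply: (@PT_intro _ _ (Seq p (Seq pI (Seq (While k body) (replace k k.+1 k.+2))))
   (fun n => n.+2 ^ c + (D n + (n.+2 ^ c * C n + (14 * n.+2 ^ c0 + 2).+1).+1).+1)
   (fun n => n.+2 ^ c0)) => [||a sa].
- apply: (poly_leW (B2 := fun n => n.+2 ^ c + (D n + (n.+2 ^ c * C n + (14 * n.+2 ^ c0 + 5))))).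
    by move=> n; lia.
  apply: (poly_leD (poly_le_exp _)); apply: (poly_leD hD); apply: poly_leD.
    exact: poly_leM (poly_le_exp _) hC.
  apply: (fun h => poly_leD h (poly_le_const _)).
  by apply: poly_leM (poly_le_const _) (poly_le_exp _).
- exact: poly_le_exp.
have [ep sp] := h a sa; set w := F a in ep sp *.
have [|eI _] := hI1 (rcons a w); first by rewrite size_rcons sa.
rewrite -cats1 take_size_cat // cats1 in eI.
have hacc' i : size (foldl (fun acc b => G (a ++ [:: acc; [:: b]])) (I a) (take i w))
    <= (tot a).+2 ^ c0 by apply: hacc.
split; last by have := hacc' (size w); rewrite take_size.
apply: execb_seq ep _; apply: execb_seq.
  apply: execbW eI; rewrite /D tot_rcons; case: (e) => // e'; rewrite leq_exp2r //; lia.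
pose S x acc : store := upd (upd (st a) k x) k.+1 acc.
have stS x acc : st (rcons (rcons a x) acc) = S x acc by rewrite !st_rcons size_rcons sa.
have nk i : k <= i -> st a i = [::] by move=> ki; rewrite /st nth_default ?sa.
rewrite stS; apply: (@execb_seq _ _ _ (S [::] (foldl (fun acc b => G (a ++ [:: acc; [:: b]])) (I a) w))).
  suff H j i : i + j = size w -> execb (While k body)
      (S (drop i w) (foldl (fun acc b => G (a ++ [:: acc; [:: b]])) (I a) (take i w)))
      (j * C (tot a))
      (S [::] (foldl (fun acc b => G (a ++ [:: acc; [:: b]])) (I a) w)).
    by have := H (size w) 0 erefl; rewrite drop0 take0; apply: execbW; rewrite leq_mul.
  elim: j i => [|j IH] i ij.
    rewrite addn0 in ij; rewrite ij drop_size take_size.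
    by exists 0 => //; apply: EWhileE; rewrite /S upd_neq ?upd_eq //; lia.
  have iw : i < size w by lia.
  have [|t2 ht2 ex2] := IH i.+1; first by lia.
  rewrite (take_nth false iw) -cats1 foldl_cat /= in ex2.
  have hn := hacc' i.+1; rewrite (take_nth false iw) -cats1 foldl_cat /= in hn.
  rewrite (drop_nth false iw); have ha := hacc' i.
  set acc := foldl _ _ (take i w) in ex2 hn ha *; set b := nth false w i in ex2 hn *.
  set u := drop i.+1 w in ex2 *; set v := G _ in ex2 hn.
  have B1 : execb (If k (Seq (Push k.+2 true) (Pop k)) (Seq (Push k.+2 false) (Pop k)) Nop)
     (S (b :: u) acc) 5 (upd (S u acc) k.+2 [:: b]).
    exists 5 => //; apply: EIf.
    have -> : S (b :: u) acc k = b :: u by rewrite /S; upd_val.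
    have K b' : exec (Seq (Push k.+2 b') (Pop k)) (S (b :: u) acc) 4 (upd (S u acc) k.+2 [:: b']).
      apply: (ESeq (t1 := 2) (t2 := 1)); first exact: EPush.
      set S1 := upd _ _ _; have := EPop k S1.
      have e0 : S1 k = b :: u by rewrite /S1 /S; upd_val.
      rewrite e0 /=; suff -> : upd S1 k u = upd (S u acc) k.+2 [:: b'] by [].
      have e1 : S (b :: u) acc k.+2 = [::] by rewrite /S; upd_val; rewrite nk //; lia.
      rewrite /S1 e1 /S; apply: store_ext => r; upd_val.
    by case: (b) K => K; apply: K.
  have B2 : execb (ren (gap k 1) q) (upd (S u acc) k.+2 [:: b]) (N (tot a))
     (upd (upd (S u acc) k.+2 [:: b]) k.+3 v).
    have [|eg sg] := g (a ++ [:: acc; [:: b]]); first by rewrite size_cat sa addn2.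
    have -> : k.+3 = gap k 1 (size (a ++ [:: acc; [:: b]])).
      by rewrite size_cat sa /= /gap; case: ifP; lia.
    apply: execbW; last (apply: execb_call eg _; first exact: gap_inj).
      by rewrite tot_cat /N /tot /=; case: (d) => // d'; rewrite leq_exp2r //; move: ha; rewrite /tot; lia.
    move=> r /=; rewrite /gap /st nth_cat sa /S /upd.
    case: ltnP => kr; first by do 3?[case: eqP => [?|_]; first lia].
    have := nk r.+1; rewrite /st => nk1; case: eqP => [e3|n3].
      by have -> : r - k = 1 by lia.
    case: eqP => [e4|n4]; first by have -> : r - k = 0 by lia.
    case: eqP => [|_]; first by lia.
    rewrite addn1 nk1; last by lia.
    by case e5: (r - k) => [|[|m]] //=; [lia|lia|rewrite nth_nil].
  have B3 := exec_clear k.+2 (upd (upd (S u acc) k.+2 [:: b]) k.+3 v).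
  have E0 : upd (upd (S u acc) k.+2 [:: b]) k.+3 v k.+2 = [:: b] by upd_val.
  rewrite E0 in B3.
  have B4 := @exec_replace k.+1 k.+3 k.+2 (upd (upd (upd (S u acc) k.+2 [:: b]) k.+3 v) k.+2 [::]).
  have E1 : upd (upd (upd (S u acc) k.+2 [:: b]) k.+3 v) k.+2 [::] k.+3 = v.
    by upd_val.
  have E2 : upd (upd (upd (S u acc) k.+2 [:: b]) k.+3 v) k.+2 [::] k.+1 = acc.
    by rewrite /S; upd_val.
  rewrite E1 E2 upd_eq in B4.
  have E3 : upd (upd (upd (upd (upd (S u acc) k.+2 [:: b]) k.+3 v) k.+2 [::]) k.+3 [::]) k.+1 v = S u v.
    have e2 : S u acc k.+2 = [::] by rewrite /S; upd_val; rewrite nk //; lia.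
    have e3 : S u acc k.+3 = [::] by rewrite /S; upd_val; rewrite nk //; lia.
    apply: store_ext => r; rewrite /S /upd; case: eqP => // n1.
    by case: eqP => [->|n3]; [case: eqP => [|_]; [lia|rewrite nk //; lia]|
       case: eqP => [->|//]; case: eqP => [|_]; [lia|rewrite nk //; lia]].
  rewrite E3 in B4.
  have {B4} B4 := B4 ltac:(lia) ltac:(lia) ltac:(lia) erefl.
  have [t1 ht1 ex1] := execb_seq B1 (execb_seq B2 (execb_seq B3 B4)).
  exists (t1.+2 + t2).
    move: ht1 ht2 ha hn; rewrite [j.+1 * C _]mulSn; set X := j * _; rewrite /C /=.
    move: (size acc) (size v) (N _) (_ ^ c0) X => ? ? ? ? ?; lia.
  apply: EWhileS ex1 ex2; have -> : S (b :: u) acc k = b :: u by rewrite /S; upd_val.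
  by [].
have := @exec_replace k k.+1 k.+2 (S [::] (foldl (fun acc b => G (a ++ [:: acc; [:: b]])) (I a) w)).
have hw := hacc' (size w); rewrite take_size in hw; set v := foldl _ _ _ in hw *.
have -> : S [::] v k = [::] by rewrite /S; upd_val.
have -> : S [::] v k.+1 = v by rewrite /S upd_eq.
have -> : upd (upd (S [::] v) k.+1 [::]) k v = upd (st a) k v.
  apply: store_ext => r; rewrite /S /upd; case: eqP => // _.
  by case: eqP => // ->; rewrite nk.
have e2 : S [::] v k.+2 = [::] by rewrite /S; upd_val; rewrite nk //; lia.
move=> H; have {}H := H ltac:(lia) ltac:(lia) ltac:(lia) e2.
by apply: execbW H; rewrite /=; lia.
Qed.

Lemma PT_gap k d m P : PT (k + m) P ->
  PT (k + d + m) (fun a => P (take k a ++ drop (k + d) a)).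
Proof.
move=> [p [c h]].
apply: (@PT_intro _ _ (ren (gap k d) p) _ _ (poly_le_exp c) (poly_le_exp c)) => a sa.
have st_ : size (take k a ++ drop (k + d) a) = k + m.
  by rewrite size_cat size_drop size_takel sa; lia.
have [e s] := h _ st_.
have le : (tot (take k a ++ drop (k + d) a)).+2 ^ c <= (tot a).+2 ^ c.
  case: c {h e s} => // c; rewrite leq_exp2r // !ltnS.
  rewrite -{3}(cat_take_drop k a) !tot_cat leq_add2l addnC -drop_drop; exact: tot_drop.
split; last exact: leq_trans s le.
have -> : k + d + m = gap k d (size (take k a ++ drop (k + d) a)) by rewrite st_ /gap; case: ltnP; lia.
apply: execbW le _; apply: execb_call => //; first exact: gap_inj.
move=> r /=; rewrite /st /gap nth_cat size_takel; last by rewrite sa; lia.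
by case: ltnP => hr; [rewrite nth_take|rewrite nth_drop; congr nth; lia].
Qed.

Lemma PT_foldl k F I G g c0 : PT k F -> PT k I -> PT k.+2 G ->
  (forall a acc b, size a = k -> G (a ++ [:: acc; [:: b]]) = g a acc b) ->
  (forall a i, size a = k -> size (foldl (g a) (I a) (take i (F a))) <= (tot a).+2 ^ c0) ->
  PT k (fun a => foldl (g a) (I a) (F a)).
Proof.
move=> hF hI hG e hb.
have E a w : size a = k -> foldl (fun acc b => G (a ++ [:: acc; [:: b]])) (I a) w = foldl (g a) (I a) w.
  by move=> sa; elim: w (I a) => //= b w IH acc; rewrite e.
apply: PT_ext (PT_fold hF hI hG (c0 := c0) _) => a; first by move=> sa; rewrite E.
by move=> i sa; rewrite E //; apply: hb.
Qed.

Lemma PT_size_le k F : PT k F -> exists c, forall a, size a = k -> size (F a) <= (tot a).+2 ^ c.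
Proof. by move=> [p [c h]]; exists c => a /h []. Qed.

Lemma nth_acc (a : seq word) x y k : size a = k -> nth [::] (a ++ [:: x; y]) k = x.
Proof. by move=> <-; rewrite nth_cat ltnn subnn. Qed.

Lemma nth_bit (a : seq word) x y k : size a = k -> nth [::] (a ++ [:: x; y]) k.+1 = y.
Proof. by move=> <-; rewrite nth_cat ltnNge leqnSn subSnn. Qed.

Definition ones n : word := nseq n true.

Lemma size_ones n : size (ones n) = n. Proof. exact: size_nseq. Qed.

Lemma ones_cat n m : ones n ++ ones m = ones (n + m).
Proof. by rewrite /ones nseqD. Qed.

Lemma onesSr n : ones n.+1 = rcons (ones n) true.
Proof. by rewrite -cats1 -addn1 -ones_cat. Qed.

Lemma size_foldl_le (g : word -> bool -> word) (d : nat) I w :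
  (forall acc b, size (g acc b) <= size acc + d) -> size (foldl g I w) <= size I + size w * d.
Proof.
move=> h; elim: w I => [|b w IH] I /=; first by rewrite addn0.
by apply: leq_trans (IH _) _; have := h I b; lia.
Qed.

(** If each round adds to the accumulator a length that is bounded in terms of the
    arguments alone, the accumulator stays polynomial by itself. *)
Lemma PT_foldl_slow k F I G g : PT k F -> PT k I -> PT k.+2 G ->
  (forall a acc b, size a = k -> G (a ++ [:: acc; [:: b]]) = g a acc b) ->
  (exists c, forall a acc b, size a = k -> size (g a acc b) <= size acc + (tot a).+2 ^ c) ->
  PT k (fun a => foldl (g a) (I a) (F a)).
Proof.
move=> hF hI hG e [c hc]; have [cF sF] := PT_size_le hF; have [cI sI] := PT_size_le hI.
have [d hd] : poly_le (fun n => n.+2 ^ cI + n.+2 ^ cF * n.+2 ^ c).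
  by apply: (poly_leD (poly_le_exp _)); apply: poly_leM; apply: poly_le_exp.
apply: (PT_foldl (c0 := d) hF hI hG e) => a i sa.
apply: leq_trans (hd (tot a)).
apply: leq_trans (size_foldl_le _ _ (d := (tot a).+2 ^ c) _) _; first by move=> *; apply: hc.
rewrite leq_add ?sI // leq_mul // (leq_trans _ (sF a sa)) //.
by rewrite size_take_min geq_minr.
Qed.

Lemma PT_catones k F H : PT k F -> PT k H -> PT k (fun a => ones (size (F a)) ++ H a).
Proof.
move=> hF hH; apply: PT_ext (PT_foldl_slow (G := fun e => true :: nth [::] e k)
   (g := fun _ acc _ => true :: acc) hF hH _ _ _).
- move=> a sa; elim: (F a) (H a) => //= _ w IH y; rewrite IH.
  by elim: (size w) => //= n ->.
- by apply: PT_cons; apply: PT_arg.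
- by move=> a acc b sa; rewrite nth_acc.
- by exists 0 => a acc b _ /=; rewrite expn0 addn1.
Qed.

(** Numbers are computed in unary, so that all polynomially bounded arithmetic is
    by loops along words. *)
Definition PN k (F : seq word -> nat) := PT k (fun a => ones (F a)).

Lemma PN_ext k F G : (forall a, size a = k -> F a = G a) -> PN k F -> PN k G.
Proof. by move=> e; apply: PT_ext => a sa; rewrite e. Qed.

Lemma PN_size k F : PT k F -> PN k (fun a => size (F a)).
Proof.
move=> h; apply: PT_ext (PT_catones h (PT_nil k)) => a _; exact: cats0.
Qed.

Lemma PN_const k c : PN k (fun=> c). Proof. exact: PT_const. Qed.

Lemma PN_add k F G : PN k F -> PN k G -> PN k (fun a => F a + G a).
Proof.
move=> hF hG; apply: PT_ext (PT_catones hF hG) => a _.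
by rewrite size_ones ones_cat.
Qed.

Lemma PT_drop k F H : PT k F -> PT k H -> PT k (fun a => drop (size (F a)) (H a)).
Proof.
move=> hF hH; apply: PT_ext (PT_foldl_slow (G := fun e => behead (nth [::] e k))
   (g := fun _ acc _ => behead acc) hF hH _ _ _).
- by move=> a sa; elim: (F a) (H a) => [|b w IH] y /=; rewrite ?drop0 // IH -drop1 drop_drop addn1.
- by apply: PT_behead; apply: PT_arg.
- by move=> a acc b sa; rewrite nth_acc.
- by exists 0 => a acc b _ /=; rewrite size_behead; lia.
Qed.

Lemma drop_ones n m : drop n (ones m) = ones (m - n).
Proof. exact: drop_nseq. Qed.

Lemma PN_sub k F G : PN k F -> PN k G -> PN k (fun a => F a - G a).
Proof.
by move=> hF hG; apply: PT_ext (PT_drop hG hF) => a _; rewrite size_ones drop_ones.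
Qed.

Lemma PN_mul k F G : PN k F -> PN k G -> PN k (fun a => F a * G a).
Proof.
move=> hF hG; have [c hc] := PT_size_le hF.
apply: PT_ext (PT_foldl_slow (G := fun e => ones (size (ones (F (take k e)))) ++ nth [::] e k)
   (g := fun a acc _ => ones (F a) ++ acc) hG (PT_nil k) _ _ _).
- move=> a sa; move: (F a) => m; have E n u : foldl (fun acc _ => ones m ++ acc) (ones u) (ones n) = ones (u + m * n).
    elim: n u => [|n IH] u /=; first by rewrite muln0 addn0.
    by rewrite ones_cat IH mulnS; congr ones; lia.
  exact: (E _ 0).
- by have h := PT_weak2 hF; apply: (PT_catones h); apply: PT_arg.
- by move=> a acc b sa; rewrite nth_acc // take_size_cat // size_ones.
- exists c => a acc b sa; rewrite size_cat addnC leq_add2l; exact: hc.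
Qed.

Lemma PN_if k F G H : PN k F -> PN k G -> PN k H -> PN k (fun a => if F a is _.+1 then G a else H a).
Proof.
move=> hF hG hH; apply: PT_ext (PT_branch hF hG hG hH) => a _.
by case: (F a).
Qed.

Lemma PN_bit k F H : PT k F -> PN k H -> PN k (fun a => nth false (F a) (H a)).
Proof.
move=> hF hH; apply: PT_ext (PT_branch (PT_drop hH hF) (PN_const k 1) (PN_const k 0) (PN_const k 0)) => a _.
rewrite size_ones -[H a in RHS]addn0 -nth_drop.
by case: (drop _ _) => [|[] w].
Qed.

Lemma PT_rev k F : PT k F -> PT k (fun a => rev (F a)).
Proof.
move=> hF; apply: PT_ext (PT_foldl_slow (G := fun e => branch (nth [::] e k.+1) (true :: nth [::] e k) (false :: nth [::] e k) [::])
   (g := fun _ acc b => b :: acc) hF (PT_nil k) _ _ _).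
- move=> a sa; rewrite -[RHS]cats0 -catrevE; elim: (F a) [::] => //= b w IH y; exact: IH.
- by apply: PT_branch; do ?[apply: PT_cons]; try apply: PT_arg; try apply: PT_nil; lia.
- by move=> a acc b sa; rewrite (nth_acc _ _ sa) (nth_bit _ _ sa); case: b.
- by exists 0 => a acc b _ /=; rewrite expn0 addn1.
Qed.

Lemma PN_count k F : PT k F -> PN k (fun a => count id (F a)).
Proof.
move=> hF; apply: PT_ext (PT_foldl_slow (G := fun e => branch (nth [::] e k.+1) (true :: nth [::] e k) (nth [::] e k) [::])
   (g := fun _ acc b => if b then true :: acc else acc) hF (PT_nil k) _ _ _).
- move=> a sa; suff E u : foldl (fun acc b => if b then true :: acc else acc) (ones u) (F a) = ones (u + count id (F a)).
    exact: (E 0).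
  elim: (F a) u => [|b w IH] u /=; first by rewrite addn0.
  by case: b => /=; [rewrite addnCA add1n -addSn; apply: (IH u.+1)|rewrite IH].
- by apply: PT_branch; do ?[apply: PT_cons]; try apply: PT_arg; try apply: PT_nil; lia.
- by move=> a acc b sa; rewrite (nth_acc _ _ sa) (nth_bit _ _ sa); case: b.
- by exists 0 => a acc [] _ /=; rewrite expn0 addn1.
Qed.

(** The length of the accumulator tells the loop which index comes next. *)
Lemma PT_mkseq k F P : PN k F -> PN k.+1 P ->
  PT k (fun a => mkseq (fun i => P (rcons a (ones i)) != 0) (F a)).
Proof.
move=> hF hP; pose bit a i := P (rcons a (ones i)) != 0.
pose g a acc (_ : bool) := bit a (size acc) :: acc.
have E a n : foldl (g a) [::] (ones n) = rev (mkseq (bit a) n).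
  by elim: n => // n IH; rewrite onesSr foldl_rcons IH mkseqS rev_rcons /g size_rev size_mkseq.
suff h : PT k (fun a => foldl (g a) [::] (ones (F a))).
  by apply: PT_ext (PT_rev h) => a _; rewrite E revK.
have hq : PN k.+3 (fun e => P (rcons (take k e) (nth [::] e k.+2))).
  have := @PT_gap k 2 1 (fun a => ones (P a)); rewrite addn1 addn2 => /(_ hP).
  rewrite addn1; apply: PN_ext => a sa; congr P.
  by rewrite -cats1 (drop_nth [::]) ?sa // drop_oversize // sa.
have hs : PN k.+2 (fun e => size (nth [::] e k)) by apply: PN_size; apply: PT_arg.
have hl := PT_let hs hq.
have arg := PT_arg (ltnW (ltnSn k.+1)).
apply: (PT_foldl_slow hF (PT_nil k)
   (PT_branch hl (PT_cons true arg) (PT_nil _) (PT_cons false arg)) (g := g)).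
- move=> a acc b sa; rewrite (nth_acc _ _ sa) /g /bit.
  set e := a ++ _; have se : size e = k.+2 by rewrite size_cat sa addn2.
  rewrite nth_rcons se ltnn eqxx; have -> : take k (rcons e (ones (size acc))) = a.
    by rewrite -cats1 takel_cat ?se 1?ltnW // /e take_size_cat.
  by case: (P _).
- by exists 0 => a acc b _ /=; rewrite expn0 addn1.
Qed.

Lemma PN_leq k F G : PN k F -> PN k G -> PN k (fun a => F a <= G a).
Proof.
move=> hF hG; apply: PN_ext (PN_if (PN_sub hF hG) (PN_const k 0) (PN_const k 1)) => a _.
by rewrite /leq; case: (_ - _).
Qed.

Lemma PN_countP k F P : PN k F -> PN k.+1 P ->
  PN k (fun a => count (fun i => P (rcons a (ones i)) != 0) (iota 0 (F a))).
Proof.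
move=> hF hP; apply: PN_ext (PN_count (PT_mkseq hF hP)) => a _.
by rewrite /mkseq count_map.
Qed.

(** * Arithmetical formulas *)

(** A variable denotes the size of an argument; the bound variable of a
    quantifier or of a count at depth [k] is the argument [k], in unary. *)
Inductive uterm :=
  | UVar of nat
  | UCst of nat
  | UAdd of uterm & uterm
  | UMul of uterm & uterm
  | ULe of uterm & uterm
  | UIf of uterm & uterm & uterm
  | UBit of nat & uterm
  | UCnt of uterm & uterm.

Fixpoint ueval (a : seq word) (t : uterm) : nat :=
  match t with
  | UVar i => size (nth [::] a i)
  | UCst c => c
  | UAdd t u => ueval a t + ueval a u
  | UMul t u => ueval a t * ueval a u
  | ULe t u => ueval a t <= ueval a u
  | UIf t u v => if ueval a t is _.+1 then ueval a u else ueval a v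
  | UBit i t => nth false (nth [::] a i) (ueval a t)
  | UCnt t u => count (fun i => ueval (rcons a (ones i)) u != 0) (iota 0 (ueval a t))
  end.

Lemma PT_nth k i : PT k (fun a => nth [::] a i).
Proof.
case: (ltnP i k) => ik; first exact: PT_arg.
by apply: PT_ext (PT_nil k) => a sa; rewrite nth_default ?sa.
Qed.

Theorem PN_ueval t k : PN k (fun a => ueval a t).
Proof.
elim: t k => /= [i|c|t1 h1 t2 h2|t1 h1 t2 h2|t1 h1 t2 h2|t1 h1 t2 h2 t3 h3|i t h|t1 h1 t2 h2] k.
- exact: PN_size (PT_nth k i).
- exact: PN_const.
- exact: PN_add.
- exact: PN_mul.
- exact: PN_leq.
- exact: PN_if.
- exact: PN_bit (PT_nth k i) (h k).
- exact: PN_countP (h1 k) (h2 k.+1).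
Qed.

Definition UBool t := ULe (UCst 1) t.
Definition UNot t := ULe t (UCst 0).
Definition UAnd t u := UIf t (UBool u) (UCst 0).
Definition UOr t u := UIf t (UCst 1) (UBool u).
Definition UImp t u := UIf t (UBool u) (UCst 1).
Definition UEq t u := UAnd (ULe t u) (ULe u t).
Definition UEx t u := UBool (UCnt t u).
Definition UAll t u := UNot (UCnt t (UNot u)).

Definition holdsu (a : seq word) (t : uterm) : bool := ueval a t != 0.

Lemma holdsu_le a t u : holdsu a (ULe t u) = (ueval a t <= ueval a u).
Proof. by rewrite /holdsu /=; case: (_ <= _). Qed.

Lemma holdsu_not a t : holdsu a (UNot t) = ~~ holdsu a t.
Proof. by rewrite holdsu_le /= leqn0 /holdsu negbK. Qed.

Lemma holdsu_bool a t : holdsu a (UBool t) = holdsu a t.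
Proof. by rewrite holdsu_le /= lt0n. Qed.

Lemma holdsu_and a t u : holdsu a (UAnd t u) = holdsu a t && holdsu a u.
Proof. by rewrite /holdsu /=; case: (ueval a t) => [|n]; case: (ueval a u) => [|m]. Qed.

Lemma holdsu_or a t u : holdsu a (UOr t u) = holdsu a t || holdsu a u.
Proof. by rewrite /holdsu /=; case: (ueval a t) => [|n]; case: (ueval a u) => [|m]. Qed.

Lemma holdsu_imp a t u : holdsu a (UImp t u) = (holdsu a t ==> holdsu a u).
Proof. by rewrite /holdsu /=; case: (ueval a t) => [|n]; case: (ueval a u) => [|m]. Qed.

Lemma holdsu_eq a t u : holdsu a (UEq t u) = (ueval a t == ueval a u).
Proof. by rewrite holdsu_and !holdsu_le eqn_leq. Qed.

Lemma holdsu_bit a i t : holdsu a (UBit i t) = nth false (nth [::] a i) (ueval a t).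
Proof. by rewrite /holdsu /=; case: (nth false _ _). Qed.

Lemma holdsu_ex a t u :
  holdsu a (UEx t u) = has (fun i => holdsu (rcons a (ones i)) u) (iota 0 (ueval a t)).
Proof. by rewrite holdsu_bool has_count lt0n. Qed.

Lemma holdsu_all a t u :
  holdsu a (UAll t u) = all (fun i => holdsu (rcons a (ones i)) u) (iota 0 (ueval a t)).
Proof.
rewrite holdsu_not /holdsu /= -lt0n -has_count -all_predC; apply: eq_all => i /=.
by have := holdsu_not (rcons a (ones i)) u; rewrite /holdsu => ->; rewrite negbK.
Qed.

(** * From formulas to machines *)

Lemma PT_machine_bound c : poly_le (fun n => n.+2 ^ c + (3 * n + (14 * n.+2 ^ c + 1).+1).+1).
Proof.
apply: (poly_leW (B2 := fun n => n.+2 ^ c + (3 * n + (14 * n.+2 ^ c + 3)))); first by move=> n; lia.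
apply: (poly_leD (poly_le_exp _)); apply: poly_leD.
  exact: poly_leM (poly_le_const _) poly_le_id.
apply: (fun h => poly_leD h (poly_le_const _)); exact: poly_leM (poly_le_const _) (poly_le_exp _).
Qed.

Definition shifted_power (c : nat) : {poly nat} := (('X + 2%:P) ^+ c)%R.

Lemma shifted_powerE c n : (shifted_power c).[n]%R = n.+2 ^ c.
Proof.
rewrite /shifted_power horner_exp hornerD hornerX hornerC natn natrXE.
by rewrite natrDE addn2.
Qed.

(** A machine delivers its output on tape 0, which at first holds an argument. *)
Lemma PT_computable k F : PT k.+1 F -> exists (M : tm) (p : {poly nat}), forall a, size a = k.+1 ->
  result_within M p.[tot a]%R a = Some (F a).
Proof.
move=> [q [c h]]; have [d hd] := PT_machine_bound c.
pose r := Seq q (replace 0 k.+1 k.+2).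
exists (machine (compile (maxreg r) r)), (shifted_power d) => a sa.
have [e s] := h a sa; rewrite shifted_powerE.
have := @exec_replace 0 k.+1 k.+2 (st (rcons a (F a))) isT ltac:(lia) isT.
have -> : st (rcons a (F a)) k.+1 = F a by rewrite /st nth_rcons sa ltnn eqxx.
have -> : st (rcons a (F a)) k.+2 = [::] by rewrite /st nth_default // size_rcons sa.
have -> : st (rcons a (F a)) 0 = nth [::] a 0 by rewrite /st nth_rcons sa.
move=> /(_ erefl) h2; have [t ht ex] := execb_seq e h2.
have tn : t <= (tot a).+2 ^ d.
  apply: leq_trans ht (leq_trans _ (hd _)); have := size_nth_tot a 0; lia.
by rewrite (program_result ex tn) upd_eq.
Qed.

Theorem poly_time_rel_uterm (t : uterm) : poly_time_rel (fun x y => holdsu [:: x; y] t).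
Proof.
have [M [p h]] := PT_computable (PT_branch (PN_ueval t 2) (PT_const _ [:: true]) (PT_const _ [:: true]) (PT_const _ [:: false])).
exists M, p => x y; have := h [:: x; y] erefl; rewrite /tot /= addn0 => ->.
by rewrite /holdsu; case: (ueval _ _).
Qed.

(** * Plane sweeps *)

Section Sweep.
Variables V E : eqType.
Implicit Types (X Y A B L R P S : seq E) (v : V).

(** The sweep line meets a word of strands; passing the vertex of an event
    replaces the block of strands that end there by those that start there. *)
Definition event : eqType := (V * seq E * seq E)%type.

Inductive deriv : seq E -> seq event -> seq E -> Prop :=
  | Deriv0 X : deriv X [::] X
  | DerivS A B v L R evs Y :
      deriv (A ++ R ++ B) evs Y -> deriv (A ++ L ++ B) ((v, L, R) :: evs) Y.

Definition verts (evs : seq event) : seq V := [seq e.1.1 | e <- evs].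
Definition olds (evs : seq event) : seq E := flatten [seq e.1.2 | e <- evs].
Definition news (evs : seq event) : seq E := flatten [seq e.2 | e <- evs].
Definition inc (evs : seq event) : seq (V * E) :=
  flatten [seq [seq (e.1.1, l) | l <- e.1.2 ++ e.2] | e <- evs].

(** Same vertices and same incidences: the derivations differ only by the way
    the graph is laid out. *)
Definition sim (evs evs' : seq event) : Prop :=
  perm_eq (verts evs) (verts evs') /\ perm_eq (inc evs) (inc evs').

Lemma inc_cons e evs : inc (e :: evs) = [seq (e.1.1, l) | l <- e.1.2 ++ e.2] ++ inc evs.
Proof. by []. Qed.

Lemma inc_cat evs1 evs2 : inc (evs1 ++ evs2) = inc evs1 ++ inc evs2.
Proof. by rewrite /inc map_cat flatten_cat. Qed.

Lemma verts_cat evs1 evs2 : verts (evs1 ++ evs2) = verts evs1 ++ verts evs2.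
Proof. exact: map_cat. Qed.

Lemma news_cat evs1 evs2 : news (evs1 ++ evs2) = news evs1 ++ news evs2.
Proof. by rewrite /news map_cat flatten_cat. Qed.

Lemma olds_cat evs1 evs2 : olds (evs1 ++ evs2) = olds evs1 ++ olds evs2.
Proof. by rewrite /olds map_cat flatten_cat. Qed.

Lemma sim_refl evs : sim evs evs.
Proof. by split; apply: perm_refl. Qed.

Lemma sim_trans e1 e2 e3 : sim e1 e2 -> sim e2 e3 -> sim e1 e3.
Proof. by case=> h1 h2 [h3 h4]; split; [apply: perm_trans h3|apply: perm_trans h4]. Qed.

Lemma perm_sim e1 e2 : perm_eq e1 e2 -> sim e1 e2.
Proof. by move=> h; split; [apply: perm_map|apply: perm_flatten; apply: perm_map]. Qed.

Lemma sim_cat e1 e2 f1 f2 : sim e1 f1 -> sim e2 f2 -> sim (e1 ++ e2) (f1 ++ f2).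
Proof. by case=> h1 h2 [h3 h4]; split; rewrite ?verts_cat ?inc_cat perm_cat. Qed.

Lemma sim_cons v L R L' R' e1 e2 : perm_eq (L ++ R) (L' ++ R') -> sim e1 e2 ->
  sim ((v, L, R) :: e1) ((v, L', R') :: e2).
Proof.
by move=> h [h1 h2]; split; rewrite /= ?perm_cons // !inc_cons perm_cat // perm_map.
Qed.

Lemma sim_size e1 e2 : sim e1 e2 -> size e1 = size e2.
Proof. by case=> /perm_size; rewrite !size_map. Qed.

Lemma deriv_perm X evs Y : deriv X evs Y -> perm_eq (X ++ news evs) (olds evs ++ Y).
Proof.
elim=> {X evs Y} [X|A B v L R evs Y _ IH]; first by rewrite /= cats0 perm_refl.
apply/permP => p; have := permP IH p; rewrite /news /olds /= !count_cat; lia.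
Qed.

Lemma deriv_cat X evs1 Y evs2 Z : deriv X evs1 Y -> deriv Y evs2 Z -> deriv X (evs1 ++ evs2) Z.
Proof. by elim=> {X evs1 Y} //= A B v L R evs Y _ IH /IH; apply: DerivS. Qed.

Lemma deriv_ctx A B X evs Y : deriv X evs Y -> deriv (A ++ X ++ B) evs (A ++ Y ++ B).
Proof.
elim=> {X evs Y} [X|A' B' v L R evs Y _ IH]; first exact: Deriv0.
by have := @DerivS (A ++ A') (B' ++ B) v L R evs (A ++ Y ++ B); rewrite !catA in IH * => /(_ IH).
Qed.

Lemma deriv_inv X e evs Y : deriv X (e :: evs) Y ->
  exists A B, X = A ++ e.1.2 ++ B /\ deriv (A ++ e.2 ++ B) evs Y.
Proof.
move eq_evs: (e :: evs) => evs' h; case: h eq_evs => {X evs' Y} // A B v L R evs' Y h [-> ->].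
by exists A, B.
Qed.

Lemma deriv_nil X Y : deriv X [::] Y -> X = Y.
Proof. by move eq_evs: [::] => evs h; case: h eq_evs. Qed.

Lemma deriv_split X evs1 evs2 Z : deriv X (evs1 ++ evs2) Z ->
  exists2 Y, deriv X evs1 Y & deriv Y evs2 Z.
Proof.
elim: evs1 X => [|[[v L] R] evs1 IH] X /= h; first by exists X => //; apply: Deriv0.
have [A [B [-> /IH[Y h1 h2]]]] := deriv_inv h.
by exists Y => //; apply: DerivS.
Qed.

(** The two symmetries of a sweep, exchanging left and right or above and below,
    reduce four kinds of rotations to one. *)
Definition flip (evs : seq event) : seq event := rev [seq (e.1.1, e.2, e.1.2) | e <- evs].
Definition vmir (evs : seq event) : seq event := [seq (e.1.1, rev e.1.2, rev e.2) | e <- evs].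

Lemma flip_cons e evs : flip (e :: evs) = rcons (flip evs) (e.1.1, e.2, e.1.2).
Proof. by rewrite /flip /= rev_cons. Qed.

Lemma deriv_flip X evs Y : deriv X evs Y -> deriv Y (flip evs) X.
Proof.
elim=> {X evs Y} [X|A B v L R evs Y _ IH]; first exact: Deriv0.
rewrite flip_cons -cats1; apply: deriv_cat IH _; apply: DerivS; exact: Deriv0.
Qed.

Lemma deriv_vmir X evs Y : deriv X evs Y -> deriv (rev X) (vmir evs) (rev Y).
Proof.
elim=> {X evs Y} [X|A B v L R evs Y _ IH]; first exact: Deriv0.
by move: IH; rewrite !rev_cat -!catA; apply: DerivS.
Qed.

Lemma sim_flip evs : sim evs (flip evs).
Proof.
split; rewrite /flip; first by rewrite /verts map_rev -map_comp perm_sym perm_rev.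
rewrite /inc map_rev perm_sym; apply: perm_trans (perm_flatten _) _; first by rewrite perm_rev; exact: perm_refl.
rewrite -map_comp; elim: evs => //= e evs IH; rewrite perm_cat // perm_map //.
by rewrite perm_catC.
Qed.

Lemma sim_vmir evs : sim evs (vmir evs).
Proof.
split; first by rewrite /verts /vmir -map_comp.
rewrite /inc -map_comp; elim: evs => //= e evs IH; rewrite perm_cat // perm_map //.
by apply: perm_cat; rewrite perm_sym perm_rev.
Qed.

Lemma size_flip evs : size (flip evs) = size evs.
Proof. by rewrite size_rev size_map. Qed.

Lemma size_vmir evs : size (vmir evs) = size evs.
Proof. by rewrite size_map. Qed.

Lemma inc_labels evs : perm_eq [seq x.2 | x <- inc evs] (olds evs ++ news evs).
Proof.
elim: evs => //= e evs IH; rewrite inc_cons map_cat -map_comp map_id.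
by apply/permP=> p; have := permP IH p; rewrite /olds /news /= !count_cat; lia.
Qed.

(** Every label occurs once where it starts and once where it ends, so the labels
    are determined by the incidences and the two boundary words. *)
Lemma sim_labels X evs Y X' evs' Y' : deriv X evs Y -> deriv X' evs' Y' -> sim evs evs' ->
  perm_eq (X ++ Y) (X' ++ Y') -> perm_eq (X ++ news evs) (X' ++ news evs').
Proof.
move=> d d' [_ hi] hXY; apply/permP=> p.
have h1 := permP (deriv_perm d) p; have h2 := permP (deriv_perm d') p.
have h3 := permP (inc_labels evs) p; have h4 := permP (inc_labels evs') p.
have h5 := permP (perm_map snd hi) p; have h6 := permP hXY p.
rewrite h3 h4 in h5; move: h1 h2 h5 h6; rewrite !count_cat; lia.
Qed.

Lemma cat_uniq_inj P r S P' S' : P ++ r :: S = P' ++ r :: S' -> uniq (P ++ r :: S) ->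
  P = P' /\ S = S'.
Proof.
move=> e u; have u' : uniq (P' ++ r :: S') by rewrite -e.
have H Q T : uniq (Q ++ r :: T) -> index r (Q ++ r :: T) = size Q.
  rewrite cat_uniq /= negb_or => /and3P[_ /andP[h _] _].
  by rewrite index_cat (negbTE h) /= eqxx addn0.
have s : size P = size P' by rewrite -(H _ _ u) -(H _ _ u') e.
by move/eqP: e; rewrite eqseq_cat // eqseq_cons => /and3P[/eqP -> _ /eqP ->].
Qed.

Definition fresh X evs := uniq (X ++ news evs).

Lemma fresh_step A L B v R evs : fresh (A ++ L ++ B) ((v, L, R) :: evs) -> fresh (A ++ R ++ B) evs.
Proof.
rewrite /fresh /news /=; rewrite (perm_uniq (s2 := L ++ (A ++ R ++ B) ++ flatten [seq e.2 | e <- evs])).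
  by rewrite cat_uniq => /and3P[].
by apply/permP=> p; rewrite !count_cat; lia.
Qed.

Lemma fresh_uniq X evs : fresh X evs -> uniq X.
Proof. by rewrite /fresh cat_uniq => /and3P[]. Qed.

(** Until the strand [r] ends it separates the plane, so that the events above it
    and those below it can be carried out one group after the other. *)
Lemma consume evs P r S Y : deriv (P ++ r :: S) evs Y -> fresh (P ++ r :: S) evs -> r \notin Y ->
  exists evsP evsS A L1 L2 B v R rest,
    [/\ deriv P evsP (A ++ L1), deriv S evsS (L2 ++ B), deriv (A ++ R ++ B) rest Y &
        perm_eq evs (evsP ++ evsS ++ (v, L1 ++ r :: L2, R) :: rest)].
Proof.
elim: evs P S => [|[[v L] R] evs IH] P S d f rY.
  by move: rY; rewrite -(deriv_nil d) mem_cat inE eqxx orbT.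
have [A [B [/= eX d']]] := deriv_inv d; rewrite eX in f.
have f' := fresh_step f; have u := fresh_uniq f; rewrite -eX in u.
have rX : r \in A ++ L ++ B by rewrite -eX mem_cat inE eqxx orbT.
move: rX; rewrite !mem_cat => /or3P[rA|rL|rB].
- case/splitPr: rA eX d' f' => A1 A2; rewrite -!catA !cat_cons => eX d' f'.
  have [eP eS] := cat_uniq_inj eX u; rewrite -eP in d' f'.
  have [evsP [evsS [A' [L1 [L2 [B' [v' [R' [rest [h1 h2 h3 h4]]]]]]]]]] := IH _ _ d' f' rY.
  exists evsP, ((v, L, R) :: evsS), A', L1, L2, B', v', R', rest; split=> //.
    by rewrite eS; apply: DerivS.
  by apply/permP=> p; have := permP h4 p; rewrite /= !count_cat /= ?count_cat /=; lia.
- case/splitPr: rL eX d' f f' => L1 L2; rewrite -!catA !cat_cons catA => eX d' f f'.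
  have [eP eS] := cat_uniq_inj eX u.
  by exists [::], [::], A, L1, L2, B, v, R, evs; rewrite eP eS; split=> //; apply: Deriv0.
- case/splitPr: rB eX d' f' => B1 B2; rewrite !catA => eX d' f'.
  have [eP eS] := cat_uniq_inj eX u; rewrite -eS in d' f'.
  have [evsP [evsS [A' [L1 [L2 [B' [v' [R' [rest [h1 h2 h3 h4]]]]]]]]]] := IH _ _ d' f' rY.
  exists ((v, L, R) :: evsP), evsS, A', L1, L2, B', v', R', rest; split=> //.
    by rewrite eP -catA; apply: DerivS; rewrite catA.
  by apply/permP=> p; have := permP h4 p; rewrite /= !count_cat /= ?count_cat /=; lia.
Qed.

(** The top strand [r], which comes in from the left, may instead leave to the
    right; only the layout of the rest changes. *)
Definition rotatable n := forall evs r X Y, size evs <= n ->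
  deriv (r :: X) evs Y -> fresh (r :: X) evs -> r \notin Y ->
  exists2 evs', deriv X evs' (r :: Y) & sim evs evs'.

(** Rotating a block strand by strand reverses it; the four versions are for
    blocks at the top or the bottom, going from left to right or back. *)
Lemma rotates_TL n : rotatable n -> forall evs P X Y, size evs <= n ->
  deriv (P ++ X) evs Y -> fresh (P ++ X) evs -> ~~ has (mem P) Y ->
  exists2 evs', deriv X evs' (rev P ++ Y) & sim evs evs'.
Proof.
move=> hr evs P; elim: P evs => [|r P IH] evs X Y sz d f dis.
  by exists evs => //; apply: sim_refl.
have [rY PY] : r \notin Y /\ ~~ has (mem P) Y.
  split; first by apply: contra dis => rY; apply/hasP; exists r => //=; rewrite inE eqxx.
  by apply: contra dis => /hasP[x xY xP]; apply/hasP; exists x => //=; rewrite inE; apply/orP; right.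
have [evs1 d1 s1] := hr _ _ _ _ sz d f rY.
have f1 : fresh (P ++ X) evs1.
  have : perm_eq ((r :: P ++ X) ++ news evs) ((P ++ X) ++ news evs1).
    apply: sim_labels d d1 s1 _; apply/permP=> p; rewrite /= !count_cat /= ?count_cat /=; lia.
  by rewrite /fresh => /perm_uniq <-.
have PrY : ~~ has (mem P) (r :: Y).
  rewrite /= negb_or PY andbT; move: (fresh_uniq f); rewrite /= mem_cat negb_or.
  by case/andP=> /andP[].
have [|evs2 d2 s2] := IH evs1 X (r :: Y) _ d1 f1 PrY; first by rewrite -(sim_size s1).
exists evs2; last exact: sim_trans s1 s2.
by rewrite rev_cons cat_rcons.
Qed.

Lemma fresh_flip X evs Y : deriv X evs Y -> fresh X evs -> fresh Y (flip evs).
Proof.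
move=> d; rewrite /fresh (perm_uniq (sim_labels d (deriv_flip d) (sim_flip evs) _)) //.
by rewrite perm_catC.
Qed.

Lemma fresh_vmir X evs Y : deriv X evs Y -> fresh X evs -> fresh (rev X) (vmir evs).
Proof.
move=> d; rewrite /fresh (perm_uniq (sim_labels d (deriv_vmir d) (sim_vmir evs) _)) //.
by apply: perm_cat; rewrite perm_sym perm_rev.
Qed.

Lemma rotates_BL n : rotatable n -> forall evs P X Y, size evs <= n ->
  deriv (X ++ P) evs Y -> fresh (X ++ P) evs -> ~~ has (mem P) Y ->
  exists2 evs', deriv X evs' (Y ++ rev P) & sim evs evs'.
Proof.
move=> hr evs P X Y sz d f dis.
have d1 := deriv_vmir d; have f1 := fresh_vmir d f; rewrite rev_cat in d1 f1.
have [||evs2 d2 s2] := rotates_TL hr _ d1 f1; first by rewrite size_vmir.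
  by rewrite has_rev (eq_has (a2 := mem P)) // => x; rewrite /= mem_rev.
exists (vmir evs2); first by have := deriv_vmir d2; rewrite revK rev_cat !revK.
by apply: sim_trans (sim_vmir _) (sim_trans s2 (sim_vmir _)).
Qed.

Lemma rotates_TR n : rotatable n -> forall evs P X Y, size evs <= n ->
  deriv X evs (P ++ Y) -> fresh X evs -> ~~ has (mem P) X ->
  exists2 evs', deriv (rev P ++ X) evs' Y & sim evs evs'.
Proof.
move=> hr evs P X Y sz d f dis.
have d1 := deriv_flip d; have f1 := fresh_flip d f.
have [|//|evs2 d2 s2] := rotates_TL hr _ d1 f1; first by rewrite size_flip.
exists (flip evs2); first exact: deriv_flip d2.
by apply: sim_trans (sim_flip _) (sim_trans s2 (sim_flip _)).
Qed.

Lemma rotates_BR n : rotatable n -> forall evs P X Y, size evs <= n ->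
  deriv X evs (Y ++ P) -> fresh X evs -> ~~ has (mem P) X ->
  exists2 evs', deriv (X ++ rev P) evs' Y & sim evs evs'.
Proof.
move=> hr evs P X Y sz d f dis.
have d1 := deriv_flip d; have f1 := fresh_flip d f.
have [|//|evs2 d2 s2] := rotates_BL hr _ d1 f1; first by rewrite size_flip.
exists (flip evs2); first exact: deriv_flip d2.
by apply: sim_trans (sim_flip _) (sim_trans s2 (sim_flip _)).
Qed.

(** Let [r] end at [v]. What lies above [r] sends strands [L1] to [v] and strands
    [A] past [v]. Sweep first what lies below [r], up to [v]; let [v] emit [r] and
    [L1] instead of receiving them; then sweep what was above [r] from [L1] to
    [A]. This last part is a rotation of a shorter sweep, available by
    induction. *)
Lemma rotatableP n : rotatable n.
Proof.
elim: n => [|n IH] evs r X Y sz d f rY.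
  case: evs d sz f => // d _ _; exfalso.
  by move: rY; rewrite -(deriv_nil d) inE eqxx.
have [evsP [evsS [A [L1 [L2 [B [v [R [rest [d1 d2 d3 pm]]]]]]]]]] := consume (P := [::]) d f rY.
have szP : size evsP <= n.
  by move: sz; rewrite (perm_size pm) !size_cat /=; lia.
have fP : fresh [::] evsP.
  move: f; rewrite /fresh /= => /andP[_]; rewrite cat_uniq => /and3P[_ _].
  rewrite (perm_uniq (perm_flatten (perm_map snd pm))) map_cat flatten_cat cat_uniq.
  by case/and3P.
have [//|evsP' d1' s1] := rotates_BR IH szP d1 fP.
exists (evsS ++ (v, L2, r :: rev L1 ++ R) :: evsP' ++ rest).
  apply: deriv_cat d2 _; apply: (@DerivS [::] B v L2 (r :: rev L1 ++ R)).
  rewrite /= -catA; apply: (@deriv_cat _ _ ([:: r] ++ (A ++ R ++ B) ++ [::])).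
    by have := deriv_ctx [:: r] (R ++ B) d1'; rewrite cats0.
  by have := deriv_ctx [:: r] [::] d3; rewrite !cats0.
apply: sim_trans (perm_sim pm) _; apply: sim_trans (_ : sim _ (evsS ++ (v, L1 ++ r :: L2, R) :: evsP ++ rest)) _.
  by apply: perm_sim; apply/permP=> p; rewrite !count_cat /= !count_cat; lia.
apply: sim_cat; first exact: sim_refl.
apply: sim_cons; last by apply: sim_cat => //; apply: sim_refl.
by apply/permP=> p; rewrite !count_cat /= !count_cat count_rev; lia.
Qed.

Lemma rotate_TL evs P X Y : deriv (P ++ X) evs Y -> fresh (P ++ X) evs -> ~~ has (mem P) Y ->
  exists2 evs', deriv X evs' (rev P ++ Y) & sim evs evs'.
Proof. exact: (rotates_TL (@rotatableP _) (leqnn _)). Qed.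

Lemma rotate_BL evs P X Y : deriv (X ++ P) evs Y -> fresh (X ++ P) evs -> ~~ has (mem P) Y ->
  exists2 evs', deriv X evs' (Y ++ rev P) & sim evs evs'.
Proof. exact: (rotates_BL (@rotatableP _) (leqnn _)). Qed.

Lemma rotate_TR evs P X Y : deriv X evs (P ++ Y) -> fresh X evs -> ~~ has (mem P) X ->
  exists2 evs', deriv (rev P ++ X) evs' Y & sim evs evs'.
Proof. exact: (rotates_TR (@rotatableP _) (leqnn _)). Qed.

Lemma rotate_BR evs P X Y : deriv X evs (Y ++ P) -> fresh X evs -> ~~ has (mem P) X ->
  exists2 evs', deriv (X ++ rev P) evs' Y & sim evs evs'.
Proof. exact: (rotates_BR (@rotatableP _) (leqnn _)). Qed.

Lemma fresh_sim X evs Y X' evs' Y' : deriv X evs Y -> deriv X' evs' Y' -> sim evs evs' ->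
  perm_eq (X ++ Y) (X' ++ Y') -> fresh X evs -> fresh X' evs'.
Proof. by move=> d d' s h; rewrite /fresh (perm_uniq (sim_labels d d' s h)). Qed.

Lemma fresh_split X evs1 evs2 Y : deriv X evs1 Y -> fresh X (evs1 ++ evs2) ->
  fresh X evs1 /\ fresh Y evs2.
Proof.
move=> d; rewrite /fresh news_cat catA => u; split; first by move: u; rewrite cat_uniq => /andP[].
move: u; rewrite (perm_uniq (s2 := olds evs1 ++ (Y ++ news evs2))).
  by rewrite cat_uniq => /and3P[].
by apply/permP=> p; have := permP (deriv_perm d) p; rewrite !count_cat; lia.
Qed.

(** Any vertex can be met first. The events before and after [a] are turned
    separately so that both have their loose strands on one side; the strands that
    pass [a] above and below then join the two parts behind [a]. *)
Lemma first_vertex evs a La Ra : deriv [::] evs [::] -> fresh [::] evs -> (a, La, Ra) \in evs ->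
  exists R evs', deriv R evs' [::] /\ sim evs ((a, [::], R) :: evs').
Proof.
move=> d f /splitPr ev; case: ev d f => E1 E2 d f.
have [Z d1 d2] := deriv_split d; have [A0 [B0 [/= eZ d3]]] := deriv_inv d2.
rewrite eZ {Z eZ} in d1 d2.
have [f1 f2] := fresh_split d1 f; have f3 := fresh_step f2.
have [//|e2 d4 s4] := rotate_TL d3 f3.
have f4 : fresh (Ra ++ B0) e2.
  by apply: fresh_sim d3 d4 s4 _ f3; apply/permP=> p; rewrite /= !count_cat count_rev; lia.
have uX := fresh_uniq f3.
have [|e3 d5 s5] := rotate_BL d4 f4.
  rewrite cats0; apply/hasP => -[x]; rewrite mem_rev => x1 /= x2.
  by move: uX; rewrite catA cat_uniq => /and3P[_ /hasP[]]; exists x => //=; rewrite mem_cat x1.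
rewrite cats0 in d4 d5.
have d1' : deriv [::] E1 ((A0 ++ La) ++ B0) by rewrite -catA.
have [//|e4 d6 s6] := rotate_TR d1' f1.
rewrite cats0 rev_cat in d6.
have f6 : fresh (rev La ++ rev A0) e4.
  by apply: fresh_sim d1 d6 s6 _ f1; apply/permP=> p; rewrite /= !count_cat !count_rev; lia.
have u2 : uniq (A0 ++ La ++ B0) := fresh_uniq f2.
have [|e5 d7 s7] := rotate_BR (Y := [::]) d6 f6.
  apply/hasP => -[x]; rewrite mem_cat !mem_rev => x1 /= x2; move: u2; rewrite catA cat_uniq.
  by case/and3P=> _ /hasP[]; exists x => //=; rewrite mem_cat orbC.
exists (rev La ++ Ra), (e3 ++ e5); split.
  apply: (@deriv_cat _ _ (rev La ++ (rev A0 ++ rev B0))).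
    by have := deriv_ctx (rev La) [::] d5; rewrite !cats0.
  by rewrite catA.
apply: sim_trans (_ : sim _ ((a, La, Ra) :: (E2 ++ E1))) _.
  by apply: perm_sim; apply/permP=> p; rewrite !count_cat /= count_cat; lia.
apply: sim_cons; first by apply/permP=> p; rewrite /= !count_cat count_rev; lia.
apply: sim_cat; first exact: sim_trans s4 s5.
exact: sim_trans s6 s7.
Qed.

Definition merge (a b : V) (x : V * E) : V * E := (if x.1 == b then a else x.1, x.2).

(** Contraction of the edge [e]. Start the sweep at [a] and follow [e] to [b]. The
    strands that reach [b] from above and from below [e] can be made to start at
    [a] by rotating what lies above and below [e]; those that leave [b] follow
    along [e]. *)
Lemma contract evs a b e : deriv [::] evs [::] -> fresh [::] evs -> uniq (verts evs) ->
  a != b -> (a, e) \in inc evs -> (b, e) \in inc evs ->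
  (forall l, (a, l) \in inc evs -> (b, l) \in inc evs -> l = e) ->
  exists evs', [/\ deriv [::] evs' [::], fresh [::] evs', perm_eq (verts evs) (b :: verts evs') &
    perm_eq (inc evs') [seq merge a b x | x <- inc evs & x.2 != e]].
Proof.
move=> d f uv ab ea eb one.
have [evs1 [R [d1 f1 s1]]] : exists evs1 R, [/\ deriv [::] ((a, [::], R) :: evs1) [::],
    fresh [::] ((a, [::], R) :: evs1) & sim evs ((a, [::], R) :: evs1)].
  have /flattenP[/= s /mapP[[[v L] R] ev ->] /mapP[l _ [va _]]] := ea.
  rewrite /= in va; subst v; have [R' [evs' [d' s']]] := first_vertex d f ev.
  have d'' : deriv [::] ((a, [::], R') :: evs') [::] by apply: (@DerivS [::] [::] a [::] R'); rewrite cats0.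
  by exists evs', R'; split=> //; apply: fresh_sim d d'' s' _ f.
have mi := perm_mem s1.2.
have uv1 : uniq (a :: verts evs1) by have := uv; rewrite (perm_uniq s1.1).
have d2 : deriv R evs1 [::].
  have [A [B [e0 d2]]] := deriv_inv d1.
  by case: A B e0 d2 => // [] [] //= _; rewrite cats0.
have f2 : fresh R evs1 by have := @fresh_step [::] [::] [::] a R evs1 f1; rewrite cats0.
have na l : (a, l) \notin inc evs1.
  apply/flattenP=> -[/= s /mapP[ev evi ->] /mapP[l' _ [av _]]].
  by move: uv1 => /= /andP[/mapP[]]; exists ev.
have eR : e \in R.
  move: ea; rewrite mi inc_cons mem_cat (negbTE (na e)) orbF /=.
  by case/mapP=> l lR [->].
have aRP l : l \in R -> (a, l) \in inc evs.
  by move=> lR; rewrite mi inc_cons mem_cat /= map_f.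
case/splitPr: eR d2 f2 aRP s1 d1 f1 mi => R1 R2 d2 f2 aRP s1 d1 f1 mi {R}.
have [//|evsP [evsS [A [L1 [L2 [B [v [R [rest [h1 h2 h3 pm]]]]]]]]]] := consume d2 f2.
have pinc : perm_eq (inc evs1) (inc evsP ++ inc evsS ++
    [seq (v, l) | l <- (L1 ++ e :: L2) ++ R] ++ inc rest).
  apply: perm_trans (perm_sim pm).2 _; rewrite !inc_cat; exact: perm_refl.
have vl l : l \in (L1 ++ e :: L2) ++ R -> (v, l) \in inc evs1.
  by move=> lL; rewrite (perm_mem pinc) !(mem_cat (v, l)) (map_f (pair v) lL) !orbT.
have vi l : l \in L1 ++ e :: L2 -> (v, l) \in inc evs.
  by move=> lL; rewrite mi inc_cons mem_cat vl ?orbT // mem_cat lL.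
have va : a != v.
  by apply/eqP=> av; have := na e; rewrite av vl // !mem_cat inE eqxx !orbT.
have cR : uniq ((R1 ++ e :: R2) ++ news evs1) := f2.
have cn : count_mem e (news evs1) = 0.
  apply/count_memPn; move: cR; rewrite cat_uniq => /and3P[_ /hasPn h _].
  by apply/negP => /h /=; rewrite mem_cat inE eqxx orbT.
have uR := fresh_uniq f2.
have cR1 : count_mem e R1 = 0.
  by apply/count_memPn; move: uR; rewrite cat_uniq /= negb_or => /and3P[_ /andP[]].
have cR2 : count_mem e R2 = 0.
  by apply/count_memPn; move: uR; rewrite cat_uniq /= => /and3P[_ _ /andP[]].
have co : count_mem e (olds evs1) = 1.
  have := permP (deriv_perm d2) (pred1 e); rewrite cats0 !count_cat /= eqxx cn cR1 cR2 => <-.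
  by [].
have bi : (b, e) \in inc evs1.
  move: eb; rewrite mi inc_cons mem_cat => /orP[|//] /mapP[l _ [ba _]].
  by rewrite ba eqxx in ab.
have vi1 : (v, e) \in inc evs1.
  by apply: vl; rewrite !mem_cat inE eqxx !orbT.
(* A strand has only two ends, and [a] is one of those of [e]. *)
have bv : b = v.
  have : size [seq x <- inc evs1 | x.2 == e] = 1.
    rewrite size_filter; have := permP (inc_labels evs1) (pred1 e).
    by rewrite count_map count_cat co cn.
  have b1 : (b, e) \in [seq x <- inc evs1 | x.2 == e] by rewrite mem_filter eqxx.
  have v1 : (v, e) \in [seq x <- inc evs1 | x.2 == e] by rewrite mem_filter eqxx.
  move: b1 v1; move: [seq x <- inc evs1 | x.2 == e] => [//|z [|//]].
  by rewrite !inE => /eqP <- /eqP[->].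
subst v.
have pn : perm_eq (news evs1) (news (evsP ++ evsS ++ (b, L1 ++ e :: L2, R) :: rest)).
  exact: perm_flatten (perm_map _ pm).
have po : perm_eq (olds evs1) (olds (evsP ++ evsS ++ (b, L1 ++ e :: L2, R) :: rest)).
  exact: perm_flatten (perm_map (fun e => e.1.2) pm).
have newsC v' l r es : news ((v', l, r) :: es) = r ++ news es by [].
have oldsC v' l r es : olds ((v', l, r) :: es) = l ++ olds es by [].
have ce := permP po (pred1 e); rewrite co !olds_cat oldsC !count_cat /= eqxx in ce.
have cn' := permP pn (pred1 e); rewrite cn !news_cat newsC !count_cat in cn'.
have [zP zS zL zM zR] : [/\ count_mem e (olds evsP) = 0, count_mem e (olds evsS) = 0,
    count_mem e L1 = 0, count_mem e L2 = 0 & count_mem e (olds rest) = 0].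
  by move: ce; clear; case: (count_mem e L1) => [|?]; case: (count_mem e L2) => [|?]; split; lia.
have [yP yS yR yQ] : [/\ count_mem e (news evsP) = 0, count_mem e (news evsS) = 0,
    count_mem e R = 0 & count_mem e (news rest) = 0].
  by move: cn'; clear; split; lia.
have fP : fresh R1 evsP.
  move: f2; rewrite /fresh (perm_uniq (s2 := (R1 ++ news evsP) ++ (e :: R2) ++ news evsS ++ R ++ news rest)).
    by rewrite cat_uniq => /andP[].
  by apply/permP=> p; have := permP pn p; rewrite !news_cat newsC !count_cat; clear; lia.
have fS : fresh R2 evsS.
  move: f2; rewrite /fresh (perm_uniq (s2 := (R2 ++ news evsS) ++ R1 ++ [:: e] ++ news evsP ++ R ++ news rest)).
    by rewrite cat_uniq => /andP[].
  by apply/permP=> p; have := permP pn p; rewrite !news_cat newsC !count_cat /= ?count_cat; clear; lia.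
have [|evsP' hP sP] := rotate_BR h1 fP.
  apply/hasP=> -[l lR /= lL]; have le := one l (aRP l _) (vi l _).
  by rewrite !mem_cat lR lL in le; move: cR1; rewrite -(le isT isT) => /count_memPn; rewrite lR.
have [|evsS' hS sS] := rotate_TR h2 fS.
  apply/hasP=> -[l lR /= lL]; have le := one l (aRP l _) (vi l _).
  rewrite !mem_cat !inE lR lL !orbT in le.
  by move: cR2; rewrite -(le isT isT) => /count_memPn; rewrite lR.
pose evs' := (a, [::], R1 ++ rev L1 ++ R ++ rev L2 ++ R2) :: evsP' ++ evsS' ++ rest.
have d' : deriv [::] evs' [::].
  apply: (@DerivS [::] [::] a [::]); rewrite cats0 cat0s.
  apply: (@deriv_cat _ _ (A ++ R ++ rev L2 ++ R2)).
    by have := deriv_ctx [::] (R ++ rev L2 ++ R2) hP; rewrite /= -!catA.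
  apply: deriv_cat h3; have := deriv_ctx (A ++ R) [::] hS; rewrite !cats0 -!catA; exact.
have iE : perm_eq (inc evs) ([seq (a, l) | l <- R1 ++ e :: R2] ++ inc evsP ++ inc evsS ++
     [seq (b, l) | l <- (L1 ++ e :: L2) ++ R] ++ inc rest).
  apply: perm_trans s1.2 _; rewrite inc_cons /= perm_cat2l.
  exact: pinc.
have vE : perm_eq (verts evs) (a :: verts evsP ++ verts evsS ++ b :: verts rest).
  apply: perm_trans s1.1 _; rewrite /= perm_cons.
  by apply: perm_trans (perm_sim pm).1 _; rewrite !verts_cat.
have id_part es : count_mem e (olds es) = 0 -> count_mem e (news es) = 0 -> b \notin verts es ->
    [seq merge a b x | x <- inc es & x.2 != e] = inc es.
  move=> c1 c2 bn; rewrite (@eq_in_filter _ _ predT) => [|x xi].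
    rewrite filter_predT -[RHS]map_id; apply/eq_in_map => x xi; rewrite /merge; case: eqP => [xb|]; last by case: x {xi}.
    case/negP: bn; rewrite -xb; case/flattenP: xi => /= s /mapP[ev evi ->] /mapP[l _ ->] /=.
    exact: map_f.
  rewrite /=; apply/eqP => xe; have : e \in [seq x.2 | x <- inc es] by rewrite -xe map_f.
  by rewrite (perm_mem (inc_labels es)) mem_cat => /orP[]; apply/negP/count_memPn.
have sim_inc : perm_eq (inc evs') [seq merge a b x | x <- inc evs & x.2 != e].
  apply: (@perm_trans _ ([seq (a, l) | l <- R1 ++ rev L1 ++ R ++ rev L2 ++ R2] ++ inc evsP ++ inc evsS ++ inc rest)).
    rewrite /evs' inc_cons /= perm_cat2l !inc_cat; apply: perm_cat; first by rewrite perm_sym; apply: sP.2.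
    by apply: perm_cat => //; rewrite perm_sym; apply: sS.2.
  rewrite perm_sym; apply: perm_trans (perm_map _ (perm_filter _ iE)) _.
  have bn : b \notin verts evsP ++ verts evsS ++ verts rest.
    move: uv; rewrite (perm_uniq vE) /= => /andP[_].
    rewrite (perm_uniq (s2 := b :: verts evsP ++ verts evsS ++ verts rest)) => [/andP[]//|].
    by apply/permP=> p; rewrite /= !count_cat /=; clear; lia.
  rewrite !mem_cat !negb_or in bn; case/and3P: bn => bn1 bn2 bn3.
  rewrite !filter_cat !map_cat (id_part _ zP yP bn1) (id_part _ zS yS bn2) (id_part _ zR yQ bn3).
  have side v' s : count_mem e s = 0 ->
      [seq merge a b x | x <- [seq (v', l) | l <- s] & x.2 != e] = [seq (if v' == b then a else v', l) | l <- s].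
    move=> c; rewrite filter_map -map_comp; have -> : [seq l <- s | preim (pair v') (fun x => x.2 != e) l] = s.
      rewrite -[RHS]filter_predT; apply: eq_in_filter => l ls /=; apply/eqP => le.
      by move/count_memPn: c; rewrite -le ls.
    by apply: eq_map.
  rewrite !map_cons !filter_cat /= eqxx /= !map_cat !side //.
  rewrite (negbTE ab) eqxx !map_rev.
  by apply/permP=> p; rewrite !count_cat !count_rev; clear; lia.
exists evs'; split=> //.
  apply: count_mem_uniq => x; have : count_mem x (news evs') <= 1.
    have h1' := permP (inc_labels evs') (pred1 x); have h2' := permP (deriv_perm d') (pred1 x).
    have h1'' := permP (inc_labels evs) (pred1 x); have h2'' := permP (deriv_perm d) (pred1 x).
    have := permP (perm_map snd sim_inc) (pred1 x); rewrite h1' -map_comp count_map count_filter => h3'.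
    have : count_mem x (news evs) <= 1 by rewrite (count_uniq_mem _ f) leq_b1.
    have le : count (predI (preim (snd \o merge a b) (pred1 x)) (fun y => y.2 != e)) (inc evs) <=
        count (pred1 x) [seq y.2 | y <- inc evs].
      by rewrite count_map; apply: sub_count => y /= /andP[].
    have le2 : count_mem x (olds evs' ++ news evs') <= count_mem x (olds evs ++ news evs).
      by rewrite h3' -h1''; exact: le.
    by move: le2 h2' h2''; rewrite !cats0 /= !count_cat; clear; lia.
  rewrite -has_pred1 has_count; case: (count_mem x _) => [|[]] //.
apply: perm_trans vE _; rewrite perm_sym /evs' /= !verts_cat.
apply/permP=> p; have := permP sP.1 p; have := permP sS.1 p; rewrite /= !count_cat /= ?count_cat; clear; lia.
Qed.
End Sweep.

(** * Graphs with a plane sweep are closed under minors *)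

Section Minors.
Variable E : eqType.

(** Strands beyond the edges of [adj] are allowed, so that edges can be forgotten
    without a change of the sweep. *)
Definition sweeps (V : eqType) (evs : seq (event V E)) (vs : seq V) (adj : rel V) : Prop :=
  [/\ deriv [::] evs [::], fresh [::] evs, uniq (verts evs), perm_eq (verts evs) vs &
      forall a b, a \in vs -> b \in vs -> a != b -> adj a b ->
        exists2 l, (a, l) \in inc evs & (b, l) \in inc evs].

Definition sweepable (V : eqType) (vs : seq V) (adj : rel V) : Prop :=
  exists evs, sweeps evs vs adj.

Section OneType.
Variable V : eqType.
Implicit Types (evs : seq (event V E)) (vs : seq V) (adj : rel V).

Definition restrict (p : pred E) evs : seq (event V E) :=
  [seq (e.1.1, seq.filter p e.1.2, seq.filter p e.2) | e <- evs].

Lemma deriv_restrict p (X Y : seq E) evs : deriv X evs Y ->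
  deriv (seq.filter p X) (restrict p evs) (seq.filter p Y).
Proof.
elim=> {X evs Y} [X|A B v L R evs Y _ IH]; first exact: Deriv0.
by move: IH; rewrite !filter_cat; apply: DerivS.
Qed.

Lemma inc_restrict p evs : inc (restrict p evs) = [seq x <- inc evs | p x.2].
Proof.
rewrite /inc /restrict -map_comp; elim: evs => //= e evs ->.
by rewrite filter_cat; congr (_ ++ _); rewrite filter_map -filter_cat.
Qed.

Lemma verts_restrict p evs : verts (restrict p evs) = verts evs.
Proof. by rewrite /verts /restrict -map_comp. Qed.

Lemma news_restrict p evs : news (restrict p evs) = seq.filter p (news evs).
Proof. by rewrite /news /restrict -map_comp filter_flatten -map_comp. Qed.

Lemma count_label evs l : deriv [::] evs [::] -> fresh [::] evs ->
  size [seq x <- inc evs | x.2 == l] <= 2.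
Proof.
move=> d f; rewrite size_filter.
have -> : count (fun x => x.2 == l) (inc evs) = count_mem l [seq x.2 | x <- inc evs] by rewrite count_map.
have := permP (inc_labels evs) (pred1 l); have := permP (deriv_perm d) (pred1 l).
have : count_mem l (news evs) <= 1 by rewrite (count_uniq_mem _ f) leq_b1.
by rewrite cats0 !count_cat /=; lia.
Qed.

Lemma two_ends evs a b c l : deriv [::] evs [::] -> fresh [::] evs -> a != b ->
  (a, l) \in inc evs -> (b, l) \in inc evs -> (c, l) \in inc evs -> c = a \/ c = b.
Proof.
move=> d f ab ha hb hc; case: (eqVneq c a) => [|ca]; first by left.
case: (eqVneq c b) => [|cb]; first by right.
have : size [:: (a, l); (b, l); (c, l)] <= size [seq x <- inc evs | x.2 == l].
  apply: uniq_leq_size; first by rewrite /= !inE !xpair_eqE !eqxx !andbT /= negb_or ab eq_sym ca eq_sym cb.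
  by move=> x; rewrite !inE mem_filter => /or3P[]/eqP->; rewrite eqxx.
by move/leq_trans => /(_ _ (count_label l d f)).
Qed.

Definition contracted (a b : V) adj : rel V :=
  fun x y => [|| adj x y, (x == a) && adj b y | (y == a) && adj x b].

(** Parallel edges between [a] and [b] are deleted first, as they would become
    loops. *)
Lemma sweepable_contract vs adj a b : sweepable vs adj -> a \in vs -> b \in vs -> a != b ->
  adj a b -> sweepable (rem b vs) (contracted a b adj).
Proof.
case=> evs [d f u pv he] av bv ab abE.
have [e ea eb] := he _ _ av bv ab abE.
(* [p] keeps [e] alone among the strands that join [a] and [b]. *)
pose p l := (l == e) || ~~ (((a, l) \in inc evs) && ((b, l) \in inc evs)).
have d1 := deriv_restrict p d; have f1 : fresh [::] (restrict p evs).
  by rewrite /fresh news_restrict filter_uniq.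
have pe : p e by rewrite /p eqxx.
have uvs : uniq vs by rewrite -(perm_uniq pv).
have [||||l|evs' [d' f' pv' pi']] := @contract V E (restrict p evs) a b e d1 f1.
- by rewrite verts_restrict.
- by [].
- by rewrite inc_restrict mem_filter pe.
- by rewrite inc_restrict mem_filter pe.
- rewrite inc_restrict !mem_filter /= => /andP[+ h1] /andP[_ h2]; rewrite /p h1 h2 orbF.
  by move/eqP.
rewrite verts_restrict in pv'; rewrite inc_restrict in pi'.
have pvb : perm_eq (verts evs') (rem b vs).
  rewrite -(perm_cons b); apply: perm_trans (_ : perm_eq _ (verts evs)) _; first by rewrite perm_sym.
  by apply: perm_trans pv _; apply: perm_to_rem.
have mem_inc x y l : (x, l) \in inc evs -> (y, l) \in inc evs -> x != y -> l != e ->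
    y != a -> y != b -> (if x == b then a else x, l) \in inc evs' /\ (y, l) \in inc evs'.
  move=> xl yl xy le ya yb; have pl : p l.
    rewrite /p (negbTE le) /=; apply/andP => -[al bl].
    by case: (two_ends d f ab al bl yl) => /eqP; [rewrite (negbTE ya)|rewrite (negbTE yb)].
  split; rewrite (perm_mem pi'); apply/mapP.
    by exists (x, l); rewrite // !mem_filter /= le pl.
  by exists (y, l); rewrite ?mem_filter /= ?le ?pl // /merge /= (negbTE yb).
exists evs'; split=> //; first by have := u; rewrite (perm_uniq pv') => /= /andP[].
move=> x y; rewrite !(mem_rem_uniq _ uvs) !inE => /andP[xb xv] /andP[yb yv] xy.
have ne l z : (z, l) \in inc evs -> z != a -> z != b -> l != e.
  move=> zl za zb; apply/eqP => le; rewrite le in zl.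
  by case: (two_ends d f ab ea eb zl) => /eqP; [rewrite (negbTE za)|rewrite (negbTE zb)].
have main x' y' : x' \in vs -> y' \in vs -> y' != a -> y' != b -> x' != y' -> adj x' y' \/ adj y' x' ->
    exists2 l, (if x' == b then a else x', l) \in inc evs' & (y', l) \in inc evs'.
  move=> xv' yv' ya yb' xy' h; have [l h1 h2] : exists2 l, (x', l) \in inc evs & (y', l) \in inc evs.
    by case: h => h; [apply: he|have [|l ? ?] := he _ _ yv' xv' _ h; [rewrite eq_sym|exists l]].
  by have [h3 h4] := mem_inc x' y' l h1 h2 xy' (ne _ _ h2 ya yb') ya yb'; exists l.
case/or3P=> [xyE|/andP[/eqP xa byE]|/andP[/eqP ya xbE]].
- case: (eqVneq y a) => [ya|ya].
    have xa : x != a by rewrite -ya.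
    have [||l] := main y x yv xv xa xb; [by rewrite eq_sym|by right|].
    by rewrite (negbTE yb) => h1 h2; exists l.
  have [|l] := main x y xv yv ya yb xy; first by left.
  by rewrite (negbTE xb); exists l.
- have ya : y != a by rewrite -xa eq_sym.
  have [||l] := main b y bv yv ya yb; [by rewrite eq_sym|by left|].
  by rewrite eqxx xa; exists l.
- have xa : x != a by rewrite -ya.
  have [||l] := main b x bv xv xa xb; [by rewrite eq_sym|by right|].
  by rewrite eqxx ya => h1 h2; exists l.
Qed.

End OneType.

Section Branch.
Variables (V : eqType) (W : eqType) (phi : V -> W).
Implicit Types (vs : seq V) (adj : rel V).

(** The fibres of [phi] are connected, stated by closed sets so that it passes
    easily through a contraction. *)
Definition connected_fibres vs adj : Prop :=
  forall a (D : pred V), a \in vs -> D a ->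
    (forall p q, p \in vs -> q \in vs -> phi p = phi a -> phi q = phi a ->
       adj p q -> D p -> D q) ->
    forall q, q \in vs -> phi q = phi a -> D q.

Definition spans vs adj (G : rel W) : Prop :=
  forall u v, u != v -> G u v ->
    exists p q, [/\ p \in vs, q \in vs, phi p = u, phi q = v & adj p q].

Lemma sweepable_map vs adj (G : rel W) : {in vs &, injective phi} -> spans vs adj G ->
  sweepable vs adj -> sweepable (map phi vs) G.
Proof.
move=> inj sp [evs [d f u pv he]].
pose evs' := [seq ((phi e.1.1, e.1.2, e.2) : event W E) | e <- evs].
have incE : inc evs' = [seq (phi x.1, x.2) | x <- inc evs].
  rewrite /inc /evs' map_flatten -!map_comp; congr flatten; apply: eq_map => e /=.
  by rewrite -map_comp.
have vE : verts evs' = map phi (verts evs) by rewrite /verts /evs' -!map_comp.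
exists evs'; split.
- suff H X Y es : deriv X es Y -> deriv X [seq ((phi e.1.1, e.1.2, e.2) : event W E) | e <- es] Y by apply: H.
  by elim=> {X es Y} [X|A B v L R es Y _ IH]; [exact: Deriv0|exact: DerivS].
- by rewrite /fresh /news /evs' -map_comp.
- rewrite vE map_inj_in_uniq // => x y; rewrite !(perm_mem pv); exact: inj.
- by rewrite vE perm_map.
move=> a b _ _ ab abG; have [p [q [pv' qv' pa qb pq]]] := sp _ _ ab abG.
have [|l h1 h2] := he p q pv' qv' _ pq; first by apply: contraNneq ab => e; rewrite -pa -qb e.
rewrite -pa -qb.
by exists l; rewrite incE; [exact: (map_f (fun x => (phi x.1, x.2)) h1)|exact: (map_f (fun x => (phi x.1, x.2)) h2)].
Qed.

(** A graph whose vertices are connected, disjoint sets of vertices of a graph with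
    a sweep has a sweep: contract edges inside the fibres of [phi] until every
    fibre is one point. *)
Theorem sweepable_minor n vs adj (G : rel W) : size vs <= n -> symmetric adj ->
  sweepable vs adj -> connected_fibres vs adj -> spans vs adj G ->
  exists2 ws, (forall w, (w \in ws) = (w \in map phi vs)) & sweepable ws G.
Proof.
elim: n vs adj => [|n IH] vs adj sz sy sw cf sp.
  exists (map phi vs) => //; apply: sweepable_map sp sw => x y.
  by move: sz; rewrite leqn0 size_eq0 => /eqP->.
have uvs : uniq vs by case: sw => evs [_ _ u pv _]; rewrite -(perm_uniq pv).
case: (boolP (has (fun a => has (fun b => [&& a != b, phi a == phi b & adj a b]) vs) vs)).
  case/hasP=> a av /hasP[b bv /and3P[ab /eqP fab abE]].
  have sw' := sweepable_contract sw av bv ab abE.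
  have rb x : (x \in rem b vs) = (x != b) && (x \in vs) by rewrite mem_rem_uniq.
  have sz' : size (rem b vs) <= n by rewrite size_rem //; lia.
  pose pi x := if x == b then a else x.
  have phi_pi x : phi (pi x) = phi x by rewrite /pi; case: eqP => [->|].
  have pi_in x : x \in vs -> pi x \in rem b vs.
    by rewrite rb /pi => xv; case: (eqVneq x b) => [_|xb]; rewrite ?ab ?av ?xb ?xv.
  have pi_adj x y : adj x y -> pi x != pi y -> contracted a b adj (pi x) (pi y).
    rewrite /pi /contracted; case: (eqVneq x b) => [->|xb]; case: (eqVneq y b) => [->|yb] xyE.
    - by rewrite eqxx.
    - by rewrite eqxx xyE orbT.
    - by rewrite eqxx xyE !orbT.
    - by rewrite xyE.
  have [|||ws hw sww] := IH (rem b vs) (contracted a b adj) sz' _ sw'.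
  - move=> x y; rewrite /contracted sy [adj b y]sy [adj x b]sy.
    by congr (_ || _); rewrite orbC.
  - move=> c D; rewrite rb => /andP[cb cv] Dc cl q; rewrite rb => /andP[qb qv] fq.
    have := cf c (fun x => D (pi x)) cv _ _ q qv fq; rewrite /pi (negbTE cb) (negbTE qb).
    apply=> // x y xv yv fx fy xy; rewrite -/(pi x) -/(pi y).
    case: (eqVneq (pi x) (pi y)) => [-> //|ne]; apply: cl; rewrite ?phi_pi ?pi_in //.
    exact: pi_adj.
  - move=> x y xy xyG; have [p [q [pv qv px qy pq]]] := sp _ _ xy xyG.
    exists (pi p), (pi q); rewrite !phi_pi !pi_in //; split=> //; apply: pi_adj => //.
    by apply: contraNneq xy => e; rewrite -px -qy -(phi_pi p) -(phi_pi q) e.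
  exists ws => // w; rewrite hw; apply/mapP/mapP => -[x xv ->].
    by exists x => //; move: xv; rewrite rb => /andP[].
  by exists (pi x); rewrite ?phi_pi ?pi_in.
move/hasPn=> none; exists (map phi vs) => //; apply: sweepable_map sp sw => x y xv yv fxy.
have := cf x (pred1 x) xv (eqxx x) _ y yv (esym fxy) => /(_ _)/eqP -> //.
move=> p q pv qv fp fq pq /eqP px; subst p; apply: contraT => /= qx.
have /hasPn/(_ q qv) := none x xv; by rewrite eq_sym qx fq eqxx pq.
Qed.
End Branch.
End Minors.

(** * The square lattice *)

Section Delete.
Variables V E : eqType.
Implicit Types (evs : seq (event V E)).

Lemma mem_incP evs a l :
  reflect (exists2 e, e \in evs & e.1.1 = a /\ l \in e.1.2 ++ e.2) ((a, l) \in inc evs).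
Proof.
apply: (iffP flattenP) => [[/= s /mapP[e ei ->] /mapP[l' li [-> ->]]]|[e ei [<- li]]].
  by exists e.
by exists [seq (e.1.1, l) | l <- e.1.2 ++ e.2]; [apply/mapP; exists e|apply: map_f].
Qed.

Lemma deriv_drop (P : pred V) X evs Y :
  (forall e, e \in evs -> ~~ P e.1.1 -> e.1.2 = [::] /\ e.2 = [::]) ->
  deriv X evs Y -> deriv X [seq e <- evs | P e.1.1] Y.
Proof.
move=> h d; elim: d h => {X evs Y} [X _|A B v L R evs Y _ IH h]; first exact: Deriv0.
have {}IH : deriv (A ++ R ++ B) [seq e <- evs | P e.1.1] Y.
  by apply: IH => e ei; apply: h; rewrite inE ei orbT.
rewrite /=; case: (boolP (P v)) => [_|pv]; first exact: DerivS.
by have [] := h (v, L, R) (mem_head _ _) pv => /= -> eR; rewrite eR in IH.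
Qed.

(** Deleting vertices: the strands at a deleted vertex go, and its event, now
    without strands, can be left out. *)
Lemma sweepable_sub (P : pred V) (vs : seq V) (adj : rel V) :
  sweepable E vs adj -> sweepable E [seq x <- vs | P x] adj.
Proof.
move=> [evs [d f u pv he]].
pose q l := all (fun x => (x.2 == l) ==> P x.1) (inc evs).
pose evs' := [seq e <- restrict q evs | P e.1.1].
have vE : verts evs' = [seq x <- verts evs | P x].
  by rewrite -[verts evs](verts_restrict q) /evs' /verts; elim: (restrict q evs) => //= e es <-; case: ifP.
exists evs'; split.
- apply: deriv_drop (deriv_restrict q d) => e /mapP[[[v L] R] ei ->] /= pvv.
  have H s : {subset s <= L ++ R} -> seq.filter q s = [::].
    move=> hs; apply/eqP; rewrite -[_ == _]negbK -has_filter; apply/hasPn => l /hs li.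
    apply/negP => /allP/(_ (v, l)); rewrite /= eqxx (negbTE pvv) => /(_ _)/negP; apply=> //.
    by apply/mem_incP; exists (v, L, R).
  by split; apply: H => l li; rewrite mem_cat li ?orbT.
- move: f; rewrite /fresh /=; apply: subseq_uniq.
  apply: (@subseq_trans _ (news (restrict q evs))); last by rewrite news_restrict filter_subseq.
  rewrite /evs' /news; elim: (restrict q evs) => //= e es IH.
  by case: ifP => _ /=; [apply: cat_subseq|apply: subseq_trans IH (suffix_subseq _ _)].
- by rewrite vE filter_uniq.
- by rewrite vE; apply: perm_filter.
move=> a b; rewrite !mem_filter => /andP[pa av] /andP[pb bv] ab abE.
have [l al bl] := he a b av bv ab abE.
have ql : q l.
  apply/allP => -[c l'] ci /=; apply/implyP => /eqP e; subst l'.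
  by case: (two_ends d f ab al bl ci) => ->.
have H c : P c -> (c, l) \in inc evs -> (c, l) \in inc evs'.
  move=> pc cl; have : (c, l) \in inc (restrict q evs) by rewrite inc_restrict mem_filter ql.
  case/mem_incP=> e ei [ec li]; apply/mem_incP; exists e => //.
  by rewrite mem_filter ec pc.
by exists l; apply: H.
Qed.
End Delete.

Lemma uniq_flatten_key (T U : eqType) (F : T -> seq U) (k : U -> T) (s : seq T) :
  uniq s -> (forall x, uniq (F x)) -> (forall x l, l \in F x -> k l = x) ->
  uniq (flatten [seq F x | x <- s]).
Proof.
move=> us uF hk; elim: s us => //= x s IH /andP[xs us].
rewrite cat_uniq uF IH // andbT; apply/hasPn => l /flattenP[/= t /mapP[y ys ->] ly].
by apply/negP => /= lx; move: xs; rewrite -(hk _ _ lx) (hk _ _ ly) ys.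
Qed.

(** [(i, j, false)] is the edge that enters [(i, j)] from the left and
    [(i, j, true)] the one that enters it from below. *)
Definition lattice_edge : eqType := (nat * nat * bool)%type.

Definition lattice : rel (nat * nat) := fun a b =>
  [|| (a.1 == b.1) && (b.2 == a.2.+1), (a.1 == b.1) && (a.2 == b.2.+1),
      (a.2 == b.2) && (b.1 == a.1.+1) | (a.2 == b.2) && (a.1 == b.1.+1)].

Lemma lattice_sym : symmetric lattice.
Proof.
move=> [a1 a2] [b1 b2]; rewrite /lattice /= [b1 == a1]eq_sym [b2 == a2]eq_sym.
by do 4!case: (_ && _).
Qed.

Section Box.
Variables n m : nat.

(** The lattice is swept column by column, upwards in each column: an event
    receives the edges from below and from the left, in the order of the strands
    at that moment. *)
Definition column_event (i j : nat) : event (nat * nat)%type lattice_edge :=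
  ((i, j), [:: (i, j, true); (i, j, false)], [:: (i.+1, j, false); (i, j.+1, true)]).

Definition column (i k : nat) : seq lattice_edge := [seq (i, j, false) | j <- iota k (m - k)].

Lemma deriv_column i k : k <= m ->
  deriv ((i, k, true) :: column i k) [seq column_event i j | j <- iota k (m - k)]
    (column i.+1 k ++ [:: (i, m, true)]).
Proof.
rewrite /column; move e: (m - k) => d km; elim: d k e km => [|d IH] k e km.
  have -> : k = m by lia.
  exact: Deriv0.
have {}IH : deriv ((i, k.+1, true) :: [seq (i, j, false) | j <- iota k.+1 d])
    [seq column_event i j | j <- iota k.+1 d] ([seq (i.+1, j, false) | j <- iota k.+1 d] ++ [:: (i, m, true)]).
  by apply: IH; lia.
apply: (@DerivS _ _ [::] _ (i, k) [:: (i, k, true); (i, k, false)] [:: (i.+1, k, false); (i, k.+1, true)]).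
by have := deriv_ctx [:: (i.+1, k, false)] [::] IH; rewrite !cats0.
Qed.

(* The edges that stick out of the box are dropped. *)
Definition inner (l : lattice_edge) : bool := if l.2 then 0 < l.1.2 < m else 0 < l.1.1 < n.

Definition box_events :=
  restrict inner (flatten [seq [seq column_event i j | j <- iota 0 m] | i <- iota 0 n]).

Lemma deriv_box : deriv [::] box_events [::].
Proof.
have fc i : 0 < i < n -> seq.filter inner (column i 0) = column i 0.
  move=> ih; apply/all_filterP/allP => l /mapP[j _ ->]; exact: ih.
have fc0 i : ~~ (0 < i < n) -> seq.filter inner (column i 0) = [::].
  move=> ih; apply/eqP; rewrite -[_ == _]negbK -has_filter; apply/hasPn => l /mapP[j _ ->]; exact: ih.
suff H d i : i + d = n -> deriv (seq.filter inner (column i 0))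
    (restrict inner (flatten [seq [seq column_event i j | j <- iota 0 m] | i <- iota i d]))
    (seq.filter inner (column n 0)).
  by have := H n 0 erefl; rewrite !fc0 // ltnn ?andbF.
elim: d i => [|d IH] i e.
  have -> : i = n by lia.
  exact: Deriv0.
rewrite /restrict /= map_cat; apply: deriv_cat (IH i.+1 _); last by lia.
have := deriv_restrict inner (@deriv_column i 0 (leq0n _)).
by rewrite subn0 filter_cat /= /inner /= ltnn andbF cats0.
Qed.

Lemma box_eventsE : box_events = [seq ((x, seq.filter inner [:: (x.1, x.2, true); (x.1, x.2, false)],
    seq.filter inner [:: (x.1.+1, x.2, false); (x.1, x.2.+1, true)]) : event (nat * nat)%type lattice_edge)
    | x <- [seq (i, j) | i <- iota 0 n, j <- iota 0 m]].
Proof.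
rewrite /box_events /restrict map_flatten -map_comp map_flatten -map_comp; congr flatten.
by apply: eq_map => i /=; rewrite -!map_comp.
Qed.

Lemma sweepable_box : sweepable lattice_edge [seq (i, j) | i <- iota 0 n, j <- iota 0 m] lattice.
Proof.
set vs := [seq _ | i <- _, j <- _].
have uvs : uniq vs.
  by apply: allpairs_uniq; rewrite ?iota_uniq // => -[? ?] [? ?] _ _ /= [-> ->].
have vE : verts box_events = vs by rewrite box_eventsE /verts -map_comp map_id.
exists box_events; split; rewrite ?vE //; first exact: deriv_box.
  rewrite /fresh /= box_eventsE /news -map_comp.
  apply: (@uniq_flatten_key _ _ _ (fun l : lattice_edge => if l.2 then (l.1.1, l.1.2.-1) else (l.1.1.-1, l.1.2))) => //.
    by move=> [i j]; apply: filter_uniq; rewrite /= inE xpair_eqE andbF.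
  by move=> [i j] l; rewrite mem_filter !inE => /andP[_ /orP[]/eqP->].
have inb a : (a \in vs) = (a.1 < n) && (a.2 < m).
  case: a => i j; apply/allpairsP/andP => [[[i' j'] /= [+ + [-> ->]]]|[hi hj]]; rewrite ?mem_iota //.
  by exists (i, j); rewrite !mem_iota.
have H i j (l : lattice_edge) : (i, j) \in vs -> inner l ->
    l \in [:: (i, j, true); (i, j, false); (i.+1, j, false); (i, j.+1, true)] -> ((i, j), l) \in inc box_events.
  move=> ij il li; apply/mem_incP; rewrite box_eventsE.
  exists ((i, j), seq.filter inner [:: (i, j, true); (i, j, false)], seq.filter inner [:: (i.+1, j, false); (i, j.+1, true)]).
    by apply/mapP; exists (i, j).
  split=> //; change (l \in seq.filter inner [:: (i, j, true); (i, j, false)] ++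
    seq.filter inner [:: (i.+1, j, false); (i, j.+1, true)]).
  by rewrite -filter_cat mem_filter il.
move=> [i j] [i' j'] av bv _; move: (av) (bv); rewrite !inb /= => /andP[i1 j1] /andP[i2 j2].
rewrite /lattice /=; case/or4P=> /andP[/eqP e1 /eqP e2]; subst.
- by exists (i', j.+1, true); apply: H; rewrite ?inE ?eqxx ?orbT // /inner /= ?j2.
- by exists (i', j'.+1, true); apply: H; rewrite ?inE ?eqxx ?orbT // /inner /= ?j1.
- by exists (i.+1, j', false); apply: H; rewrite ?inE ?eqxx ?orbT // /inner /= ?i2.
- by exists (i'.+1, j', false); apply: H; rewrite ?inE ?eqxx ?orbT // /inner /= ?i1.
Qed.
End Box.

Lemma sweepable_lattice (vs : seq (nat * nat)) : uniq vs -> sweepable lattice_edge vs lattice.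
Proof.
move=> uvs; have [n hn] : exists n, forall x, x \in vs -> x.1 < n /\ x.2 < n.
  exists (\max_(x <- vs) maxn x.1 x.2).+1 => x xv; rewrite !ltnS.
  by have := @leq_bigmax_seq _ vs predT (fun x => maxn x.1 x.2) x xv isT; rewrite /= geq_max => /andP[].
have := @sweepable_sub _ _ (mem vs) _ _ (sweepable_box n n).
set ws := seq.filter _ _; suff pw : perm_eq ws vs.
  by case=> evs [d f u pv he]; exists evs; split=> // [|a b av bv]; [apply: perm_trans pv pw|apply: he; rewrite (perm_mem pw)].
apply: uniq_perm => //.
  by apply: filter_uniq; apply: allpairs_uniq; rewrite ?iota_uniq // => -[? ?] [? ?] _ _ /= [-> ->].
move=> [i j]; rewrite mem_filter; change (mem vs (i, j)) with ((i, j) \in vs).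
case: (boolP ((i, j) \in vs)) => //= ij; have [hi hj] := hn _ ij.
by apply/allpairsP; exists (i, j); rewrite !mem_iota.
Qed.

(** * From a sweep to an order of vertices and edges *)

Section Orderly.
Variable V : finType.
Implicit Types (adj lt : rel V) (O : rel (V * V)) (e f g : V * V) (v : V).

(** The pair [(v, v)] stands for the vertex [v], the pair [(a, b)] for an edge
    that is met by the sweep line from [a] on to [b]. *)
Definition item adj lt e : bool := (e.1 == e.2) || adj e.1 e.2 && lt e.1 e.2.

Definition meets lt e f : bool := lt e.1 f.2 && lt f.1 e.2.

(** [O e f] means that [e] comes before [f] along the sweep line, at every moment
    when both are met. [O_end] makes an edge that ends at [v] take the
    place of [v] among the items met with [v]: no other edge gets between. *)
Record orderly adj lt O : Prop := Orderly {
  lt_irr : forall v, ~~ lt v v;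
  lt_tr : forall u v w, lt u v -> lt v w -> lt u w;
  lt_tot : forall u v, u != v -> lt u v || lt v u;
  O_tot : forall e f, item adj lt e -> item adj lt f -> e != f -> meets lt e f ->
    O e f (+) O f e;
  O_tr : forall e f g, item adj lt e -> item adj lt f -> item adj lt g ->
    meets lt e f -> meets lt f g -> meets lt e g -> O e f -> O f g -> O e g;
  O_end : forall e f v, item adj lt e -> item adj lt f -> f.1 != f.2 ->
    meets lt e (v, v) -> (f.1 == v) || (f.2 == v) -> O e f = O e (v, v)
}.
End Orderly.

Section WordSequence.
Variables (V E : eqType).
Implicit Types (evs : seq (event V E)) (X Y : seq E).

Lemma deriv_words X evs Y ev0 : deriv X evs Y -> fresh X evs ->
  exists W A B : nat -> seq E, [/\ W 0 = X, W (size evs) = Y,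
    forall k, k < size evs -> W k = A k ++ (nth ev0 evs k).1.2 ++ B k /\
      W k.+1 = A k ++ (nth ev0 evs k).2 ++ B k &
    forall k, k <= size evs -> fresh (W k) (drop k evs)].
Proof.
elim=> {X evs Y} [X|A B v L R evs Y d IH] f.
  by exists (fun=> X), (fun=> X), (fun=> X); split=> // [] [] //.
have [W [A' [B' [w0 wn st fr]]]] := IH (fresh_step f).
exists (fun k => if k is k'.+1 then W k' else A ++ L ++ B),
  (fun k => if k is k'.+1 then A' k' else A), (fun k => if k is k'.+1 then B' k' else B).
split=> // [[|k] hk|[|k] hk]; [by split|exact: st|by []|exact: fr].
Qed.

Lemma flatten_uniq_index (ss : seq (seq E)) i j x : uniq (flatten ss) ->
  x \in nth [::] ss i -> x \in nth [::] ss j -> i = j.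
Proof.
elim: ss i j => [|s ss IH] [|i] [|j] //=; rewrite ?nth_nil // cat_uniq => /and3P[_ /hasPn h u] xi xj.
- have /h : x \in flatten ss.
    by apply/flattenP; exists (nth [::] ss j) => //; apply: mem_nth; rewrite ltnNge; apply/negP => k; rewrite nth_default in xj.
  by rewrite /= xi.
- have /h : x \in flatten ss.
    by apply/flattenP; exists (nth [::] ss i) => //; apply: mem_nth; rewrite ltnNge; apply/negP => k; rewrite nth_default in xi.
  by rewrite /= xj.
- by rewrite (IH i j).
Qed.

Definition before (T : eqType) (w : seq T) (x y : T) : bool := index x w < index y w.

(** Strands that survive an event belong to its context, which does not change. *)
Lemma before_replace (T : eqType) (A L R B : seq T) x y :
  uniq (A ++ L ++ B) -> uniq (A ++ R ++ B) ->
  x \in A ++ B -> y \in A ++ B ->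
  before (A ++ L ++ B) x y = before (A ++ R ++ B) x y.
Proof.
move=> u1 u2 hx hy; rewrite /before.
have H C : uniq (A ++ C ++ B) -> forall z, z \in A ++ B ->
    index z (A ++ C ++ B) = if z \in A then index z A else size A + size C + index z B.
  move=> u z; rewrite mem_cat; rewrite index_cat; case: ifP => //= zA zB.
  rewrite index_cat ifN ?addnA //; apply: contraL zB => zC; move: u.
  rewrite cat_uniq => /and3P[_ _]; rewrite cat_uniq => /and3P[_ /hasPn h _].
  by apply/negP => /h /=; rewrite zC.
rewrite !H //; have ia z : z \in A -> index z A < size A by rewrite index_mem.
case: ifP => xA; case: ifP => yA //; last by rewrite !ltn_add2l.
  by have := ia _ xA; lia.
by have := ia _ yA; lia.
Qed.

Lemma before_total (T : eqType) (w : seq T) x y : x \in w -> y \in w -> x != y ->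
  before w x y (+) before w y x.
Proof.
move=> xw yw; rewrite /before; case: ltngtP => // e; rewrite -(nth_index x xw) e nth_index // eqxx.
by [].
Qed.
End WordSequence.

Ltac nlia := repeat match goal with
  | H : is_true (_ <= _) |- _ => revert H
  | H : @eq nat _ _ |- _ => revert H
  end; clear; repeat match goal with x := _ |- _ => clearbody x end; lia.

Section SweepOrder.
Variables (V : finType) (E : eqType) (adj : rel V).
Hypothesis adj_irr : forall v, ~~ adj v v.

(** Two items are compared at a moment when the line meets both; by
    [before_replace] it does not matter which. *)
Theorem sweep_orderly (ws : seq V) : (forall v, v \in ws) -> sweepable E ws adj ->
  exists lt O, orderly adj lt O.
Proof.
move=> all_ws [evs [d f u pv he]].
have vs_all v : v \in verts evs by rewrite (perm_mem pv).
case: (pselect (exists v0 : V, True)) => [[v0 _]|noV]; last first.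
  exists (fun _ _ => false), (fun _ _ => false).
  by split=> [v|v|v|[v ?]|[v ?]|[v ?]]; case: noV; exists v.
pose ev0 : event V E := (v0, [::], [::]).
pose N := size evs; pose ix (v : V) : nat := index v (verts evs).
have ixN v : ix v < N by rewrite /N -(size_map (fun e => e.1.1)) index_mem vs_all.
pose Lk k := (nth ev0 evs k).1.2; pose Rk k := (nth ev0 evs k).2; pose vk k : V := (nth ev0 evs k).1.1.
have vk_ix v : vk (ix v) = v.
  by have := nth_index v0 (vs_all v); rewrite /vk /verts -/(ix v) (nth_map ev0) ?ixN.
have ix_inj a b : ix a = ix b -> a = b by move=> e; rewrite -(vk_ix a) e vk_ix.
have ix_vk k : k < N -> ix (vk k) = k.
  by move=> kN; rewrite /ix /vk -(nth_map _ v0 (fun e : event V E => e.1.1)) // index_uniq // size_map.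
have [W [A [B [w0 wn st fr]]]] := deriv_words ev0 d f.
have uW k : k <= N -> uniq (W k) by move=> kN; apply: (fresh_uniq (fr k kN)).
have uolds : uniq (olds evs).
  by have := perm_uniq (deriv_perm d); rewrite cats0 /= => <-.
have Lu i j x : x \in Lk i -> x \in Lk j -> i = j.
  have H k : Lk k = nth [::] [seq e.1.2 | e <- evs] k.
    by rewrite /Lk; case: (ltnP k N) => hk; [rewrite (nth_map ev0)|rewrite !nth_default ?size_map].
  by rewrite !H; apply: flatten_uniq_index.
have Ru i j x : x \in Rk i -> x \in Rk j -> i = j.
  have H k : Rk k = nth [::] [seq e.2 | e <- evs] k.
    by rewrite /Rk; case: (ltnP k N) => hk; [rewrite (nth_map ev0)|rewrite !nth_default ?size_map].
  by rewrite !H; apply: flatten_uniq_index.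
have LN i x : x \in Lk i -> i < N by rewrite ltnNge /Lk; case: leqP => // h; rewrite nth_default.
have RN i x : x \in Rk i -> i < N by rewrite ltnNge /Rk; case: leqP => // h; rewrite nth_default.
have step k x : k < N -> (x \in W k.+1) = (x \in W k) && (x \notin Lk k) || (x \in Rk k).
  move=> kN; have [e1 e2] := st k kN; have := uW k (ltnW kN); rewrite e2 e1 -/(Lk k) -/(Rk k).
  rewrite (perm_uniq (s2 := Lk k ++ (A k ++ B k))); last by apply/permP=> p; rewrite !count_cat; nlia.
  rewrite cat_uniq => /and3P[_ /hasPn h _]; rewrite !mem_cat.
  have := h x; rewrite mem_cat; case: (x \in A k); case: (x \in B k); case: (x \in Lk k); case: (x \in Rk k) => //=;
    by move=> h'; have := h' isT.
have pres0 i x k : x \in Rk i -> k <= i -> x \notin W k.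
  move=> xi; elim: k => [|k IH] ki; first by rewrite w0.
  have kN : k < N by have := RN _ _ xi; nlia.
  rewrite step // (negbTE (IH (ltnW ki))) /=; apply/negP => xk; have := Ru _ _ _ xi xk; nlia.
have Lsub k x : x \in Lk k -> x \in W k.
  by move=> xk; have [-> _] := st k (LN _ _ xk); rewrite !mem_cat -/(Lk k) xk orbT.
have ij i j x : x \in Rk i -> x \in Lk j -> i < j.
  by move=> xi xj; rewrite ltnNge; apply/negP => ji; have := pres0 _ _ _ xi ji; rewrite Lsub.
have pres i j x k : x \in Rk i -> x \in Lk j -> k <= N -> (x \in W k) = (i < k <= j).
  move=> xi xj; elim: k => [|k IH] kN; first by rewrite w0.
  rewrite step // (IH (ltnW kN)); have h := ij _ _ _ xi xj.
  have -> : (x \in Lk k) = (k == j).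
    by apply/idP/eqP => [xk|->//]; apply: Lu xk xj.
  have -> : (x \in Rk k) = (k == i).
    by apply/idP/eqP => [xk|->//]; apply: Ru xk xi.
  by nlia.
pose lab0 : eqType := (E + V)%type.
have lab_ex : forall e : V * V, exists x : lab0, (e.1 = e.2 -> x = inr e.1) /\
    (e.1 != e.2 -> adj e.1 e.2 -> ix e.1 < ix e.2 ->
       exists2 l, x = inl l & l \in Rk (ix e.1) /\ l \in Lk (ix e.2)).
  move=> [a b] /=; case: (pselect (adj a b /\ ix a < ix b)) => [[ab lab]|n]; last first.
    exists (inr a); split=> // _ h1 h2; by case: n.
  have nab : a != b by apply/eqP=> e; move: (adj_irr a); rewrite {2}e ab.
  have [l al bl] := he a b (all_ws a) (all_ws b) nab ab.
  have H c : (c, l) \in inc evs -> (l \in Lk (ix c)) || (l \in Rk (ix c)).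
    case/mem_incP=> ev ei [ec]; rewrite mem_cat.
    have -> : ix c = index ev evs.
      by rewrite -(ix_vk (index ev evs)) ?index_mem // /vk nth_index // ec.
    by rewrite /Lk /Rk nth_index.
  exists (inl l); split=> [e|_ _ _]; first by rewrite e eqxx in nab.
  exists l => //; case/orP: (H _ al) => h1; case/orP: (H _ bl) => h2 //.
  - by have := Lu _ _ _ h1 h2; nlia.
  - by have := ij _ _ _ h2 h1; nlia.
  - by have := Ru _ _ _ h1 h2; nlia.
have [lab labP] := choice lab_ex.
(* The words before each event at even moments, and between them, at odd moments,
   the word with the vertex of the event in place of its strands. *)
pose W' m : seq lab0 := if odd m then map inl (A m./2) ++ inr (vk m./2) :: map inl (B m./2)
  else map inl (W m./2).
pose lt (a b : V) := ix a < ix b.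
pose O (e f : V * V) := has (fun m => [&& lab e \in W' m, lab f \in W' m & before (W' m) (lab e) (lab f)]) (iota 0 (N.*2).+1).
exists lt, O.
(* The first and the last moment at which an item is met. *)
pose ss (e : V * V) := (ix e.1).*2 + (if e.1 == e.2 then 1 else 2).
pose tt (e : V * V) := (ix e.2).*2 + (if e.1 == e.2 then 1 else 0).
have inl_inj : injective (@inl E V) by move=> ? ? [].
have memA k x : k < N -> (inl x \in W' k.*2.+1) = (x \in W k) && (x \notin Lk k).
  move=> kN; rewrite /W' /= odd_double /= uphalf_double mem_cat inE /= !mem_map //.
  have [e1 _] := st k kN; have := uW k (ltnW kN); rewrite e1 -/(Lk k).
  rewrite (perm_uniq (s2 := Lk k ++ (A k ++ B k))); last by apply/permP=> p; rewrite !count_cat; nlia.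
  rewrite cat_uniq => /and3P[_ /hasPn h _]; rewrite !mem_cat.
  have := h x; rewrite mem_cat; case: (x \in A k); case: (x \in B k); case: (x \in Lk k) => //=;
    by move=> h'; have := h' isT.
have ltit e : item adj lt e -> e.1 != e.2 -> adj e.1 e.2 /\ ix e.1 < ix e.2.
  by rewrite /item => /orP[/eqP ->|/andP[]//]; rewrite eqxx.
have present e m : item adj lt e -> m <= N.*2 -> (lab e \in W' m) = (ss e <= m <= tt e).
  move=> ie mN; rewrite /ss /tt; have [h1 h2] := labP e.
  have em : m = odd m + m./2.*2 by rewrite odd_double_half.
  case: (eqVneq e.1 e.2) => [ee|ne].
    rewrite h1 // -ee; rewrite {1}/W'; case: ifP em => om em.
      rewrite mem_cat inE; have -> : (inr e.1 \in map inl (A m./2)) = false :> bool.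
        by apply/negP => /mapP[].
      have -> : (inr e.1 \in map inl (B m./2)) = false :> bool by apply/negP => /mapP[].
      rewrite orbF /=; have mN2 : m./2 < N by move: mN em; nlia.
      apply/eqP/idP => [[eq]|]; first by have := ix_vk _ mN2; rewrite -eq; move: em; nlia.
      by move=> hm; congr inr; rewrite -(vk_ix e.1); congr vk; move: em hm; nlia.
    have -> : (inr e.1 \in map inl (W m./2)) = false :> bool by apply/negP => /mapP[].
    by apply/esym/negP => /andP[hm1 hm2]; nlia.
  have [ae le] := ltit e ie ne; have [l -> [lR lL]] := h2 ne ae le.
  case om: (odd m) em => em.
    have mN2 : m./2 < N by move: mN em; nlia.
    have -> : m = (m./2).*2.+1 by rewrite {1}em.
    rewrite memA // (pres _ _ _ _ lR lL (ltnW mN2)).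
    have -> : (l \in Lk m./2) = (m./2 == ix e.2).
      by apply/idP/eqP => [xk|->//]; apply: Lu xk lL.
    by nlia.
  have mN2 : m./2 <= N by move: mN em; nlia.
  rewrite /W' om mem_map // (pres _ _ _ _ lR lL mN2); move: em; nlia.
have uW' m : m <= N.*2 -> uniq (W' m).
  move=> mN; have em : m = odd m + m./2.*2 by rewrite odd_double_half.
  rewrite /W'; case: ifP em => om em; last first.
    by rewrite map_inj_uniq // uW //; move: mN em; nlia.
  have mN2 : m./2 < N by move: mN em; nlia.
  have [e1 _] := st _ mN2; have := uW _ (ltnW mN2); rewrite e1.
  rewrite !cat_uniq /= !map_inj_uniq // => /and3P[-> h /and3P[_ _ ->]] /=.
  rewrite negb_or andbT -andbA; apply/and3P; split; last by apply/negP => /mapP[].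
    by apply/negP => /mapP[].
  apply/hasPn => _ /mapP[x xB ->] /=; rewrite mem_map //; apply: contra h => xA.
  by apply/hasP; exists x; rewrite // mem_cat xB orbT.
have keep m x y : m < N.*2 -> x \in W' m -> y \in W' m -> x \in W' m.+1 -> y \in W' m.+1 ->
    before (W' m) x y = before (W' m.+1) x y.
  move=> mN; have em : m = odd m + m./2.*2 by rewrite odd_double_half.
  have mN2 : m./2 < N by move: mN em; case: (odd m); nlia.
  have [e1 e2] := st _ mN2; have u1 := uW' m (ltnW mN); have u2 := uW' m.+1 mN.
  move: u1 u2; rewrite /W' /=; case: ifP em => om em /=.
    have -> : uphalf m = (m./2).+1 by rewrite uphalf_half om.
    rewrite e2 !map_cat -cat1s => u1 u2 x1 y1 x2 y2; apply: before_replace => //.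
      move: x1 x2 u2; rewrite !mem_cat inE; case/or3P => [->//|/eqP ->|->]; last by rewrite orbT.
      by case/or3P=> /mapP[].
    move: y1 y2 u2; rewrite !mem_cat inE; case/or3P => [->//|/eqP ->|->]; last by rewrite orbT.
    by case/or3P=> /mapP[].
  have -> : uphalf m = m./2 by rewrite uphalf_half om.
  rewrite e1 !map_cat -[inr _ :: _]cat1s => u1 u2 x1 y1 x2 y2; apply: before_replace => //.
    move: x2 x1 u2; rewrite !mem_cat inE; case/or3P => [->//|/eqP ->|->]; last by rewrite orbT.
    by case/or3P=> /mapP[].
  move: y2 y1 u2; rewrite !mem_cat inE; case/or3P => [->//|/eqP ->|->]; last by rewrite orbT.
  by case/or3P=> /mapP[].
clear f d he.
have keeps e f m1 m2 : item adj lt e -> item adj lt f -> m1 <= m2 -> m2 <= N.*2 ->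
    lab e \in W' m1 -> lab f \in W' m1 -> lab e \in W' m2 -> lab f \in W' m2 ->
    before (W' m1) (lab e) (lab f) = before (W' m2) (lab e) (lab f).
  move=> ie jf m12; rewrite -(subnKC m12); elim: (m2 - m1) => [|k IH]; first by rewrite addn0.
  rewrite addnS => mN e1 f1 e2 f2.
  have [h1 h2] : lab e \in W' (m1 + k) /\ lab f \in W' (m1 + k).
    move: e1 e2 f1 f2; rewrite !present //; try nlia.
  by rewrite IH // 1?ltnW // keep.
have Oat e f m : item adj lt e -> item adj lt f -> m <= N.*2 -> lab e \in W' m -> lab f \in W' m ->
    O e f = before (W' m) (lab e) (lab f).
  move=> ie jf mN em fm; apply/hasP/idP => [[k]|h]; last by exists m; rewrite ?mem_iota ?em ?fm.
  rewrite mem_iota => /andP[_ kN] /and3P[ek fk bk].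
  case: (leqP k m) => [km|/ltnW mk]; first by rewrite -(keeps e f k m).
  by rewrite (keeps e f m k).
have st_ e : item adj lt e -> ss e <= tt e.
  move=> ie; rewrite /ss /tt; case: (eqVneq e.1 e.2) => [->//|ne].
  by have [_] := ltit e ie ne; nlia.
have tN e : item adj lt e -> tt e <= N.*2.
  move=> ie; rewrite /tt; have := ixN e.2; case: (eqVneq e.1 e.2) => _; nlia.
have meet e f : item adj lt e -> item adj lt f -> meets lt e f -> ss e <= tt f /\ ss f <= tt e.
  move=> ie jf; rewrite /meets /lt /ss /tt => /andP[h1 h2].
  case: (eqVneq e.1 e.2) => [ee|ne]; case: (eqVneq f.1 f.2) => [ff|nf].
  - by move: h1 h2; rewrite ee ff; nlia.
  - by move: h1 h2; rewrite ee; nlia.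
  - by move: h1 h2; rewrite ff; nlia.
  - by move: h1 h2; nlia.
have lab_inj e f : item adj lt e -> item adj lt f -> lab e = lab f -> e = f.
  move=> ie jf; have [h1 h2] := labP e; have [h3 h4] := labP f.
  case: (eqVneq e.1 e.2) => [ee|ne]; case: (eqVneq f.1 f.2) => [ff|nf].
  - rewrite h1 // h3 // => -[ef]; move: ee ff ef; case: (e) => a b; case: (f) => c d' /=.
    by move=> <- <- ->.
  - by have [af lf] := ltit f jf nf; have [l -> _] := h4 nf af lf; rewrite h1.
  - by have [af lf] := ltit e ie ne; have [l -> _] := h2 ne af lf; rewrite h3.
  have [ae le] := ltit e ie ne; have [af lf] := ltit f jf nf.
  have [l -> [r1 l1]] := h2 ne ae le; have [l' -> [r2 l2]] := h4 nf af lf => -[ll]; subst l'.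
  have := ix_inj _ _ (Ru _ _ _ r1 r2); have := ix_inj _ _ (Lu _ _ _ l1 l2).
  by case: (e) => a b; case: (f) => c d' /= -> ->.
split.
- by move=> v; rewrite /lt ltnn.
- by move=> x y z; apply: ltn_trans.
- move=> x y xy; rewrite /lt -neq_ltn; apply: contraNneq xy => /ix_inj -> //.
- move=> e f ie jf ef m; have [m1 m2] := meet e f ie jf m.
  pose k := maxn (ss e) (ss f); have [k1 k2] : k <= tt e /\ k <= tt f.
    by rewrite /k !geq_max !st_ //; split; apply/andP; split.
  have kN : k <= N.*2 by apply: leq_trans k1 (tN _ ie).
  have e1 : lab e \in W' k by rewrite present // k1 leq_maxl.
  have f1 : lab f \in W' k by rewrite present // k2 leq_maxr.
  rewrite (Oat e f k) // (Oat f e k) //; apply: before_total => //.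
  by apply: contraNneq ef => /lab_inj ->.
- move=> e f g ie jf kg mef mfg meg.
  have [a1 a2] := meet e f ie jf mef; have [a3 a4] := meet f g jf kg mfg.
  have [a5 a6] := meet e g ie kg meg.
  pose k := maxn (ss e) (maxn (ss f) (ss g)).
  have k1 : k <= tt e by rewrite /k !geq_max st_ // a2 a6.
  have k2 : k <= tt f by rewrite /k !geq_max st_ // a1 a4.
  have k3 : k <= tt g by rewrite /k !geq_max st_ // a3 a5.
  have kN : k <= N.*2 by apply: leq_trans k1 (tN _ ie).
  have e1 : lab e \in W' k by rewrite present // k1 leq_maxl.
  have f1 : lab f \in W' k by rewrite present // k2 !leq_max leqnn ?orbT.
  have g1 : lab g \in W' k by rewrite present // k3 !leq_max leqnn ?orbT.
  by rewrite (Oat e f k) // (Oat f g k) // (Oat e g k) //; apply: ltn_trans.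
move=> e f v ie jf nf mev fv.
have iv : item adj lt (v, v) by rewrite /item eqxx.
have [a1 a2] := meet e (v, v) ie iv mev; rewrite /ss /tt /= eqxx in a1 a2.
have nee : e.1 != e.2.
  apply/eqP=> ee; move: mev; rewrite /meets /lt /= ee; nlia.
have [ae le] := ltit e ie nee; have [af lf] := ltit f jf nf.
rewrite (negbTE nee) in a1 a2.
have vN := ixN v; pose k := ix v; have kE : k = ix v by [].
have kN1 : k.*2.+1 <= N.*2 by nlia.
have em : lab e \in W' k.*2.+1.
  by rewrite present // /ss /tt (negbTE nee); move: a1 a2; nlia.
have vm : lab (v, v) \in W' k.*2.+1.
  by rewrite present // /ss /tt /= eqxx /k; nlia.
rewrite (Oat e (v, v) k.*2.+1) //.
have [l el [lR lL]] := (labP e).2 nee ae le.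
have [l' fl [lR' lL']] := (labP f).2 nf af lf.
have ev : lab (v, v) = inr v by apply: (labP (v, v)).1.
have Wv : W' k.*2.+1 = map inl (A k) ++ [:: inr v] ++ map inl (B k).
  by rewrite /W' /= odd_double /= uphalf_double vk_ix.
have [s1 s2] := st k vN; rewrite -/(Lk k) -/(Rk k) in s1 s2.
have nv z : (inr v \in map inl z) = false :> bool by apply/negP => /mapP[].
have lAB : (l \in A k) || (l \in B k).
  by move: em; rewrite Wv el !mem_cat inE /= !mem_map.
have bv C : uniq (A k ++ C ++ B k) -> l' \in C ->
    before (map inl (A k ++ C ++ B k)) (lab e) (lab f) = before (W' k.*2.+1) (lab e) (lab (v, v)).
  move=> uc l'C; rewrite Wv el fl ev /before (index_map inl_inj) (index_map inl_inj).
  have nA : l' \notin A k.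
    move: uc; rewrite cat_uniq => /and3P[_ /hasPn h _]; by apply/negP => /= hA; have := h l'; rewrite mem_cat l'C /= hA => /(_ isT).
  have r1 : index (inr v) (map inl (A k) ++ [:: inr v] ++ map inl (B k)) = size (A k).
    by rewrite index_cat nv /= eqxx size_map addn0.
  have r2 : index (inl l) (map inl (A k) ++ [:: inr v] ++ map inl (B k)) =
      if l \in A k then index l (A k) else size (A k) + (index l (B k)).+1.
    by rewrite index_cat mem_map // (index_map inl_inj) size_map /= (index_map inl_inj).
  rewrite r1 r2 !index_cat (negbTE nA).
  have i1 z : l \in z -> index l z < size z by rewrite index_mem.
  case: ifP => [lA|lA]; first by have := i1 _ lA; nlia.
  have lB : l \in B k by move: lAB; rewrite lA.
  have lC : l \notin C.
    move: uc; rewrite cat_uniq => /and3P[_ _]; rewrite cat_uniq => /and3P[_ /hasPn h _].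
    by have := h l lB.
  rewrite l'C (negbTE lC); have : index l' C < size C by rewrite index_mem.
  by nlia.
case/orP: fv => /eqP fv.
  have fm : lab f \in W' k.+1.*2.
    rewrite present //; last by nlia.
    by rewrite /ss /tt (negbTE nf) /k -fv; move: lf; nlia.
  have em2 : lab e \in W' k.+1.*2.
    rewrite present //; last by nlia.
    by rewrite /ss /tt (negbTE nee) /k; move: a1 a2; nlia.
  rewrite (Oat e f k.+1.*2) //; last by nlia.
  have -> : W' k.+1.*2 = map inl (A k ++ Rk k ++ B k) by rewrite /W' odd_double doubleK s2.
  by apply: bv; [rewrite -s2 uW|rewrite /k -fv].
have fm : lab f \in W' k.*2.
  rewrite present //; last by nlia.
  by rewrite /ss /tt (negbTE nf) /k -fv; move: lf; nlia.
have em2 : lab e \in W' k.*2.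
  rewrite present //; last by nlia.
  by rewrite /ss /tt (negbTE nee) /k; move: a1 a2; nlia.
rewrite (Oat e f k.*2) //; last by nlia.
have -> : W' k.*2 = map inl (A k ++ Lk k ++ B k) by rewrite /W' odd_double doubleK s1.
by apply: bv; [rewrite -s1 uW // ltnW|rewrite /k -fv].
Qed.
End SweepOrder.

(** * An order of vertices and edges gives a plane drawing *)

Section PiecewiseLinear.
Variable R : realType.
Local Open Scope ring_scope.

(** A sum of scaled translates of the tent function is continuous, and is the
    piecewise linear function with the given values at the integers. *)
Definition hat (t : R) : R := (1 - `|t| + `|1 - `|t| |) / 2.

Definition pl (n : nat) (c : nat -> R) (x : R) : R := \sum_(k < n) c k * hat (x - k%:R).

Lemma hat_in t : `|t| <= 1 -> hat t = 1 - `|t|.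
Proof. by move=> h; rewrite /hat [`|1 - _|]ger0_norm ?subr_ge0 //; lra. Qed.

Lemma hat_out t : 1 <= `|t| -> hat t = 0.
Proof. by move=> h; rewrite /hat [`|1 - _|]ler0_norm ?subr_le0 //; lra. Qed.

Lemma pl_slab n c i (s : R) : 0 <= s <= 1 -> (i.+1 < n)%N ->
  pl n c (i%:R + s) = c i * (1 - s) + c i.+1 * s.
Proof.
move=> /andP[s0 s1] iN; have iN' : (i < n)%N by apply: ltn_trans iN.
rewrite /pl (bigD1 (Ordinal iN')) //= (bigD1 (Ordinal iN)) //=; last first.
  by rewrite -val_eqE /= neq_ltn ltnSn orbT.
have -> : i%:R + s - i%:R = s by ring.
have -> : i%:R + s - i.+1%:R = - (1 - s) by rewrite -natr1; ring.
rewrite hat_in ?ger0_norm // hat_in ?normrN ?ger0_norm ?subr_ge0 //; last by lra.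
rewrite big1 ?addr0 => [|k /andP[/eqP k1 /eqP k2]]; first by congr (_ + _ * _); ring.
rewrite hat_out ?mulr0 //.
have : (k < i)%N \/ (i.+1 < k)%N.
  have e1 : (k : nat) <> i by move=> e; apply: k1; apply: val_inj.
  have e2 : (k : nat) <> i.+1 by move=> e; apply: k2; apply: val_inj.
  by lia.
case=> h.
  have : k%:R + 1 <= i%:R :> R by rewrite natr1 ler_nat.
  by move=> h'; rewrite ger0_norm; lra.
have : i%:R + 2 <= k%:R :> R by rewrite -natrD ler_nat; lia.
by move=> h'; rewrite ler0_norm; lra.
Qed.

Lemma pl_nat n c i : (i < n)%N -> pl n c i%:R = c i.
Proof.
move=> iN; rewrite /pl (bigD1 (Ordinal iN)) //= subrr hat_in ?normr0 ?ler01 // subr0 mulr1.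
rewrite big1 ?addr0 // => k /eqP k1; rewrite hat_out ?mulr0 //.
have e1 : (k : nat) <> i by move=> e; apply: k1; apply: val_inj.
have : (k < i)%N \/ (i < k)%N by lia.
case=> h.
  have : k%:R + 1 <= i%:R :> R by rewrite natr1 ler_nat.
  by move=> h'; rewrite ger0_norm; lra.
have : i%:R + 1 <= k%:R :> R by rewrite natr1 ler_nat.
by move=> h'; rewrite ler0_norm; lra.
Qed.

Local Open Scope classical_set_scope.

Lemma hat_continuous : continuous hat.
Proof.
move=> t; have n1 : {for t, continuous (fun x : R => `|x|)} by apply: norm_continuous.
have n2 : {for t, continuous (fun x : R => 1 - `|x|)}.
  by apply: continuousB => //; apply: cst_continuous.
apply: (@continuousM _ _ (fun x => 1 - `|x| + `|1 - `|x| |) (cst 2^-1)); last exact: cst_continuous.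
apply: continuousD => //; apply: (@continuous_comp _ _ _ (fun x : R => 1 - `|x|) (fun x : R => `|x|)) => //.
exact: norm_continuous.
Qed.

Lemma pl_continuous n c : continuous (pl n c).
Proof.
elim: n => [|n IH] x.
  have -> : pl 0 c = cst 0 by apply: funext => y; rewrite /pl big_ord0.
  exact: cst_continuous.
have -> : pl n.+1 c = pl n c \+ (fun y => c n * hat (y - n%:R)).
  by apply: funext => y; rewrite /pl big_ord_recr.
apply: continuousD; first exact: IH.
apply: continuousM; first exact: cst_continuous.
apply: (@continuous_comp _ _ _ (fun y : R => y - n%:R) hat); last exact: hat_continuous.
apply: continuousB => //; exact: cst_continuous.
Qed.
End PiecewiseLinear.

Section Draw.
Variables (R : realType) (V : finType) (adj lt : rel V) (O : rel (V * V)).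
Hypothesis adj_sym : symmetric adj.
Hypothesis ord : orderly adj lt O.

Let irr := lt_irr ord.
Let tr := lt_tr ord.
Let tot := lt_tot ord.

Definition rank (v : V) : nat := #|[set u | lt u v]%SET|.

Lemma lt_asym u v : lt u v -> ~~ lt v u.
Proof. by move=> h; apply/negP => /(tr h); apply/negP/irr. Qed.

Lemma rank_lt u v : lt u v -> rank u < rank v.
Proof.
move=> uv; apply: proper_card; apply/properP; split.
  by apply/fintype.subsetP => w; rewrite !inE => /tr; apply.
by exists u; rewrite !inE ?uv // irr.
Qed.

Lemma rank_ltE u v : (rank u < rank v) = lt u v.
Proof.
apply/idP/idP; last exact: rank_lt.
case: (eqVneq u v) => [->|]; first by rewrite ltnn.
by case/tot/orP => // /rank_lt; case: ltngtP.
Qed.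

Lemma rank_inj : injective rank.
Proof.
move=> u v e; case: (eqVneq u v) => // /tot; rewrite -!rank_ltE e ltnn //.
Qed.

Lemma rank_max v : rank v < #|V|.
Proof.
rewrite -cardsT; apply: proper_card; apply/properP; split; first by apply/fintype.subsetP => w; rewrite inE.
by exists v; rewrite !inE // irr.
Qed.

Lemma rank_surj i : i < #|V| -> exists v, rank v = i.
Proof.
move=> iV; pose f v : 'I_#|V| := Ordinal (rank_max v).
have fi : injective f by move=> u v /(congr1 val) /= /rank_inj.
have := @inj_card_onto _ _ f fi; rewrite card_ord => /(_ (leqnn _) (Ordinal iV))/codomP[v /(congr1 val) /= ->].
by exists v.
Qed.

Definition at_level v (e : V * V) : bool := item adj lt e && (meets lt e (v, v) || (e == (v, v))).

Definition height v (e : V * V) : nat := #|[set g | [&& at_level v g, g != e & O g e]]%SET|.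

Lemma item_vert v : item adj lt (v, v). Proof. by rewrite /item eqxx. Qed.

Lemma at_level_vert v : at_level v (v, v). Proof. by rewrite /at_level item_vert eqxx orbT. Qed.

Lemma at_level_meets v e f : at_level v e -> at_level v f -> e != f -> meets lt e f.
Proof.
rewrite /at_level /meets => /andP[_ /orP[/andP[/= h1 h2]|/eqP ->]] /andP[_ /orP[/andP[/= h3 h4]|/eqP ->]];
  rewrite ?eqxx //= ?h1 ?h2 ?h3 ?h4 // => _.
by rewrite (tr h1 h4) (tr h3 h2).
Qed.

Lemma height_lt v e f : at_level v e -> at_level v f -> e != f -> O e f -> height v e < height v f.
Proof.
move=> le lf ef Oef; apply: proper_card; apply/properP; split; last first.
  by exists e; rewrite !inE ?eqxx ?andbF // le ef.
apply/fintype.subsetP => g; rewrite !inE => /and3P[lg ge Oge].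
have [ie ig jf] : [/\ item adj lt e, item adj lt g & item adj lt f] by case/andP: le; case/andP: lg; case/andP: lf.
have gf : g != f.
  apply/eqP=> e0; subst g; have := O_tot ord ie jf ef (at_level_meets le lf ef).
  by rewrite Oef Oge.
rewrite lg gf /=; exact: (O_tr ord ig ie jf (at_level_meets lg le ge) (at_level_meets le lf ef) (at_level_meets lg lf gf) Oge Oef).
Qed.

Lemma height_inj v e f : at_level v e -> at_level v f -> height v e = height v f -> e = f.
Proof.
move=> le lf h; apply/eqP; apply/negP => /negP ef.
have [ie jf] : item adj lt e /\ item adj lt f by case/andP: le; case/andP: lf.
have := O_tot ord ie jf ef (at_level_meets le lf ef).
case Oef: (O e f) => /= Ofe; first by have := height_lt le lf ef Oef; rewrite h ltnn.
by have := height_lt lf le _ Ofe; rewrite h ltnn eq_sym => /(_ ef).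
Qed.

Definition yat v (e : V * V) : nat := if (e.1 == v) || (e.2 == v) then height v (v, v) else height v e.

Definition edge (e : V * V) : bool := adj e.1 e.2 && lt e.1 e.2.

Lemma edge_item e : edge e -> item adj lt e.
Proof. by rewrite /edge /item => ->; rewrite orbT. Qed.

Lemma edge_neq e : edge e -> e.1 != e.2.
Proof. by case/andP=> _ h; apply/eqP=> e0; move: (irr e.1); rewrite {2}e0 h. Qed.

Lemma edge_at_level v e : edge e -> lt e.1 v -> lt v e.2 -> at_level v e.
Proof. by move=> he h1 h2; rewrite /at_level edge_item // /meets h1 h2. Qed.

Definition spans_from v (e : V * V) : bool := (e.1 == v) || lt e.1 v.
Definition spans_to v (e : V * V) : bool := (e.2 == v) || lt v e.2.
Definition over v e := spans_from v e && spans_to v e.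
Definition ends v (e : V * V) := (e.1 == v) || (e.2 == v).

Lemma over_level v e : edge e -> over v e -> ~~ ends v e -> at_level v e.
Proof.
move=> he; rewrite /over /spans_from /spans_to /ends negb_or => /andP[h1 h2] /andP[/negbTE n1 /negbTE n2].
by move: h1 h2; rewrite n1 n2 /=; apply: edge_at_level.
Qed.

Lemma yat_vert v e : edge e -> over v e -> ~~ ends v e -> yat v e != height v (v, v).
Proof.
move=> he ov ne; have le := over_level he ov ne; move: (ne); rewrite /yat /ends => /negbTE ->.
apply/eqP => /(height_inj le (at_level_vert v)) e0.
by move: ne; rewrite e0 /ends eqxx.
Qed.

(** By [O_end] an edge that ends at [v] compares with the other edges as [v] does. *)
Lemma yat_lt v e f : edge e -> edge f -> e != f -> over v e -> over v f -> meets lt e f -> O e f ->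
  yat v e < yat v f \/ ends v e && ends v f /\ yat v e = yat v f.
Proof.
move=> he hf ef oe of_ m Oef.
have ie := edge_item he; have jf := edge_item hf; have iv := item_vert v.
have xor := O_tot ord ie jf ef m.
have mE g : at_level v g -> g != (v, v) -> meets lt g (v, v).
  by move=> lg gv; apply: at_level_meets lg (at_level_vert v) gv.
have nv g : edge g -> g != (v, v) by move=> hg; apply/eqP => e0; move: (edge_neq hg); rewrite e0 eqxx.
case: (boolP (ends v e)) => ee; case: (boolP (ends v f)) => ff.
- by right; split=> //; move: ee ff; rewrite /yat /ends => -> ->.
- left; have lf := over_level hf of_ ff; move: (ee) (ff); rewrite {1}/ends /yat => -> /negbTE; rewrite /ends => ->.
  apply: height_lt => //; [exact: at_level_vert|by rewrite eq_sym nv|].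
  have mf := mE f lf (nv f hf).
  have := O_tot ord jf iv (nv f hf) mf; rewrite -(O_end ord jf ie (edge_neq he) mf ee).
  by move: xor; rewrite Oef /= => /negbTE ->.
- left; have le := over_level he oe ee; move: (ee) (ff); rewrite {2}/ends /yat => /negbTE; rewrite /ends => -> ->.
  apply: height_lt => //; [exact: at_level_vert|exact: nv|].
  by rewrite -(O_end ord ie jf (edge_neq hf) (mE e le (nv e he)) ff).
- left; have le := over_level he oe ee; have lf := over_level hf of_ ff.
  move: ee ff; rewrite /yat /ends => /negbTE -> /negbTE ->; exact: height_lt.
Qed.

Local Open Scope ring_scope.
Local Open Scope classical_set_scope.

Definition place v : R * R := ((rank v)%:R, (height v (v, v))%:R).

Definition vert_of (v0 : V) (k : nat) : V := odflt v0 [pick v | rank v == k]%SET.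

Lemma vert_of_rank v0 v : vert_of v0 (rank v) = v.
Proof.
rewrite /vert_of; case: pickP => [w /eqP /rank_inj //|/(_ v)]; by rewrite eqxx.
Qed.

Definition ycoef (e : V * V) (k : nat) : R := (yat (vert_of e.1 k) e)%:R.

Definition curve_y (e : V * V) : R -> R := pl #|V| (ycoef e).

Definition curve (e : V * V) : set (R * R) :=
  [set p | (rank e.1)%:R <= p.1 <= (rank e.2)%:R /\ p.2 = curve_y e p.1].

Lemma curve_vert e v : curve_y e (rank v)%:R = (yat v e)%:R.
Proof. by rewrite /curve_y pl_nat ?rank_max // /ycoef vert_of_rank. Qed.

Lemma over_rank e v : over v e = (rank e.1 <= rank v <= rank e.2)%N.
Proof.
rewrite /over /spans_from /spans_to -!rank_ltE !(leq_eqVlt (rank _)) !(inj_eq rank_inj).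
by rewrite [v == e.2]eq_sym.
Qed.

Lemma curve_ends e v : edge e -> curve e (place v) -> v = e.1 \/ v = e.2.
Proof.
move=> he [] /=; rewrite !ler_nat curve_vert => ov /eqP; rewrite eqr_nat => /eqP h.
have oe : over v e by rewrite over_rank.
case: (boolP (ends v e)) => [/orP[/eqP<-|/eqP<-]|ne]; [by left|by right|].
by have := yat_vert he oe ne; rewrite -h eqxx.
Qed.

(** Crossings are excluded at the abscissas of vertices and strictly between two
    of them, where the curves are straight. *)
Lemma nat_or_slab (x : R) (a b : nat) : a%:R <= x <= b%:R ->
  (exists i, (a <= i <= b)%N /\ x = i%:R) \/
  (exists i s, [/\ (a <= i)%N, (i.+1 <= b)%N, 0 < s < 1 & x = i%:R + s]).
Proof.
move=> /andP[ax xb]; have x0 : 0 <= x by apply: le_trans ax.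
pose i := Num.truncn x; have /andP[i1 i2] := truncn_itv x0; rewrite -/i in i1 i2.
have ai : (a <= i)%N by rewrite -ltnS -(ltr_nat R); apply: le_lt_trans ax i2.
case: (eqVneq x i%:R) => [e|ne].
  by left; exists i; split=> //; rewrite ai -(ler_nat R) -e.
have ix : i%:R < x by rewrite lt_neqAle eq_sym ne i1.
right; exists i, (x - i%:R); split=> //; last by ring.
  by rewrite -(ltr_nat R); apply: lt_le_trans ix xb.
by move: i2; rewrite -natr1 => i2; apply/andP; split; lra.
Qed.

Lemma curves_cross e f p : edge e -> edge f -> e != f -> curve e p -> curve f p ->
  exists v, p = place v.
Proof.
case: p => x y he hf ef [/= xe ye] [/= xf yf].
have xef : (maxn (rank e.1) (rank f.1))%:R <= x <= (minn (rank e.2) (rank f.2))%:R.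
  rewrite !natr_max !natr_min; move: xe xf; rewrite ge_max le_min => /andP[-> ->] /andP[-> ->] //.
case: (nat_or_slab xef) => [[i [/andP[i1 i2] xi]]|[i [s [i1 i2 s01 xi]]]].
  move: i1 i2; rewrite geq_max leq_min => /andP[e1 f1] /andP[e2 f2].
  have [v vi] := rank_surj (leq_ltn_trans e2 (rank_max _)).
  have oe : over v e by rewrite over_rank vi e1 e2.
  have of_ : over v f by rewrite over_rank vi f1 f2.
  rewrite xi -vi in ye yf; rewrite xi -vi ye.
  rewrite curve_vert in ye *; rewrite curve_vert in yf.
  have yE : yat v e = yat v f by apply/eqP; rewrite -(eqr_nat R) -ye -yf.
  exists v; rewrite /place; congr (_, _%:R).
  case: (boolP (ends v e)) => [|ee]; first by rewrite /yat /ends => ->.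
  case: (boolP (ends v f)) => [|ff]; first by rewrite yE /yat /ends => ->.
  have ye' : yat v e = height v e by move: ee; rewrite /yat /ends => /negbTE ->.
  have yf' : yat v f = height v f by move: ff; rewrite /yat /ends => /negbTE ->.
  rewrite ye' yf' in yE; have e0 := height_inj (over_level he oe ee) (over_level hf of_ ff) yE.
  by rewrite e0 eqxx in ef.
move: i1 i2; rewrite geq_max leq_min => /andP[e1 f1] /andP[e2 f2].
have iV : (i.+1 < #|V|)%N := leq_ltn_trans e2 (rank_max _).
have [v vi] := rank_surj (ltnW iV); have [w wi] := rank_surj iV.
have oev : over v e by rewrite over_rank vi e1 ltnW.
have ofv : over v f by rewrite over_rank vi f1 ltnW.
have oew : over w e by rewrite over_rank wi e2 leqW.
have ofw : over w f by rewrite over_rank wi f2 leqW.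
have m : meets lt e f.
  by rewrite /meets -!rank_ltE (leq_ltn_trans e1) // (leq_ltn_trans f1).
have s01' : 0 <= s <= 1 by case/andP: s01 => /ltW -> /ltW ->.
have yE : (ycoef e i - ycoef f i) * (1 - s) + (ycoef e i.+1 - ycoef f i.+1) * s = 0.
  by move: yf; rewrite ye /curve_y xi !pl_slab // => h; apply/eqP; rewrite -subr_eq0 in h *; lra.
have cE g : edge g -> ycoef g i = (yat v g)%:R /\ ycoef g i.+1 = (yat w g)%:R.
  by move=> _; rewrite /ycoef -vi vert_of_rank vi -wi vert_of_rank.
have [ce1 ce2] := cE e he; have [cf1 cf2] := cE f hf; rewrite ce1 ce2 cf1 cf2 in yE.
(* Over the slab the difference of two edges interpolates two differences of the
   same sign, which do not both vanish: else the edges have both ends in common. *)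
have key g h : edge g -> edge h -> g != h -> over v g -> over v h -> over w g -> over w h ->
    (rank g.1 <= i)%N -> (rank h.1 <= i)%N -> (i.+1 <= rank g.2)%N -> (i.+1 <= rank h.2)%N ->
    meets lt g h -> O g h ->
    ((yat v g)%:R - (yat v h)%:R) * (1 - s) + ((yat w g)%:R - (yat w h)%:R) * s < 0 :> R.
  move=> hg hh gh ogv ohv ogw ohw g1 h1 g2 h2 mgh Ogh; case/andP: s01 => s0 s1.
  have hv := yat_lt hg hh gh ogv ohv mgh Ogh; have hw := yat_lt hg hh gh ogw ohw mgh Ogh.
  have lv : (yat v g)%:R <= (yat v h)%:R :> R by rewrite ler_nat; case: hv => [/ltnW|[_ ->]].
  have lw : (yat w g)%:R <= (yat w h)%:R :> R by rewrite ler_nat; case: hw => [/ltnW|[_ ->]].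
  case: hv => [hv|[/andP[ev fv] _]].
    have : (yat v g)%:R < (yat v h)%:R :> R by rewrite ltr_nat.
    by move=> hv'; nra.
  case: hw => [hw|[/andP[ew fw] _]].
    have : (yat w g)%:R < (yat w h)%:R :> R by rewrite ltr_nat.
    by move=> hw'; nra.
  have fst_v k : ends v k -> (i.+1 <= rank k.2)%N -> k.1 = v.
    by rewrite /ends => /orP[/eqP //|/eqP kv]; rewrite kv vi ltnn.
  have snd_w k : ends w k -> (rank k.1 <= i)%N -> k.2 = w.
    by rewrite /ends => /orP[/eqP kv|/eqP //]; rewrite kv wi ltnn.
  case/negP: gh; apply/eqP; rewrite [g]surjective_pairing [h]surjective_pairing.
  by rewrite (fst_v g) // (fst_v h) // (snd_w g) // (snd_w h).
exfalso; have := O_tot ord (edge_item he) (edge_item hf) ef m.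
case Oef: (O e f) => /= Ofe.
  by have := key e f he hf ef oev ofv oew ofw e1 f1 e2 f2 m Oef; rewrite yE ltxx.
have m' : meets lt f e by move: m; rewrite /meets andbC.
have := key f e hf he _ ofv oev ofw oew f1 e1 f2 e2 m' Ofe; rewrite eq_sym => /(_ ef).
by move=> h; have : (0 : R) < 0; [rewrite -{2}yE; lra|rewrite ltxx].
Qed.

Definition param (e : V * V) (t : R) : R * R :=
  let x := (rank e.1)%:R + t * ((rank e.2)%:R - (rank e.1)%:R) in (x, curve_y e x).

Lemma param_continuous e : continuous (param e).
Proof.
move=> t; have xc : {for t, continuous (fun z : R => (rank e.1)%:R + z * ((rank e.2)%:R - (rank e.1)%:R) : R)}.
  apply: continuousD; first exact: cst_continuous.
  by apply: continuousM => //; apply: cst_continuous.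
have yc : {for t, continuous (fun z : R => curve_y e ((rank e.1)%:R + z * ((rank e.2)%:R - (rank e.1)%:R)))}.
  apply: (@continuous_comp _ _ _ (fun z : R => (rank e.1)%:R + z * ((rank e.2)%:R - (rank e.1)%:R) : R) (curve_y e)) => //.
  exact: pl_continuous.
exact: (cvg_pair xc yc).
Qed.

Lemma param_image e : edge e -> param e @` `[0, 1] = curve e.
Proof.
move=> he; have rl : 0 < (rank e.2)%:R - (rank e.1)%:R :> R.
  by rewrite subr_gt0 ltr_nat rank_ltE; case/andP: he.
apply/seteqP; split=> [_ [t /= + <-]|[x y] [/= /andP[x1 x2] ->]].
  rewrite in_itv /= => /andP[t0 t1]; split=> //=; apply/andP; split; nra.
exists ((x - (rank e.1)%:R) / ((rank e.2)%:R - (rank e.1)%:R)) => /=.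
  rewrite in_itv /=; apply/andP; split; [apply: divr_ge0; lra|rewrite ler_pdivrMr // mul1r; lra].
have xE : (rank e.1)%:R + (x - (rank e.1)%:R) / ((rank e.2)%:R - (rank e.1)%:R) * ((rank e.2)%:R - (rank e.1)%:R) = x.
  by rewrite divfK ?lt0r_neq0 //; ring.
by rewrite /param xE.
Qed.

Lemma param_inj e : edge e -> injective (param e).
Proof.
move=> he t u [+ _]; have rl : 0 < (rank e.2)%:R - (rank e.1)%:R :> R.
  by rewrite subr_gt0 ltr_nat rank_ltE; case/andP: he.
by move/addrI/(mulIf (lt0r_neq0 rl)).
Qed.

Lemma param0 e : edge e -> param e 0 = place e.1.
Proof. by move=> _; rewrite /param mul0r addr0 curve_vert /yat eqxx. Qed.

Lemma param1 e : edge e -> param e 1 = place e.2.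
Proof.
move=> _; have xE : (rank e.1)%:R + 1 * ((rank e.2)%:R - (rank e.1)%:R) = (rank e.2)%:R :> R by ring.
by rewrite /param xE curve_vert /yat eqxx orbT.
Qed.

(** Edges that are ordered by [O] at one vertex are ordered the same way at all
    vertices they both span, so their polygonal lines do not cross. *)
Theorem orderly_planar : irreflexive adj -> planar_graph R adj.
Proof.
move=> adj_irr.
pose G (S : {set V}) : set (R * R) :=
  [set p | exists2 e, edge e /\ S = [set e.1; e.2]%SET & curve e p].
have GE e : edge e -> G [set e.1; e.2]%SET = curve e.
  move=> he; apply/seteqP; split=> p; last by exists e.
  case=> f [hf eS]; suff -> : e = f by [].
  have f1 : f.1 \in [set e.1; e.2]%SET by rewrite eS !inE eqxx.
  have f2 : f.2 \in [set e.1; e.2]%SET by rewrite eS !inE eqxx orbT.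
  have nf := edge_neq hf; case/andP: (he) => _ le; case/andP: (hf) => _ lf.
  rewrite [e]surjective_pairing [f]surjective_pairing; move: f1 f2 nf lf; rewrite !inE.
  by case/orP=> /eqP -> /orP[]/eqP -> //; rewrite ?eqxx // => _ h; have := lt_asym le; rewrite h.
have orient u v : adj u v -> edge (u, v) \/ edge (v, u).
  move=> uv; have uv' : u != v by apply/eqP=> e; rewrite e adj_irr in uv.
  by case/orP: (tot uv') => h; [left|right]; rewrite /edge /= ?uv // adj_sym uv.
have gE u v : adj u v -> exists2 e, edge e & [set u; v]%SET = [set e.1; e.2]%SET /\
    ((u = e.1 /\ v = e.2) \/ (u = e.2 /\ v = e.1)).
  move=> /orient[h|h]; [exists (u, v) => //; split; by [|left]|exists (v, u) => //; split; last by right].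
  by rewrite finset.setUC.
exists place, G; split.
- by move=> u v [/eqP]; rewrite eqr_nat => /eqP /rank_inj.
- move=> u v /gE[e he [-> uvE]]; rewrite GE //; case: uvE => -[-> ->].
    exists (param e); split; [|by move=> ? ? _ _; apply: param_inj|exact: param0|exact: param1|exact: param_image].
    exact: (continuous_subspaceT (@param_continuous e)).
  have flip_img : (fun t : R => 1 - t) @` `[0, 1] = `[0, 1].
    apply/seteqP; split=> [_ [t /= + <-]|t /=]; rewrite !in_itv /= => /andP[t0 t1].
      by apply/andP; split; lra.
    by exists (1 - t); rewrite ?in_itv /=; [apply/andP; split; lra|ring].
  exists (fun t => param e (1 - t)); split.
  + apply: continuous_subspaceT => t.
    apply: (@continuous_comp _ _ _ (fun t : R => 1 - t) (param e)); last exact: param_continuous.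
    by apply: continuousB => //; apply: cst_continuous.
  + by move=> t s _ _ /(param_inj he)/addrI/oppr_inj.
  + by rewrite subr0 param1.
  + by rewrite subrr param0.
  + by rewrite -param_image // -{2}flip_img image_comp.
- move=> u v w /gE[e he [-> uvE]]; rewrite GE // => /(curve_ends he).
  by case: uvE => -[-> ->] []; [left|right|right|left].
move=> u v x y /gE[e he [-> _]] /gE[f hf [-> _]]; rewrite !GE // => ne p [pe pf].
have ef : e != f by apply: contraNneq ne => ->.
by have [w ->] := curves_cross he hf ef pe pf; exists w.
Qed.
End Draw.

(** * Discretising a plane drawing *)

Section Compactness.
Variable R : realType.
Local Open Scope ring_scope.
Local Open Scope classical_set_scope.

(** Extending arcs by constants makes them continuous on the line. *)
Definition clamp (t : R) : R := Num.max 0 (Num.min 1 t).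

Lemma clamp_itv t : 0 <= clamp t <= 1.
Proof. by rewrite /clamp le_max lexx ge_max ler01 ge_min lexx. Qed.

Lemma clamp_id t : 0 <= t <= 1 -> clamp t = t.
Proof. by rewrite /clamp => /andP[t0 t1]; rewrite (min_idPr t1) (max_idPr t0). Qed.

Lemma clamp_continuous : continuous clamp.
Proof.
move=> t; apply: continuous_max; first exact: cst_continuous.
by apply: continuous_min; [exact: cst_continuous|].
Qed.

Lemma continuous_clamp (g : R -> R * R) : {within `[0, 1], continuous g} -> continuous (g \o clamp).
Proof.
move=> /subspace_continuousP gc t; have ct : `[0, 1] (clamp t) by rewrite /= in_itv /= clamp_itv.
apply: cvg_trans (gc _ ct) => U /= [/= e e0 he].
have := @clamp_continuous t; move=> /cvgrPdist_lt /(_ e e0) [d d0 hd].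
exists d => // z tz; apply: he; first exact: hd.
by rewrite /= in_itv /= clamp_itv.
Qed.

Lemma positive_bound (h : R * R -> R) a b c d : a <= b -> c <= d -> continuous h ->
  (forall s t, a <= s <= b -> c <= t <= d -> 0 < h (s, t)) ->
  exists2 m, 0 < m & forall s t, a <= s <= b -> c <= t <= d -> m <= h (s, t).
Proof.
move=> ab cd hc h0; have A0 : (`[a, b] `*` `[c, d]) !=set0.
  by exists (a, c); split; rewrite /= in_itv /= lexx.
have cA := compact_setX (@segment_compact R a b) (@segment_compact R c d).
have [[s t]] := compact_EVT_min A0 cA (continuous_subspaceT hc).
rewrite inE => -[/=]; rewrite !in_itv /= => sab tcd min.
exists (h (s, t)); first exact: h0.
by move=> s' t' s'ab t'cd; apply: min; rewrite inE; split; rewrite /= in_itv.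
Qed.

Lemma dist_continuous (F G : R -> R * R) : continuous F -> continuous G ->
  continuous (fun p : R * R => `|F p.1 - G p.2|).
Proof.
move=> Fc Gc p; apply: (@continuous_comp _ _ _ (fun p : R * R => F p.1 - G p.2) (fun q : R * R => `|q|)); last exact: norm_continuous.
apply: (@continuousB _ _ _ (F \o fst) (G \o snd)).
  by apply: continuous_comp; [exact: cvg_fst|exact: Fc].
by apply: continuous_comp; [exact: cvg_snd|exact: Gc].
Qed.

Lemma separated (F G : R -> R * R) a b c d : a <= b -> c <= d -> continuous F -> continuous G ->
  (forall s t, a <= s <= b -> c <= t <= d -> F s <> G t) ->
  exists2 m, 0 < m & forall s t, a <= s <= b -> c <= t <= d -> m <= `|F s - G t|.
Proof.
move=> ab cd Fc Gc ne.
apply: (positive_bound (h := fun p => `|F p.1 - G p.2|)) => //; first exact: dist_continuous.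
by move=> s t hs ht; rewrite normr_gt0 subr_eq0; apply/eqP/ne.
Qed.

(** The function [h] below is positive everywhere: its first term off the
    diagonal, its second term on it. Where the first term is less than the minimum
    of [h], the second one has to be positive. *)
Lemma uniformly_continuous (F : R -> R * R) e : continuous F -> 0 < e ->
  exists2 m, 0 < m & forall s t, 0 <= s <= 1 -> 0 <= t <= 1 -> `|s - t| < m -> `|F s - F t| < e.
Proof.
move=> Fc e0.
pose h (p : R * R) := `|p.1 - p.2| + Num.max 0 (e - `|F p.1 - F p.2|).
have hc : continuous h.
  move=> p; apply: (@continuousD _ _ _ (fun p : R * R => `|p.1 - p.2|) (fun p : R * R => Num.max 0 (e - `|F p.1 - F p.2|))).
    apply: (@continuous_comp _ _ _ (fun p : R * R => p.1 - p.2) (fun x : R => `|x|)); last exact: norm_continuous.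
    by apply: (@continuousB _ _ _ fst snd); [exact: cvg_fst|exact: cvg_snd].
  apply: (@continuous_max R (R * R)%type (fun=> 0) (fun p : R * R => e - `|F p.1 - F p.2|)); first exact: cst_continuous.
  apply: (@continuousB _ _ _ (fun=> e) (fun p : R * R => `|F p.1 - F p.2|)); first exact: cst_continuous.
  exact: dist_continuous.
have [|m m0 hm] := positive_bound (@ler01 R) (@ler01 R) hc.
  move=> s t _ _; rewrite /h /=; case: (eqVneq s t) => [->|st].
    by rewrite !subrr !normr0 add0r subr0 lt_max e0 orbT.
  by apply: ltr_wpDr; rewrite ?le_max ?lexx // normr_gt0 subr_eq0.
exists m => // s t hs ht st; have := hm s t hs ht; rewrite /h /= => h1.
have : 0 < Num.max 0 (e - `|F s - F t|) by lra.
by rewrite lt_max ltxx /= subr_gt0.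
Qed.

Lemma prod_norm_lt (x : R * R) e : (`|x| < e) = (`|x.1| < e) && (`|x.2| < e).
Proof. by rewrite prod_normE gt_max. Qed.

Lemma prod_norm_le (x : R * R) e : (`|x| <= e) = (`|x.1| <= e) && (`|x.2| <= e).
Proof. by rewrite prod_normE ge_max. Qed.

End Compactness.

Section Walks.
Variables (V : finType) (edges : seq (V * V)) (o : V -> nat * nat) (w : V * V -> nat -> nat * nat).
Variables (N h t : nat).
Hypothesis ht : h < t <= N.
Hypothesis noloop : forall e, e \in edges -> e.1 != e.2.
Hypothesis w_start : forall e, e \in edges -> w e 0 = o e.1.
Hypothesis w_stop : forall e, e \in edges -> w e N = o e.2.
Hypothesis w_step : forall e k, e \in edges -> k < N -> w e k = w e k.+1 \/ lattice (w e k) (w e k.+1).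

(** Up to the time [h] a walk is near its start, from the time [t] on it is near
    its stop; in between it is disjoint from all other walks. *)
Definition near_vertex (u : V) (p : nat * nat) : Prop :=
  p = o u \/ exists2 e, e \in edges & exists2 k, k <= N & p = w e k /\ (e.1 = u /\ k <= h \/ e.2 = u /\ t <= k).

Hypothesis near_disjoint : forall u v p, near_vertex u p -> near_vertex v p -> u = v.
Hypothesis walk_avoids : forall e k v, e \in edges -> k <= N -> near_vertex v (w e k) -> v = e.1 \/ v = e.2.
Hypothesis middle_disjoint : forall e f k l, e \in edges -> f \in edges -> h <= k <= t -> h <= l <= t ->
  w e k = w f l -> e = f.

(** The walk of [e] before it comes near the end of [e] is given to the start of
    [e], so that the branch sets of the two ends touch. *)
Definition branch_set (u : V) (p : nat * nat) : Prop :=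
  near_vertex u p \/ exists2 e, e \in edges & exists k,
    [/\ e.1 = u, k <= N, p = w e k & forall l, l <= k -> ~ near_vertex e.2 (w e l)].

Lemma branch_set_disjoint u v p : branch_set u p -> branch_set v p -> u = v.
Proof.
have mixed x y q : near_vertex x q -> branch_set y q -> x = y.
  move=> nq [nq'|[e ee [k [<- kN qE far]]]]; first exact: near_disjoint nq nq'.
  case: (walk_avoids (v := x) ee kN); rewrite -?qE // => xE.
  by case: (far k (leqnn k)); rewrite -qE -xE.
move=> [nu|bu]; first exact: mixed.
move=> [nv|bv]; first by apply/esym; apply: mixed nv (or_intror bu).
case: bu bv => e ee [k [eu kN pe fe]] [f ff [l [fv lN pf ff']]].
have bu : branch_set u p by right; exists e => //; exists k.
have bv : branch_set v p by right; exists f => //; exists l.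
case: (leqP k h) => kh.
  apply: (mixed u v p) => //; right; exists e => //; exists k => //; split=> //; by left.
case: (leqP l h) => lh.
  apply/esym; apply: (mixed v u p) => //; right; exists f => //; exists l => //; split=> //; by left.
case: (leqP t k) => tk.
  by case: (fe k (leqnn k)); right; exists e => //; exists k => //; split=> //; right.
case: (leqP t l) => tl.
  by case: (ff' l (leqnn l)); right; exists f => //; exists l => //; split=> //; right.
rewrite -eu -fv; congr fst; apply: (middle_disjoint ee ff (k := k) (l := l)); rewrite ?(ltnW kh) ?(ltnW lh) ?(ltnW tk) ?(ltnW tl) //.
by rewrite -pe -pf.
Qed.

Definition walk_points : seq (nat * nat) :=
  undup (map o (enum V) ++ [seq w e k | e <- edges, k <- iota 0 N.+1]).

Lemma walk_in e k : e \in edges -> k <= N -> w e k \in walk_points.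
Proof.
move=> ee kN; rewrite mem_undup mem_cat; apply/orP; right; apply/allpairsP; exists (e, k).
by split=> //=; rewrite -[0 :: _]/(iota 0 N.+1) mem_iota.
Qed.

Lemma origin_in v : o v \in walk_points.
Proof. by rewrite mem_undup mem_cat map_f // mem_enum. Qed.

(** The branch sets are connected, as every point of a walk leads back to an end
    of the walk, and disjoint, so they present the graph as a minor of the
    lattice. *)
Theorem walks_sweepable : exists2 ws, (forall v, v \in ws) &
  sweepable lattice_edge ws (fun u v => ((u, v) \in edges) || ((v, u) \in edges)).
Proof.
case: (pselect (exists v0 : V, True)) => [[v0 _]|noV]; last first.
  exists [::]; first by move=> v; case: noV; exists v.
  by exists [::]; split=> //; exact: Deriv0.
pose phi p : V := odflt v0 [pick v | `[< branch_set v p >]].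
have phiE v p : branch_set v p -> phi p = v.
  move=> bp; rewrite /phi; case: pickP => [u /asboolP bu|/(_ v)/asboolP //]; exact: branch_set_disjoint bu bp.
pose vs := [seq p <- walk_points | `[< exists v, branch_set v p >]].
have inP p : p \in vs -> p \in walk_points /\ branch_set (phi p) p.
  by rewrite mem_filter => /andP[/asboolP[v bv] ->]; rewrite (phiE v).
have in_vs v p : p \in walk_points -> branch_set v p -> p \in vs.
  by move=> pw bp; rewrite mem_filter pw andbT; apply/asboolP; exists v.
have bo v : branch_set v (o v) by left; left.
have [||ws wsP sw] := sweepable_minor (phi := phi) (n := size vs) (adj := lattice)
   (G := fun u v => ((u, v) \in edges) || ((v, u) \in edges)) (leqnn _) lattice_sym
   (@sweepable_lattice vs (filter_uniq _ (undup_uniq _))).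
- have to_origin (D : pred (nat * nat)) u q :
      (forall p q, p \in vs -> q \in vs -> phi p = u -> phi q = u -> lattice p q -> D p -> D q) ->
      q \in vs -> phi q = u -> D q = D (o u).
    move=> cl qv qu; have ovs : o u \in vs by apply: in_vs (origin_in u) (bo u).
    have cl2 p p' : p \in vs -> p' \in vs -> phi p = u -> phi p' = u -> p = p' \/ lattice p p' -> D p = D p'.
      move=> pv pv' pu pu' [->//|pp]; apply/idP/idP; apply: cl => //; by rewrite lattice_sym.
    have seg e a b : e \in edges -> a <= b -> b <= N -> (forall k, a <= k <= b -> branch_set u (w e k)) ->
        D (w e a) = D (w e b).
      move=> ee ab; rewrite -(subnKC ab); elim: (b - a) => [|k IH]; first by rewrite addn0.
      rewrite addnS => bN br; rewrite IH; [|exact: ltnW|by move=> j /andP[j1 j2]; apply: br; rewrite j1 ltnW].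
      have b1 : branch_set u (w e (a + k)) by apply: br; rewrite leq_addr leqW.
      have b2 : branch_set u (w e (a + k).+1) by apply: br; rewrite leqW ?leq_addr //=.
      apply: cl2; [exact: in_vs (walk_in ee (ltnW bN)) b1|exact: in_vs (walk_in ee bN) b2|exact: phiE|exact: phiE|exact: w_step].
    have [_] := inP q qv; rewrite qu => -[[->//|[e ee [k kN [-> [[eu kh]|[eu tk]]]]]]|[e ee [k [eu kN -> far]]]].
    + rewrite -eu -w_start //; apply/esym; apply: seg => // j jk; left; right; exists e => //.
      exists j; first exact: leq_trans kN; split=> //; left; split=> //; exact: leq_trans kh.
    + rewrite -eu -w_stop //; apply: seg => // j /andP[kj jN]; left; right; exists e => //.
      exists j => //; split=> //; right; split=> //; exact: leq_trans kj.
    + rewrite -eu -w_start //; apply/esym; apply: seg => // j jk; right; exists e => //.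
      exists j; split=> //; first exact: leq_trans kN; move=> l lj; apply: far; exact: leq_trans jk.
  move=> a D av Da cl q qv fq.
  rewrite (to_origin D (phi a)) //; by rewrite -(to_origin D (phi a) a).
- have edge_span e : e \in edges -> exists p q, [/\ p \in vs, q \in vs, phi p = e.1, phi q = e.2 & lattice p q].
    move=> ee; have [] := @ex_minnP (fun k => (k <= N) && `[< near_vertex e.2 (w e k) >]).
      exists N; rewrite leqnn /=; apply/asboolP; left; exact: w_stop.
    move=> m /andP[mN /asboolP nm] min; case: m mN nm min => [|m] mN nm min.
      rewrite w_start // in nm; have /eqP := near_disjoint nm (or_introl (erefl (o e.1))).
      by rewrite eq_sym (negbTE (noloop ee)).
    have b1 : branch_set e.1 (w e m).
      right; exists e => //; exists m; split=> //; first exact: ltnW.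
      move=> l lm nl; have := min l; rewrite (leq_trans (leqW lm) mN) /=.
      by move/asboolP: nl => -> /(_ isT); rewrite ltnNge lm.
    have b2 : branch_set e.2 (w e m.+1) by left.
    exists (w e m), (w e m.+1); rewrite (phiE _ _ b1) (phiE _ _ b2); split=> //.
    + exact: in_vs (walk_in ee (ltnW mN)) b1.
    + exact: in_vs (walk_in ee mN) b2.
    case: (w_step ee mN) => // eq; have := branch_set_disjoint b1; rewrite eq => /(_ _ b2)/eqP.
    by rewrite (negbTE (noloop ee)).
  move=> u v uv /orP[]/edge_span /= [p [q [pv qv pu qu pq]]]; first by exists p, q.
  by exists q, p; rewrite lattice_sym.
exists ws => // v; rewrite wsP; apply/mapP; exists (o v); last by rewrite (phiE v).
exact: in_vs (origin_in v) (bo v).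
Qed.
End Walks.

Section Discretise.
Variable R : realType.
Local Open Scope ring_scope.

Lemma common_bound (T : eqType) (s : seq T) (P : T -> R -> Prop) :
  (forall x m m', 0 < m' -> m' <= m -> P x m -> P x m') ->
  (forall x, x \in s -> exists2 m, 0 < m & P x m) ->
  exists2 m, 0 < m & forall x, x \in s -> P x m.
Proof.
move=> mono; elim: s => [|x s IH] h; first by exists 1.
have [m m0 hm] := h x (mem_head _ _).
have [|m' m0' hm'] := IH; first by move=> y ys; apply: h; rewrite inE ys orbT.
have mm : 0 < Num.min m m' by rewrite lt_min m0.
exists (Num.min m m') => // y; rewrite inE => /orP[/eqP ->|/hm' hy].
  by apply: mono hm; rewrite ?ge_min ?lexx.
by apply: mono hy; rewrite ?ge_min ?lexx ?orbT.
Qed.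

Section Grid.
Variables (B d : R).
Hypothesis d0 : 0 < d.

Definition grid (x : R) : nat := Num.truncn ((x + B) / d).

Lemma grid_itv x : `|x| <= B -> (grid x)%:R * d <= x + B < (grid x).+1%:R * d.
Proof.
move=> xB; have x0 : 0 <= x + B by have := lerNnormlW xB; lra.
by have /andP[h1 h2] := truncn_itv (divr_ge0 x0 (ltW d0)); rewrite -ler_pdivlMr // h1 -ltr_pdivrMr.
Qed.

Lemma grid_step x y : `|x| <= B -> `|y| <= B -> `|x - y| < d ->
  [\/ grid x = grid y, grid y = (grid x).+1 | grid x = (grid y).+1].
Proof.
move=> /grid_itv/andP[x1 x2] /grid_itv/andP[y1 y2]; rewrite ltr_norml => /andP[h1 h2].
have a1 : (grid x)%:R < (grid y).+2%:R :> R.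
  by rewrite -(ltr_pM2r d0) -natr1; apply: le_lt_trans x1 _; rewrite mulrDl; lra.
have a2 : (grid y)%:R < (grid x).+2%:R :> R.
  by rewrite -(ltr_pM2r d0) -natr1; apply: le_lt_trans y1 _; rewrite mulrDl; lra.
rewrite !ltr_nat in a1 a2; case: (ltngtP (grid x) (grid y)) => [xy|yx|]; last by constructor 1.
  by constructor 2; apply/eqP; rewrite eqn_leq xy -ltnS a2.
by constructor 3; apply/eqP; rewrite eqn_leq yx -ltnS a1.
Qed.

(** The slack of a second cell is for points whose two coordinates are rounded at
    different times. *)
Definition close (p : nat * nat) (x : R * R) : Prop :=
  `|p.1%:R * d - B - x.1| <= 2 * d /\ `|p.2%:R * d - B - x.2| <= 2 * d.

Lemma close_dist p x y : close p x -> close p y -> `|x - y| <= 4 * d.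
Proof.
move=> [h1 h2] [h3 h4]; rewrite prod_norm_le; move: h1 h2 h3 h4; rewrite !ler_norml /=.
by move=> /andP[? ?] /andP[? ?] /andP[? ?] /andP[? ?]; apply/andP; split; apply/andP; split; lra.
Qed.

Lemma close_grid x y : `|x| <= B -> `|y| <= B -> `|x - y| < d -> close (grid x.1, grid y.2) x.
Proof.
rewrite !prod_norm_le prod_norm_lt => /andP[/grid_itv/andP[x1 x2] _] /andP[_ /grid_itv/andP[y1 y2]] /andP[_].
rewrite /close ltr_norml /= => /andP[h1 h2]; rewrite -natr1 in x2; rewrite -natr1 in y2.
by split; rewrite ler_norml; apply/andP; split; lra.
Qed.
End Grid.

Section Curves.
Variables (V : finType) (edges : seq (V * V)) (pt : V -> R * R) (c : V * V -> R -> R * R).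
Hypothesis noloop : forall e, e \in edges -> e.1 != e.2.
Hypothesis pt_inj : injective pt.
Hypothesis c_cont : forall e, e \in edges -> continuous (c e).
Hypothesis c0 : forall e, e \in edges -> c e 0 = pt e.1.
Hypothesis c1 : forall e, e \in edges -> c e 1 = pt e.2.
Hypothesis c_inj : forall e s t, e \in edges -> 0 <= s <= 1 -> 0 <= t <= 1 -> c e s = c e t -> s = t.
Hypothesis c_avoid : forall e t v, e \in edges -> 0 <= t <= 1 -> c e t = pt v -> v = e.1 \/ v = e.2.
Hypothesis c_cross : forall e f s t, e \in edges -> f \in edges -> e != f -> 0 <= s <= 1 -> 0 <= t <= 1 ->
  c e s = c f t -> exists v, c e s = pt v.

(** The factor 3 leaves room for two balls of radius [rho] and for the error of
    rounding. *)
Lemma vertices_apart : exists2 rho, 0 < rho &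
  (forall u v, u != v -> 3 * rho <= `|pt u - pt v|) /\
  (forall e t v, e \in edges -> 0 <= t <= 1 -> v != e.1 -> v != e.2 -> 3 * rho <= `|c e t - pt v|).
Proof.
have [|e|m1 m10 h1] := @common_bound _ (enum {: V * V}) (fun e m => e.1 != e.2 -> 3 * m <= `|pt e.1 - pt e.2|).
- by move=> e m m' m0 mm h /h; lra.
- move=> _; case: (eqVneq e.1 e.2) => [_|ne]; first by exists 1.
  exists (`|pt e.1 - pt e.2| / 3); last by move=> _; lra.
  by rewrite divr_gt0 // normr_gt0 subr_eq0; apply: contra ne => /eqP/pt_inj ->.
have [|x|m2 m20 h2] := @common_bound _ [seq (e, v) | e <- edges, v <- enum V]
    (fun x m => forall t, 0 <= t <= 1 -> x.2 != x.1.1 -> x.2 != x.1.2 -> 3 * m <= `|c x.1 t - pt x.2|).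
- by move=> x m m' m0 mm h t t01 n1 n2; have := h t t01 n1 n2; lra.
- case/allpairsP=> -[e v] /= [ee _ ->] /=.
  case: (boolP ((v != e.1) && (v != e.2))) => [/andP[n1 n2]|ne]; last first.
    by exists 1 => // t _ n1 n2; rewrite n1 n2 in ne.
  have [||m m0 hm] := @separated R (c e) (fun=> pt v) 0 1 0 1 ler01 ler01 (c_cont ee).
  + by move=> ?; exact: cst_continuous.
  + move=> s t hs _ /(c_avoid ee hs) []/eqP; exact/negP.
  exists (m / 3) => [|t t01 _ _]; first by rewrite divr_gt0.
  by have := hm t t t01 t01; lra.
have mm : 0 < Num.min m1 m2 by rewrite lt_min m10.
exists (Num.min m1 m2) => //; split=> [u v uv|e t v ee t01 n1 n2].
  have := h1 (u, v); rewrite mem_enum => /(_ isT uv) /= h; apply: le_trans h.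
  by rewrite ler_pM2l // ge_min lexx.
have := h2 (e, v) _ t t01 n1 n2 => /(_ _)/le_trans h; apply: le_trans (h _ _ (lexx _)).
  by rewrite ler_pM2l // ge_min lexx orbT.
by apply/allpairsP; exists (e, v); split=> //=; rewrite mem_enum.
Qed.

Lemma uniform_step eps : 0 < eps -> exists n : nat, forall k s t e, (n <= k)%N -> e \in edges ->
  0 <= s <= 1 -> 0 <= t <= 1 -> `|s - t| <= k.+1%:R^-1 -> `|c e s - c e t| < eps.
Proof.
move=> e0; have [||m m0 hm] := @common_bound _ edges (fun e m => forall s t, 0 <= s <= 1 -> 0 <= t <= 1 -> `|s - t| < m -> `|c e s - c e t| < eps).
- by move=> e m m' m0 mm h s t hs ht st; apply: h => //; apply: lt_le_trans mm.
- by move=> e ee; exact: uniformly_continuous (c_cont ee) e0.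
have mi : 0 <= m^-1 by rewrite invr_ge0 ltW.
have /andP[_ h] := truncn_itv mi.
exists (Num.truncn m^-1) => k s t e nk ee hs ht st; apply: hm => //; apply: le_lt_trans st _.
rewrite -[ltRHS]invrK ltf_pV2 ?posrE ?invr_gt0 //; apply: lt_le_trans h _; by rewrite ler_nat.
Qed.

(** Two arcs meet only in vertices, which lie at the ends of the arcs, so the parts
    of arcs away from the ends are disjoint compact sets. *)
Lemma middles_apart a : 0 < a -> a <= 1 - a -> exists2 mu, 0 < mu &
  forall e f s t, e \in edges -> f \in edges -> e != f -> a <= s <= 1 - a -> a <= t <= 1 - a ->
    mu <= `|c e s - c f t|.
Proof.
move=> a0 a1.
have [|x|m m0 hm] := @common_bound _ [seq (e, f) | e <- edges, f <- edges]
   (fun x m => x.1 != x.2 -> forall s t, a <= s <= 1 - a -> a <= t <= 1 - a -> m <= `|c x.1 s - c x.2 t|).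
- by move=> x m m' m0 mm h n s t hs ht; apply: le_trans mm (h n s t hs ht).
- case/allpairsP=> -[e f] /= [ee ff ->] /=; case: (eqVneq e f) => [_|ne]; first by exists 1.
  have [|m m0 hm] := separated a1 a1 (c_cont ee) (c_cont ff); last by exists m.
  move=> s t /andP[s1 s2] /andP[t1 t2] cc.
  have s01 : 0 <= s <= 1 by apply/andP; split; lra.
  have t01 : 0 <= t <= 1 by apply/andP; split; lra.
  have [v vE] := c_cross ee ff ne s01 t01 cc.
  case: (c_avoid ee s01 vE) => ve; move: vE; rewrite ve; [rewrite -c0|rewrite -c1] => // /(c_inj ee s01).
    by rewrite lexx ler01 => /(_ isT) s0; lra.
  by rewrite lexx ler01 => /(_ isT) s0; lra.
exists m => // e f s t ee ff ne; apply: (hm (e, f)) => //.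
by apply/allpairsP; exists (e, f).
Qed.

Lemma curves_bounded : exists2 B, 0 <= B & (forall v, `|pt v| <= B) /\
  (forall e t, e \in edges -> 0 <= t <= 1 -> `|c e t| <= B).
Proof.
have inv (x m : R) : 0 < m -> m * x <= 1 -> x <= m^-1 by move=> m0; rewrite -[m^-1]mul1r ler_pdivlMr // mulrC.
have [||m1 m10 h1] := @common_bound _ (enum V) (fun v m => m * `|pt v| <= 1).
- by move=> v m m' m0 mm; apply: le_trans; rewrite ler_wpM2r.
- move=> v _; have v0 : 0 < 1 + `|pt v| by rewrite ltr_pwDl.
  by exists ((1 + `|pt v|)^-1); rewrite ?invr_gt0 // mulrC ler_pdivrMr // mul1r lerDr.
have [||m2 m20 h2] := @common_bound _ edges (fun e m => forall t, 0 <= t <= 1 -> m * `|c e t| <= 1).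
- by move=> e m m' m0 mm h t ht; apply: le_trans (h t ht); rewrite ler_wpM2r.
- move=> e ee.
  have [|t0 _ h] := @EVT_max R (fun t => `|c e t|) 0 1 ler01.
  + apply: continuous_subspaceT => t; apply: continuous_comp; [exact: c_cont|exact: norm_continuous].
  have v0 : 0 < 1 + `|c e t0| by rewrite ltr_pwDl.
  exists ((1 + `|c e t0|)^-1); rewrite ?invr_gt0 // => t t01; rewrite mulrC ler_pdivrMr // mul1r.
  by apply: le_trans (h t _) _; rewrite ?in_itv // lerDr.
exists (Num.max m1^-1 m2^-1); first by rewrite le_max invr_ge0 ltW.
split=> [v|e t ee t01]; rewrite le_max; first by rewrite inv // h1 // mem_enum.
by apply/orP; right; rewrite inv // h2.
Qed.

(** The constants are chosen in this order: [rho] separates vertices; near its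
    ends, in a fraction [a] of its time, an arc stays within [rho] of them; [mu]
    separates the remaining middle parts; [d] is the mesh of the lattice, small
    against [rho] and [mu]; [M] makes consecutive samples of an arc closer than
    [d]. *)
Theorem curves_sweepable : exists2 ws, (forall v, v \in ws) &
  sweepable lattice_edge ws (fun u v => ((u, v) \in edges) || ((v, u) \in edges)).
Proof.
have [rho rho0 [apart_v apart_e]] := vertices_apart.
have [n1 near1] := uniform_step rho0.
pose K := n1.+3; pose a : R := K%:R^-1.
have K0 : 0 < K%:R :> R by rewrite ltr0n.
have K3 : 3 <= K%:R :> R by rewrite ler_nat.
have a0 : 0 < a by rewrite invr_gt0.
have aK : a * K%:R = 1 by rewrite mulVf // lt0r_neq0.
have a1 : a <= 1 - a by rewrite -(ler_pM2r K0) mulrBl aK mul1r; lra.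
have [mu mu0 apart_m] := middles_apart a0 a1.
pose d := Num.min rho mu / 5.
have d0 : 0 < d by rewrite divr_gt0 // lt_min rho0.
have drho : 4 * d < rho.
  have : Num.min rho mu <= rho by rewrite ge_min lexx.
  by rewrite /d; lra.
have dmu : 4 * d < mu.
  have : Num.min rho mu <= mu by rewrite ge_min lexx orbT.
  by rewrite /d; lra.
have [n2 near2] := uniform_step d0.
pose M := n2.+1; pose N := (K * M)%N.
have MN3 : (3 * M <= N)%N by rewrite leq_mul2r.
have M1 : M = n2.+1 by [].
have aN : a * N%:R = M%:R by rewrite natrM mulrA aK mul1r.
clearbody N; clearbody M.
have MN : (M <= N)%N by nlia.
have N1 : (0 < N)%N by nlia.
have N0 : 0 < N%:R :> R by rewrite ltr0n.
have [B B0 [Bv Be]] := curves_bounded.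
pose z e k : R * R := c e (k%:R / N%:R).
have par01 k : (k <= N)%N -> 0 <= (k%:R / N%:R : R) <= 1.
  by move=> kN; rewrite divr_ge0 // ler_pdivrMr // mul1r ler_nat.
have zB e k : e \in edges -> (k <= N)%N -> `|z e k| <= B.
  by move=> ee kN; apply: Be => //; exact: par01.
have zstep e k : e \in edges -> (k < N)%N -> `|z e k - z e k.+1| < d.
  move=> ee kN; apply: (near2 N.-1) => //; [nlia|exact/par01/ltnW|exact: par01|].
  rewrite -mulrBl -natr1 opprD addrA subrr sub0r normrM normrN normr1 mul1r ger0_norm ?invr_ge0 //.
  by rewrite prednK.
pose o v := (grid B d (pt v).1, grid B d (pt v).2).
(* Consecutive samples may differ by a diagonal step, so the two coordinates are
   advanced in turn. *)
pose w e j := (grid B d (z e j./2).1, grid B d (z e (uphalf j)).2).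
have wclose e j : e \in edges -> (j <= N.*2)%N -> close B d (w e j) (z e j./2).
  move=> ee jN; apply: close_grid => //; [apply: zB => //; nlia|apply: zB => //; nlia|].
  rewrite uphalf_half; case: (boolP (odd j)) => oj; last by rewrite add0n subrr normr0.
  by rewrite add1n; apply: zstep => //; move: oj; nlia.
have oclose v : close B d (o v) (pt v).
  by apply: close_grid; rewrite ?subrr ?normr0.
have kM k : (k <= M)%N = (k%:R / N%:R <= a).
  rewrite ler_pdivrMr // aN ler_nat //.
have kM' k : (N - M <= k)%N = (1 - a <= k%:R / N%:R).
  by rewrite ler_pdivlMr // mulrBl mul1r aN -natrB // ler_nat.
have near_close u p : near_vertex edges o w N.*2 M.*2 (N - M).*2 u p ->
    exists2 x, close B d p x & `|x - pt u| < rho.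
  case=> [->|[e ee [k kN [-> [[eu kh]|[eu tk]]]]]].
  - by exists (pt u) => //; rewrite subrr normr0.
  - exists (z e k./2); first exact: wclose; rewrite -eu -c0 //.
    apply: (near1 n1.+2) => //; [nlia|apply: par01; nlia|by rewrite lexx ler01|].
    have k01 := par01 k./2; rewrite subr0 ger0_norm ?divr_ge0 //; rewrite -/K -/a -kM; nlia.
  - exists (z e k./2); first exact: wclose; rewrite -eu -c1 //.
    have k01 : 0 <= (k./2%:R / N%:R : R) <= 1 by apply: par01; nlia.
    apply: (near1 n1.+2) => //; [nlia|by rewrite lexx ler01|].
    have : (N - M <= k./2)%N by nlia.
    rewrite kM' distrC => h; rewrite ger0_norm ?subr_ge0; last by case/andP: k01.
    by rewrite -/K -/a; lra.
apply: (walks_sweepable (o := o) (w := w) (N := N.*2) (h := M.*2) (t := (N - M).*2)) => //; try nlia.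
- by move=> e ee; rewrite /w /z /= mul0r c0.
- by move=> e ee; rewrite /w /z uphalf_double doubleK divff ?lt0r_neq0 // c1.
- move=> e j ee jN; rewrite /w; have e1 : uphalf j.+1 = (j./2).+1 by [].
  have e2 : (j.+1)./2 = uphalf j by [].
  rewrite e1 e2 uphalf_half; case: (boolP (odd j)) => oj; rewrite ?add0n ?add1n.
    have jN' : (j./2 < N)%N by move: oj; nlia.
    have := zstep e _ ee jN'; rewrite prod_norm_lt => /andP[h _].
    have := grid_step d0 _ _ h; have := zB e _ ee (ltnW jN'); have := zB e _ ee jN'.
    rewrite !prod_norm_le => /andP[b1 _] /andP[b2 _] /(_ B b2 b1).
    by case=> ->; [by left|right|right]; rewrite /lattice /= ?eqxx ?orbT.
  have jN' : (j./2 < N)%N by move: oj; nlia.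
  have := zstep e _ ee jN'; rewrite prod_norm_lt => /andP[_ h].
  have := grid_step d0 _ _ h; have := zB e _ ee (ltnW jN'); have := zB e _ ee jN'.
  rewrite !prod_norm_le => /andP[_ b1] /andP[_ b2] /(_ B b2 b1).
  by case=> ->; [by left|right|right]; rewrite /lattice /= ?eqxx ?orbT.
- move=> u v p /near_close[x px xu] /near_close[y py yv]; apply/eqP; apply/negP => /negP uv.
  have h1 := apart_v u v uv; have h2 := close_dist px py.
  have : `|pt u - pt v| <= `|pt u - x| + (`|x - y| + `|y - pt v|).
    by apply: le_trans (ler_distD x _ _) _; rewrite lerD2l ler_distD.
  by rewrite distrC in xu; lra.
- move=> e k v ee kN /near_close[x px xv]; have h2 := close_dist (wclose e k ee kN) px.
  have k01 : 0 <= (k./2%:R / N%:R : R) <= 1 by apply: par01; nlia.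
  case: (eqVneq v e.1) => [|n1']; first by left.
  case: (eqVneq v e.2) => [|n2']; first by right.
  have h1 := apart_e e _ v ee k01 n1' n2'.
  have : `|z e k./2 - pt v| <= `|z e k./2 - x| + `|x - pt v| by rewrite ler_distD.
  by rewrite -/(z e k./2) in h1; move=> h3; exfalso; lra.
- move=> e f k l ee ff /andP[k1 k2] /andP[l1 l2] wE; apply/eqP; apply/negP => /negP ef.
  have mid j : (M.*2 <= j)%N -> (j <= (N - M).*2)%N -> a <= j./2%:R / N%:R <= 1 - a.
    have mm i : (M <= i <= N - M)%N -> a <= i%:R / N%:R <= 1 - a.
      move=> /andP[i1 i2].
      rewrite ler_pdivlMr // ler_pdivrMr // mulrBl mul1r aN -natrB //.
      by rewrite !ler_nat i1.
    by move=> j1 j2; apply: mm; nlia.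
  have h := apart_m e f _ _ ee ff ef (mid k k1 k2) (mid l l1 l2).
  have kN : (k <= N.*2)%N by nlia.
  have lN : (l <= N.*2)%N by nlia.
  have := wclose e k ee kN; rewrite wE => h3.
  by have := close_dist h3 (wclose f l ff lN); rewrite /z; lra.
Qed.

End Curves.
End Discretise.

Section PlanarSweep.
Variables (R : realType) (V : finType) (adj : rel V).
Local Open Scope classical_set_scope.
Local Open Scope ring_scope.

(** An undirected edge is drawn once, so it is oriented by an enumeration of the
    vertices. *)
Theorem planar_sweepable : irreflexive adj -> symmetric adj -> planar_graph R adj ->
  exists2 ws, (forall v, v \in ws) & sweepable lattice_edge ws adj.
Proof.
move=> adj_irr adj_sym [pt [G [pt_inj arcs avoid cross]]].
pose edges := [seq e <- enum {: V * V} | adj e.1 e.2 && (enum_rank e.1 < enum_rank e.2)%N].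
have eadj e : e \in edges -> adj e.1 e.2 by rewrite mem_filter => /andP[/andP[]].
have /choice[g gP] : forall e : V * V, exists g : R -> R * R, adj e.1 e.2 ->
    [/\ {within `[0, 1], continuous g}, {in `[0, 1] &, injective g},
        g 0 = pt e.1, g 1 = pt e.2 & g @` `[0, 1] = G [set e.1; e.2]%SET].
  move=> e; case: (boolP (adj e.1 e.2)) => [/arcs|_]; last by exists (fun=> 0).
  by case=> g gP; exists g => _.
pose c e := g e \o @clamp R.
have cE e t : 0 <= t <= 1 -> c e t = g e t by move=> t01; rewrite /c /= clamp_id.
have cG e t : e \in edges -> 0 <= t <= 1 -> G [set e.1; e.2]%SET (c e t).
  move=> /eadj/gP[_ _ _ _ <-] t01; exists t; rewrite ?cE //= in_itv //.
have b0 : 0 <= (0 : R) <= 1 by rewrite lexx ler01.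
have b1 : 0 <= (1 : R) <= 1 by rewrite lexx ler01.
have set_inj e f : e \in edges -> f \in edges -> [set e.1; e.2]%SET = [set f.1; f.2]%SET -> e = f.
  rewrite !mem_filter => /andP[/andP[_ le] _] /andP[/andP[_ lf] _] eS.
  have f1 : f.1 \in [set e.1; e.2]%SET by rewrite eS !inE eqxx.
  have f2 : f.2 \in [set e.1; e.2]%SET by rewrite eS !inE eqxx orbT.
  rewrite [e]surjective_pairing [f]surjective_pairing; move: f1 f2 lf; rewrite !inE.
  case/orP=> /eqP -> /orP[]/eqP ->; rewrite ?ltnn // => h; by have := ltn_trans le h; rewrite ltnn.
have [||||||||ws all_ws [evs [d f u pv he]]] := @curves_sweepable R V edges pt c.
- by move=> e /eadj; apply: contraTneq => ->; rewrite adj_irr.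
- exact: pt_inj.
- by move=> e /eadj/gP[gc _ _ _ _]; exact: continuous_clamp.
- by move=> e /eadj/gP[_ _ g0 _ _]; rewrite cE.
- by move=> e /eadj/gP[_ _ _ g1 _]; rewrite cE.
- move=> e s t /eadj/gP[_ gi _ _ _] s01 t01; rewrite !cE //; apply: gi; by rewrite in_itv.
- by move=> e t v ee t01 ctv; have := cG e t ee t01; rewrite ctv => /(avoid _ _ _ (eadj e ee))[]; [left|right].
- move=> e f s t ee ff ef s01 t01 cc.
  have ne : [set e.1; e.2]%SET != [set f.1; f.2]%SET by apply: contra ef => /eqP/set_inj ->.
  have [|v _ vE] := cross _ _ _ _ (eadj e ee) (eadj f ff) ne (c e s); last by exists v.
  by split; [exact: cG|rewrite cc; exact: cG].
exists ws => //; exists evs; split=> // x y xw yw xy axy; apply: he => //.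
have eT (p : V * V) : p \in enum {: V * V} by rewrite mem_enum.
rewrite ![_ \in edges]mem_filter !eT !andbT /= axy adj_sym axy /=.
by case: ltngtP => // /val_inj/enum_rank_inj e; rewrite e eqxx in xy.
Qed.
End PlanarSweep.

(** * Matrices of truth values *)

Definition table (n : nat) (f : nat -> nat -> bool) : word :=
  mkseq (fun p => f (p %/ n) (p %% n)) (n * n).

Lemma size_table n f : size (table n f) = n * n.
Proof. exact: size_mkseq. Qed.

Lemma table_lt n u v : u < n -> v < n -> u * n + v < n * n.
Proof. move=> un vn; apply: (@leq_trans (u.+1 * n)); first by rewrite mulSn addnC ltn_add2r.
by rewrite leq_mul2r un orbT. Qed.

Lemma nth_table n f u v : u < n -> v < n -> nth false (table n f) (u * n + v) = f u v.
Proof.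
move=> un vn; rewrite nth_mkseq ?table_lt // divnMDl ?(leq_ltn_trans _ vn) // divn_small // addn0.
by rewrite modnMDl modn_small.
Qed.

Definition nat_rel (T : Type) n (r : 'I_n -> 'I_n -> T) (d : T) (u v : nat) : T :=
  if (insub u, insub v) is (Some a, Some b) then r a b else d.

Lemma nat_relE T n (r : 'I_n -> 'I_n -> T) d (a b : 'I_n) : nat_rel r d a b = r a b.
Proof. by rewrite /nat_rel !valK. Qed.

Lemma allpairs_table m n (f : nat -> nat -> bool) :
  [seq f u v | u <- iota 0 m, v <- iota 0 n] = mkseq (fun p => f (p %/ n) (p %% n)) (m * n).
Proof.
elim: m => [|m IH]; first by rewrite mul0n.
rewrite -addn1 iotaD allpairs_cat IH mulnDl mul1n /mkseq iotaD map_cat add0n /= cats0; congr (_ ++ _).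
rewrite add0n (_ : iota (m * n) n = map (addn (m * n)) (iota 0 n)); last by rewrite -iotaDl addn0.
rewrite -map_comp; apply/eq_in_map => p; rewrite mem_iota /= => pn.
by rewrite divnMDl ?modnMDl ?(leq_ltn_trans _ pn) // divn_small // addn0 modn_small.
Qed.

Lemma encode_table D : encode D = table (nvert D) (nat_rel (darc (d := D)) false).
Proof.
rewrite /table -allpairs_table /encode -val_enum_ord.
rewrite -(map_allpairs id) /= allpairs_mapl allpairs_mapr map_id.
by apply: eq_allpairs => u v; rewrite nat_relE.
Qed.

Lemma size_encode D : size (encode D) = nvert D * nvert D.
Proof. by rewrite encode_table size_table. Qed.

Lemma nth_encode D (u v : 'I_(nvert D)) : nth false (encode D) (u * nvert D + v) = darc u v.
Proof. by rewrite encode_table nth_table // nat_relE. Qed.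

Lemma encode_inj : injective encode.
Proof.
move=> D D' e; have := congr1 size e; rewrite !size_encode => nn.
have {nn} n : nvert D = nvert D' by move: nn; rewrite !mulnn => /eqP; rewrite eqn_exp2r // => /eqP.
have arcs u v u' v' : val u = val u' -> val v = val v' -> darc (d := D) u v = darc (d := D') u' v'.
  by move=> uu vv; rewrite -!nth_encode e uu vv n.
case: D D' e n arcs => [n d irr] [n' d' irr'] /= _ nn; subst n' => arcs.
have dd : d = d' by apply/funext => u; apply/funext => v; exact: arcs.
by subst d'; congr Digraph; apply: Prop_irrelevance.
Qed.

(** * Acyclic sets *)

(** The order is reachability by a nonempty path inside the set. *)
Lemma acyclic_order (T : finType) (r : rel T) (A : pred T) :
  ~ (exists p, [/\ p != [::], {subset p <= A} & ucycle r p]) ->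
  exists S : rel T, [/\ irreflexive S, transitive S & forall x y, A x -> A y -> r x y -> S x y].
Proof.
move=> acy; pose rA x y := [&& A x, A y & r x y].
pose S x y := [exists z, rA x z && connect rA z y].
have SE x z y : rA x z -> connect rA z y -> S x y by move=> h1 h2; apply/existsP; exists z; rewrite h1.
exists S; split.
- move=> x; apply/negbTE/negP => /existsP[z /andP[xz /connectP[p zp xE]]]; apply: acy.
  case: (shortenP zp) xE xz => q zq uq _ -> xz; exists (z :: q); split=> //.
    have Az : A z by case/and3P: xz.
    move=> y; rewrite inE => /orP[/eqP -> //|yq].
    elim: q z zq {zp uq xz Az} yq => //= b q IH z /andP[/and3P[_ Ab _] bq]; rewrite inE => /orP[/eqP ->//|].
    exact: IH bq.
  rewrite /ucycle uq andbT /= rcons_path; apply/andP; split.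
    by apply: sub_path zq => a b /and3P[].
  by case/and3P: xz.
- move=> y x z /existsP[a /andP[xa ay]] /existsP[b /andP[yb bz]].
  by apply: SE xa _; apply: connect_trans ay (connect_trans (connect1 yb) bz).
by move=> x y Ax Ay xy; apply: SE (connect0 _ y); rewrite /rA Ax Ay.
Qed.

(** A cycle would make its first point less than itself. *)
Lemma order_acyclic (T : finType) (r S : rel T) (A : pred T) :
  irreflexive S -> transitive S -> (forall x y, A x -> A y -> r x y -> S x y) ->
  ~ (exists p, [/\ p != [::], {subset p <= A} & ucycle r p]).
Proof.
move=> irr tr rS [[|x p] [] //= _ sub /andP[cyc _]].
have : path S x (rcons p x).
  have : all A (x :: rcons p x).
    by apply/allP => y yp; apply: sub; move: yp; rewrite !inE mem_rcons inE orbA orbb.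
  have H : forall q y, path r y q -> all A (y :: q) -> path S y q.
    by elim=> //= z q IH y /andP[yz zq] /and3P[Ay Az Aq]; rewrite rS // IH //= Az.
  exact: H cyc.
by move/(order_path_min tr)/allP/(_ x); rewrite mem_rcons inE eqxx irr => /(_ isT).
Qed.

(** * Certificates *)

(** Planarity is a combinatorial property: the drawing can be forgotten. *)
Lemma planar_orderly (R : realType) (V : finType) (adj : rel V) : irreflexive adj -> symmetric adj ->
  planar_graph R adj <-> exists lt O, orderly adj lt O.
Proof.
move=> irr sym; split=> [pl|[ord [side h]]]; last exact: orderly_planar h irr.
have [ws all_ws sw] := planar_sweepable irr sym pl; apply: sweep_orderly sw => //.
by move=> v; rewrite irr.
Qed.

Section Certificate.
Variables (n : nat) (A L : nat -> nat -> bool) (O : nat -> nat -> nat -> nat -> bool).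
Variables (C : nat -> bool) (S : nat -> nat -> bool).

Definition itemb a b := (a == b) || ((A a b || A b a) && L a b).
Definition meetsb a b c d := L a d && L c b.

Definition strict_order_b (r : nat -> nat -> bool) :=
  [forall u : 'I_n, ~~ r u u] &&
  [forall u : 'I_n, [forall v : 'I_n, [forall w : 'I_n, r u v && r v w ==> r u w]]].

Definition orderly_b :=
  [&& strict_order_b L,
   [forall u : 'I_n, [forall v : 'I_n, (val u == val v) || (L u v || L v u)]],
   [forall a : 'I_n, [forall b : 'I_n, [forall c : 'I_n, [forall d : 'I_n,
     itemb a b && (itemb c d && (~~ ((val a == val c) && (val b == val d)) && meetsb a b c d)) ==>
     (O a b c d (+) O c d a b)]]]],
   [forall a : 'I_n, [forall b : 'I_n, [forall c : 'I_n, [forall d : 'I_n, [forall e : 'I_n, [forall f : 'I_n,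
     itemb a b && (itemb c d && (itemb e f && (meetsb a b c d && (meetsb c d e f && (meetsb a b e f &&
       (O a b c d && O c d e f)))))) ==> O a b e f]]]]]] &
   [forall a : 'I_n, [forall b : 'I_n, [forall c : 'I_n, [forall d : 'I_n, [forall v : 'I_n,
     itemb a b && (itemb c d && (~~ (val c == val d) && (meetsb a b v v && ((val c == val v) || (val d == val v))))) ==>
       ~~ (O a b c d (+) O a b v v)]]]]]].

Definition certified :=
  [&& [forall u : 'I_n, ~~ A u u], orderly_b, strict_order_b S &
   [forall u : 'I_n, [forall v : 'I_n, A u v ==> ((C u (+) C v) || S u v)]]].

Lemma strict_order_bP (r : nat -> nat -> bool) : reflect
  (irreflexive (fun u v : 'I_n => r u v) /\ transitive (fun u v : 'I_n => r u v)) (strict_order_b r).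
Proof.
apply: (iffP andP) => [[/forallP h1 /forallP h2]|[h1 h2]].
  split=> [u|v u w uv vw]; first exact/negbTE/h1.
  by have /forallP/(_ v)/forallP/(_ w) := h2 u; rewrite uv vw.
split; first by apply/forallP => u; rewrite h1.
by do 3!apply/forallP => ?; apply/implyP => /andP[]; exact: h2.
Qed.

Lemma orderly_bP : reflect
  (orderly (fun u v : 'I_n => A u v || A v u) (fun u v : 'I_n => L u v)
     (fun e f : 'I_n * 'I_n => O e.1 e.2 f.1 f.2)) orderly_b.
Proof.
set adj := fun u v : 'I_n => A u v || A v u; set lt := fun u v : 'I_n => L u v.
have it a b : itemb (val a) (val b) = item adj lt (a, b) by [].
have me a b c d : meetsb (val a) (val b) (val c) (val d) = meets lt (a, b) (c, d) by [].
apply: (iffP and5P) => [[/strict_order_bP[h1 h1'] h2 h3 h4 h5]|[h0 h1 h2 h3 h4 h5]]; split.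
- by move=> v; apply/negbT/h1.
- by move=> u v w; apply: h1'.
- move=> u v; have := forallP (forallP h2 u) v; by rewrite (inj_eq val_inj); case: (eqVneq u v).
- move=> [a b] [c d] ie jf ef m /=; have := forallP (forallP (forallP (forallP h3 a) b) c) d.
  by rewrite !it me ie jf m /= andbT -xpair_eqE ef.
- move=> [a b] [c d] [e f] i1 i2 i3 m1 m2 m3 o1 o2.
  have := forallP (forallP (forallP (forallP (forallP (forallP h4 a) b) c) d) e) f.
  by rewrite !it !me i1 i2 i3 m1 m2 m3 o1 o2.
- move=> [a b] [c d] v i1 i2 n0 m1 v0; have := forallP (forallP (forallP (forallP (forallP h5 a) b) c) d) v.
  rewrite !it !me i1 i2 m1 !(inj_eq val_inj) n0 v0 /=.
  by case: (O a b c d); case: (O a b v v).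
- apply/strict_order_bP; split=> [u|v u w]; [exact/negbTE/h0|exact: h1].
- by do 2!apply/forallP => ?; case: eqVneq => //=; exact: h2.
- do 4!apply/forallP => ?; apply/implyP; rewrite !it !me => /and4P[i1 i2 ne m].
  by apply: (h3 (_, _) (_, _)) => //; rewrite xpair_eqE.
- do 6!apply/forallP => ?; apply/implyP; rewrite !it !me => /and5P[i1 i2 i3 m1 /and4P[m2 m3 o1 o2]].
  exact: (h4 (_, _) (_, _) (_, _)) i1 i2 i3 m1 m2 m3 o1 o2.
- do 5!apply/forallP => ?; apply/implyP; rewrite !it !me !(inj_eq val_inj) => /and5P[i1 i2 n0 m v0].
  by rewrite negb_add; apply/eqP; apply: (h5 (_, _) (_, _)).
Qed.
End Certificate.

(** * Formulas that follow a truth value *)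

Section HoldsRules.
Variables (a : seq word) (t u : uterm) (b c : bool).
Hypotheses (ht : holdsu a t = b) (hu : holdsu a u = c).

Definition UXor t u := UIf t (UNot u) (UBool u).

Lemma holds_and : holdsu a (UAnd t u) = b && c. Proof. by rewrite holdsu_and ht hu. Qed.
Lemma holds_or : holdsu a (UOr t u) = b || c. Proof. by rewrite holdsu_or ht hu. Qed.
Lemma holds_imp : holdsu a (UImp t u) = (b ==> c). Proof. by rewrite holdsu_imp ht hu. Qed.
Lemma holds_not : holdsu a (UNot t) = ~~ b. Proof. by rewrite holdsu_not ht. Qed.
Lemma holds_xor : holdsu a (UXor t u) = b (+) c.
Proof.
rewrite -ht -hu /holdsu /=.
by case: (ueval a t); case: (ueval a u).
Qed.
End HoldsRules.

Lemma holds_forall a t u n (P : 'I_n -> bool) : ueval a t = n ->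
  (forall i : 'I_n, holdsu (rcons a (ones i)) u = P i) -> holdsu a (UAll t u) = [forall i, P i].
Proof.
move=> tn h; rewrite holdsu_all tn; apply/allP/forallP => [H i|H i].
  by rewrite -h H // mem_iota /=.
by rewrite mem_iota add0n => hi; rewrite -[i]/(val (Ordinal hi)) h.
Qed.

Lemma holds_eq a t u m k : ueval a t = m -> ueval a u = k -> holdsu a (UEq t u) = (m == k).
Proof. by move=> <- <-; exact: holdsu_eq. Qed.

Lemma holds_bit a i t w k : nth [::] a i = w -> ueval a t = k -> holdsu a (UBit i t) = nth false w k.
Proof. by move=> <- <-; exact: holdsu_bit. Qed.

Ltac reflect_formula := repeat first
  [ apply: holds_and | apply: holds_or | apply: holds_imp | apply: holds_not | apply: holds_xor
  | apply: holds_forall; [by rewrite /= ?size_ones|move=> ? /=]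
  | apply: holds_eq; by rewrite /= ?size_ones
  | apply: holds_bit; by rewrite /= ?size_ones ].

Section VerifierFormula.
Local Notation n := (UVar 2).
Local Notation v := UVar.
(** The variables are 0 for the matrix, 1 for the certificate, 2 for the number of
    vertices, and 3 onwards for the quantified vertices. *)
Definition u_pair s t := UAdd (UMul s n) t.
Definition u_A s t := UBit 0 (u_pair s t).
Definition u_L s t := UBit 1 (u_pair s t).
Definition u_O a b c d := UBit 1 (UAdd (UMul n n) (UAdd (UMul (u_pair a b) (UMul n n)) (u_pair c d))).
Definition u_C s := UBit 1 (UAdd (UAdd (UMul n n) (UMul (UMul n n) (UMul n n))) s).
Definition u_S s t := UBit 1 (UAdd (UAdd (UAdd (UMul n n) (UMul (UMul n n) (UMul n n))) n) (u_pair s t)).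
Definition u_item a b := UOr (UEq a b) (UAnd (UOr (u_A a b) (u_A b a)) (u_L a b)).
Definition u_meets a b c d := UAnd (u_L a d) (u_L c b).
Definition u_strict (r : uterm -> uterm -> uterm) :=
  UAnd (UAll n (UNot (r (v 3) (v 3))))
    (UAll n (UAll n (UAll n (UImp (UAnd (r (v 3) (v 4)) (r (v 4) (v 5))) (r (v 3) (v 5)))))).
Fixpoint u_all k t := if k is k'.+1 then UAll n (u_all k' t) else t.
Definition u_orderly :=
  UAnd (u_strict u_L)
  (UAnd (u_all 2 (UOr (UEq (v 3) (v 4)) (UOr (u_L (v 3) (v 4)) (u_L (v 4) (v 3)))))
  (UAnd (u_all 4 (UImp (UAnd (u_item (v 3) (v 4)) (UAnd (u_item (v 5) (v 6))
      (UAnd (UNot (UAnd (UEq (v 3) (v 5)) (UEq (v 4) (v 6)))) (u_meets (v 3) (v 4) (v 5) (v 6)))))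
      (UXor (u_O (v 3) (v 4) (v 5) (v 6)) (u_O (v 5) (v 6) (v 3) (v 4)))))
  (UAnd (u_all 6 (UImp (UAnd (u_item (v 3) (v 4)) (UAnd (u_item (v 5) (v 6)) (UAnd (u_item (v 7) (v 8))
      (UAnd (u_meets (v 3) (v 4) (v 5) (v 6)) (UAnd (u_meets (v 5) (v 6) (v 7) (v 8))
      (UAnd (u_meets (v 3) (v 4) (v 7) (v 8)) (UAnd (u_O (v 3) (v 4) (v 5) (v 6)) (u_O (v 5) (v 6) (v 7) (v 8)))))))))
      (u_O (v 3) (v 4) (v 7) (v 8))))
   (u_all 5 (UImp (UAnd (u_item (v 3) (v 4)) (UAnd (u_item (v 5) (v 6))
      (UAnd (UNot (UEq (v 5) (v 6))) (UAnd (u_meets (v 3) (v 4) (v 7) (v 7)) (UOr (UEq (v 5) (v 7)) (UEq (v 6) (v 7)))))))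
      (UNot (UXor (u_O (v 3) (v 4) (v 5) (v 6)) (u_O (v 3) (v 4) (v 7) (v 7))))))))).
Definition u_certified :=
  UAnd (UAll n (UNot (u_A (v 3) (v 3)))) (UAnd u_orderly (UAnd (u_strict u_S)
    (u_all 2 (UImp (u_A (v 3) (v 4)) (UOr (UXor (u_C (v 3)) (u_C (v 4))) (u_S (v 3) (v 4))))))).

(** The number of vertices is not given with the matrix; it is looked for as a
    square root of the length. *)
Definition verifier := UEx (UAdd (UVar 0) (UCst 1)) (UAnd (UEq (UMul n n) (UVar 0)) u_certified).

(** The certificate [y] is the concatenation of the tables of the order of the
    vertices, of the sides of pairs, of the colouring, and of the order that shows
    acyclicity. *)
Definition decoded (n : nat) (x y : word) : bool :=
  certified n (fun a b => nth false x (a * n + b)) (fun a b => nth false y (a * n + b))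
    (fun a b c d => nth false y (n * n + ((a * n + b) * (n * n) + (c * n + d))))
    (fun a => nth false y (n * n + n * n * (n * n) + a))
    (fun a b => nth false y (n * n + n * n * (n * n) + n + (a * n + b))).

Lemma holds_certified x y m : holdsu [:: x; y; ones m] u_certified = decoded m x y.
Proof. rewrite /decoded /certified /orderly_b /strict_order_b /itemb /meetsb. reflect_formula. Qed.

Lemma holds_verifier x y : reflect (exists n, size x = n * n /\ decoded n x y) (holdsu [:: x; y] verifier).
Proof.
rewrite holdsu_ex; apply: (iffP hasP) => [[n _]|[n [sx dn]]].
  rewrite holdsu_and holdsu_eq /= size_ones => /andP[/eqP sx c]; exists n; split=> //.
  by rewrite -holds_certified.
exists n; last by rewrite holdsu_and holdsu_eq /= size_ones sx eqxx holds_certified.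
by rewrite mem_iota /= sx; case: (n) => // k; rewrite mulnS; lia.
Qed.
End VerifierFormula.

(** * Membership *)

(** The matrix determines the digraph, so the certificate for the planarity and the
    2-colouring of any digraph with this matrix will do. *)
Theorem planar_dicolourability_in_NP (R : realType) : in_NP (planar_dicolourability R 2).
Proof.
exists (fun x y => holdsu [:: x; y] verifier), ('X ^+ 2 + 3%:P * 'X)%R; split; first exact: poly_time_rel_uterm.
move=> x; split=> [[D [xE pl [c col]]]|[y [_ /holds_verifier[n [sx]]]]].
  set n := nvert D in c col.
  pose r := darc (d := D).
  have uirr : irreflexive (underlying (D := D)) by move=> u; rewrite /underlying darc_irr.
  have usym : symmetric (underlying (D := D)) by move=> u v; rewrite /underlying orbC.
  have [slt [side ord]] := (planar_orderly R uirr usym).1 pl.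
  have Sex i : exists S : rel 'I_n, [/\ irreflexive S, transitive S & forall u v, c u == i -> c v == i -> r u v -> S u v].
    apply: acyclic_order => -[p [p0 ps pc]]; apply: (col i); exists p; split=> // u /ps.
    by rewrite inE.
  have [S0 [S0i S0t S0r]] := Sex ord0; have [S1 [S1i S1t S1r]] := Sex ord_max.
  have I2 (i : 'I_2) : i = ord0 \/ i = ord_max.
    by case: i => [[|[|//]] h]; [left|right]; apply: val_inj.
  pose S u v := [|| [&& c u == ord0, c v == ord0 & S0 u v] | [&& c u == ord_max, c v == ord_max & S1 u v]].
  pose On p q := nat_rel (fun a b => nat_rel (fun c d => side (a, b) (c, d)) false (q %/ n) (q %% n)) false (p %/ n) (p %% n).
  pose y := table n (nat_rel slt false) ++ table (n * n) On ++
     mkseq (fun u => nat_rel (fun a _ => c a == ord0) false u u) n ++ table n (nat_rel S false).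
  have yL (u v : 'I_n) : nth false y (u * n + v) = slt u v.
    by rewrite nth_cat size_table table_lt // nth_table // nat_relE.
  have yO (a b a' b' : 'I_n) : nth false y (n * n + ((a * n + b) * (n * n) + (a' * n + b'))) = side (a, b) (a', b').
    rewrite nth_cat size_table ltnNge leq_addr /= addKn nth_cat size_table !table_lt // nth_table ?table_lt //.
    have dm (i j : 'I_n) : (i * n + j) %/ n = i /\ (i * n + j) %% n = j.
      rewrite modnMDl modn_small // divnMDl ?(leq_ltn_trans _ (ltn_ord j)) //.
      by rewrite (divn_small (ltn_ord j)) addn0.
    by rewrite /On !(dm _ _).1 !(dm _ _).2 !nat_relE.
  have yC (u : 'I_n) : nth false y (n * n + n * n * (n * n) + u) = (c u == ord0).
    rewrite nth_cat size_table -addnA ltnNge leq_addr /= addKn nth_cat size_table ltnNge leq_addr /= addKn.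
    by rewrite nth_cat size_mkseq ltn_ord nth_mkseq // nat_relE.
  have yS (u v : 'I_n) : nth false y (n * n + n * n * (n * n) + n + (u * n + v)) = S u v.
    rewrite nth_cat size_table -!addnA ltnNge leq_addr /= addKn nth_cat size_table ltnNge leq_addr /= addKn.
    by rewrite nth_cat size_mkseq ltnNge leq_addr /= addKn nth_table // nat_relE.
  have xA (u v : 'I_n) : nth false x (u * n + v) = r u v by rewrite xE nth_encode.
  have sx : size x = n * n by rewrite xE size_encode.
  exists y; split.
    rewrite !size_cat !size_table size_mkseq sx.
    rewrite hornerD hornerXn hornerCM hornerX; set N := n * n.
    have nN : n <= N by rewrite /N; nia.
    have -> : (N ^+ 2 + 3 * N)%R = N * N + 3 * N by rewrite expr2.
    by lia.
  apply/holds_verifier; exists n; split=> //; apply/and4P; split.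
  - by apply/forallP => u; rewrite xA /r darc_irr.
  - apply/orderly_bP; case: ord => h0 h1 h2 h3 h4 h5.
    have itE e : item (fun u v : 'I_n => nth false x (u * n + v) || nth false x (v * n + u))
       (fun u v : 'I_n => nth false y (u * n + v)) e = item (@underlying D) slt e.
      by rewrite /item !xA yL.
    split; rewrite /meets.
    + by move=> v; rewrite yL.
    + by move=> u v w; rewrite !yL; exact: h1.
    + by move=> u v; rewrite !yL; exact: h2.
    + by move=> [a b] [a' b']; rewrite !itE !yL !yO; exact: h3.
    + by move=> [a b] [a' b'] [a'' b'']; rewrite !itE !yL !yO; exact: h4.
    + by move=> [a b] [a' b'] v; rewrite !itE !yL !yO; exact: h5.
  - apply/strict_order_bP; split=> [u|v u w]; rewrite !yS /S.
      by rewrite S0i S1i !andbF.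
    case/orP=> /and3P[/eqP-> /eqP-> h] /orP[]/and3P[] //= => [_ -> h'|_ -> h'].
      by rewrite (S0t _ _ _ h h').
    by rewrite (S1t _ _ _ h h').
  - apply/forallP => u; apply/forallP => v; apply/implyP; rewrite xA !yC yS => uv.
    rewrite /S; case: (I2 (c u)) => cu; case: (I2 (c v)) => cv; by rewrite cu cv /= ?S0r ?S1r ?cu ?cv ?eqxx.
set A := fun a b : nat => nth false x (a * n + b).
case/and4P=> /forallP Airr /orderly_bP ord /strict_order_bP[Sirr Str] /forallP Acol.
pose D := @Digraph n (fun u v : 'I_n => A u v) (fun u => negbTE (Airr u)).
have xE : x = encode D.
  rewrite encode_table; apply: (@eq_from_nth _ false); rewrite ?size_table // sx => p pn.
  have n0 : 0 < n by move: pn; case: (n).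
  have un : p %/ n < n by rewrite ltn_divLR.
  have vn : p %% n < n by rewrite ltn_pmod.
  have := nth_table (nat_rel (darc (d := D)) false) un vn; rewrite -divn_eq => ->.
  by rewrite -[p %/ n]/(val (Ordinal un)) -[p %% n]/(val (Ordinal vn)) nat_relE /= /A -divn_eq.
have uirr : irreflexive (underlying (D := D)) by move=> u; rewrite /underlying darc_irr.
have usym : symmetric (underlying (D := D)) by move=> u v; rewrite /underlying orbC.
exists D; split=> //.
  by apply/(planar_orderly R uirr usym); eexists; eexists; exact: ord.
pose C a := nth false y (n * n + n * n * (n * n) + a).
exists (fun u => if C u then ord0 else ord_max) => i.
case=> p [p0 ps pc].
pose B := [pred v : 'I_n | (if C v then ord0 else ord_max : 'I_2) == i].
have rS (u v : 'I_n) : B u -> B v -> darc (d := D) u v -> nth false y (n * n + n * n * (n * n) + n + (u * n + v)).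
  move=> /= cu cv uv; have /forallP/(_ v)/implyP/(_ uv) := Acol u.
  by rewrite -/(C u) -/(C v); case/orP=> //; move: cu cv; case: (C u); case: (C v) => //= /eqP <-.
by apply: (order_acyclic Sirr Str rS); exists p; split=> // u /ps; rewrite inE.
Qed.

(** * Straight drawings with king moves *)

Section King.
Variables (R : realType) (V : finType) (adj : rel V) (pos : V -> nat * nat).
Local Open Scope classical_set_scope.
Local Open Scope ring_scope.

Definition adjacent_nat (a b : nat) := (a <= b.+1)%N && (b <= a.+1)%N.

Hypothesis pos_inj : injective pos.
Hypothesis adj_irr : irreflexive adj.
Hypothesis adj_king : forall u v, adj u v ->
  adjacent_nat (pos u).1 (pos v).1 && adjacent_nat (pos u).2 (pos v).2.
Hypothesis adj_cross : forall u v x y, adj u v -> adj x y ->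
  (pos x).1 = (pos u).1 -> (pos y).1 = (pos v).1 -> (pos x).2 = (pos v).2 -> (pos y).2 = (pos u).2 ->
  (pos u).1 = (pos v).1 \/ (pos u).2 = (pos v).2.
Hypothesis adj_sym : symmetric adj.

Definition spot (v : V) : R * R := ((pos v).1%:R, (pos v).2%:R).

Definition segment (u v : V) (t : R) : R * R :=
  ((pos u).1%:R + t * ((pos v).1%:R - (pos u).1%:R), (pos u).2%:R + t * ((pos v).2%:R - (pos u).2%:R)).

Lemma spot_inj : injective spot.
Proof.
move=> u v [/eqP + /eqP]; rewrite !eqr_nat => /eqP e1 /eqP e2; apply: pos_inj.
by rewrite [LHS]surjective_pairing e1 e2 -surjective_pairing.
Qed.

Lemma segment_rev u v t : segment u v t = segment v u (1 - t).
Proof. by rewrite /segment; congr (_, _); ring. Qed.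

Lemma segment0 u v : segment u v 0 = spot u.
Proof. by rewrite /segment !mul0r !addr0. Qed.

Lemma segment1 u v : segment u v 1 = spot v.
Proof. by rewrite /segment !mul1r /spot; congr (_, _); ring. Qed.

Lemma segment_continuous u v : continuous (segment u v).
Proof.
have lin (a b : R) : continuous (fun t : R => a + t * b).
  move=> t; apply: (@continuousD _ _ _ (fun=> a) (fun t : R => t * b)); first exact: cst_continuous.
  by apply: (@continuousM _ _ id (fun=> b)); [exact: cvg_id|exact: cst_continuous].
by move=> t; exact: cvg_pair (lin _ _ t) (lin _ _ t).
Qed.

Lemma segment_inj u v : u != v -> injective (segment u v).
Proof.
move=> uv s t [/addrI e1 /addrI e2]; case: (eqVneq s t) => // st.
have z (x : R) : s * x = t * x -> x = 0.
  move=> h; have /eqP : (s - t) * x = 0 by rewrite mulrBl h subrr.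
  by rewrite mulf_eq0 subr_eq0 (negbTE st) => /eqP.
case/negP: uv; apply/eqP/spot_inj; rewrite /spot; congr (_, _); apply/eqP; rewrite eq_sym -subr_eq0; apply/eqP; exact: z.
Qed.

(** As the ends of an edge differ by at most 1 in a coordinate, the integer part of
    this coordinate of an inner point, and whether it is a whole number, determine
    the two ends up to their order. *)
Lemma coordinate_gap (a a' : nat) (t : R) : adjacent_nat a a' -> 0 < t < 1 ->
  exists (lo : nat) (f : R), [/\ a%:R + t * (a'%:R - a%:R) = lo%:R + f, 0 <= f < 1 &
    (f == 0) = (a == a') /\ (a, a') \in [:: (lo, lo); (lo, lo.+1); (lo.+1, lo)]].
Proof.
case/andP=> aa' a'a /andP[t0 t1]; case: (ltngtP a a') => [h|h|->].
- have -> : a' = a.+1 by lia.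
  exists a, t; rewrite ltW //= t1; split=> //; first by rewrite -natr1; ring.
  by rewrite !inE eqxx orbT gt_eqF // ltn_eqF.
- have -> : a = a'.+1 by lia.
  exists a', (1 - t); split; first by rewrite -natr1; ring.
    by apply/andP; split; lra.
  by rewrite !inE eqxx !orbT gt_eqF ?subr_gt0.
- by exists a', 0; rewrite subrr mulr0 !lexx ltr01 !eqxx inE eqxx.
Qed.

(** Two open edges with a point in common have, in each coordinate, the same two
    ends up to their order. So they are equal, or the two diagonals of a cell. *)
Lemma same_coordinate (a a' b b' : nat) (s t : R) : adjacent_nat a a' -> adjacent_nat b b' ->
  0 < s < 1 -> 0 < t < 1 -> a%:R + s * (a'%:R - a%:R) = b%:R + t * (b'%:R - b%:R) ->
  (a = b /\ a' = b') \/ (a = b' /\ a' = b).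
Proof.
move=> na nb s01 t01; have [lo [f [-> /andP[f0 f1] [fE inl]]]] := coordinate_gap na s01.
have [lo' [g [-> /andP[g0 g1] [gE inr]]]] := coordinate_gap nb t01 => e.
have lE : lo = lo'.
  have h1 : lo%:R < lo'.+1%:R :> R by rewrite -natr1; lra.
  have h2 : lo'%:R < lo.+1%:R :> R by rewrite -natr1; lra.
  by rewrite !ltr_nat !ltnS in h1 h2; apply/eqP; rewrite eqn_leq h1.
subst lo'; move: e => /addrI e; subst g; rewrite fE in gE.
by move: inl inr gE; rewrite !inE => /or3P[]/eqP[-> ->] /or3P[]/eqP[-> ->]; rewrite ?eqxx ?(eq_sym lo.+1) ?(ltn_eqF (ltnSn lo)) //; auto.
Qed.

Lemma segments_meet u v x y s t : adj u v -> adj x y -> 0 < s < 1 -> 0 < t < 1 ->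
  segment u v s = segment x y t -> [set u; v]%SET = [set x; y]%SET.
Proof.
move=> uv xy s01 t01 [e1 e2].
have /andP[k1 k2] := adj_king uv; have /andP[l1 l2] := adj_king xy.
have pE p q : (pos p).1 = (pos q).1 -> (pos p).2 = (pos q).2 -> p = q.
  by move=> h1 h2; apply: pos_inj; rewrite [LHS]surjective_pairing h1 h2 -surjective_pairing.
have cross p q p' q' : adj p q -> adj p' q' -> (pos p).1 = (pos p').1 -> (pos q).1 = (pos q').1 ->
    (pos p).2 = (pos q').2 -> (pos q).2 = (pos p').2 -> [set p; q]%SET = [set p'; q']%SET.
  move=> pq pq' h1 h2 h3 h4; case: (adj_cross pq pq' (esym h1) (esym h2) (esym h4) (esym h3)) => h.
    by rewrite (pE p q' (etrans h h2) h3) (pE q p' (etrans (esym h) h1) h4) finset.setUC.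
  by rewrite (pE p p' h1 (etrans h h4)) (pE q q' h2 (etrans (esym h) h3)).
case: (same_coordinate k1 l1 s01 t01 e1) => -[a1 a2]; case: (same_coordinate k2 l2 s01 t01 e2) => -[b1 b2].
- by rewrite (pE u x) // (pE v y).
- exact: cross.
- rewrite [RHS]finset.setUC; apply: cross => //; by rewrite adj_sym.
- by rewrite (pE u y) // (pE v x) // finset.setUC.
Qed.

(** The straight segments between neighbouring grid points form a plane drawing as
    soon as no cell contains both of its diagonals. *)
Theorem king_planar : planar_graph R adj.
Proof.
pose G (S : {set V}) : set (R * R) :=
  [set p | exists u v t, [/\ adj u v, S = [set u; v]%SET, 0 <= t <= 1 & p = segment u v t]].
have neq u v : adj u v -> u != v by apply: contraTneq => ->; rewrite adj_irr.
have set2 (u v x y : V) : u != v -> [set u; v]%SET = [set x; y]%SET -> (u = x /\ v = y) \/ (u = y /\ v = x).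
  move=> uv e; have : u \in [set x; y]%SET by rewrite -e !inE eqxx.
  have : v \in [set x; y]%SET by rewrite -e !inE eqxx orbT.
  by rewrite !inE => /orP[]/eqP vE /orP[]/eqP uE; subst; rewrite ?eqxx in uv; auto.
have cases p S : G S p -> exists u v t, [/\ adj u v, S = [set u; v]%SET, p = segment u v t &
     p = spot u \/ 0 < t < 1].
  case=> u [v [t [uv -> /andP[t0 t1] ->]]].
  case: (eqVneq t 0) => [->|n0]; first by exists u, v, 0; rewrite segment0; split=> //; left.
  case: (eqVneq t 1) => [->|n1].
    exists v, u, 0; rewrite adj_sym finset.setUC segment0 segment1; split=> //; by left.
  exists u, v, t; split=> //; right; rewrite !lt_neqAle t0 t1 n1 eq_sym n0 //.
exists spot, G; split; first exact: spot_inj.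
- move=> u v uv; exists (segment u v); split.
  + exact: continuous_subspaceT (@segment_continuous u v).
  + by move=> s t _ _; apply: segment_inj; exact: neq.
  + exact: segment0.
  + exact: segment1.
  apply/seteqP; split=> [_ [t /= + <-]|p [x [y [t [xy S t01 ->]]]]].
    by rewrite in_itv /= => t01; exists u, v, t.
  case: (set2 _ _ _ _ (neq _ _ uv) S) => -[-> ->].
    by exists t; rewrite //= in_itv.
  exists (1 - t); last by rewrite -segment_rev.
  by case/andP: t01 => t0 t1; rewrite /= in_itv /=; apply/andP; split; lra.
- move=> u v w uv /cases[x [y [t [xy S pE [e|t01]]]]].
    move/spot_inj: e => ->; case: (set2 _ _ _ _ (neq _ _ uv) S) => -[-> ->]; by [left|right].
  exfalso; move: pE; rewrite /spot /segment => -[e1 e2]; have /andP[k1 k2] := adj_king xy.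
  have key (a b c : nat) : adjacent_nat a b -> c%:R = a%:R + t * (b%:R - a%:R) -> a = b.
    move=> ab e; have [lo [f [e' f01 [fE _]]]] := coordinate_gap ab t01; apply/eqP; rewrite -fE.
    move: e; rewrite e' => e; case/andP: f01 => f0 f1; rewrite eq_le f0 andbT leNgt; apply/negP => fp.
    have : lo%:R < c%:R :> R by lra.
    have : c%:R < lo.+1%:R :> R by rewrite -natr1; lra.
    by rewrite !ltr_nat ltnS leqNgt => /negP.
  have h1 := key _ _ _ k1 e1; have h2 := key _ _ _ k2 e2.
  have /negP := neq _ _ xy; apply; apply/eqP; apply: pos_inj.
  by rewrite [LHS]surjective_pairing h1 h2 -surjective_pairing.
move=> u v x y uv xy ne p [/cases[a [b [s [ab Sab pab ea]]]] /cases[c [d [t [cd Scd pcd ec]]]]].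
case: ea => [->|s01]; first by exists a.
case: ec => [->|t01]; first by exists c.
have := segments_meet ab cd s01 t01; rewrite -pab -pcd -Sab -Scd => /(_ erefl) e.
by rewrite e eqxx in ne.
Qed.
End King.

(** * Strips of wires and clauses *)

Section Strip.
Variables (H S m : nat).
Variables (cut link : nat -> nat -> bool) (present : nat -> bool) (base : nat -> nat) (pat : nat -> nat -> bool).

(** A slot has 6 columns. In the row [k] of a clause the cycle uses a column whose
    parity is given by [pat s k], in the range 1, 2 on the way down and 3, 4 on
    the way up, so that it is monochromatic exactly for the given pattern. At the
    first and the last row the two ways meet; the meeting point is a king move
    away from both ways only if it lies between them, and this fixes its parity:
    the pattern has to change there. *)
Definition down_col s k :=
  if k == 0 then 2 + pat s 1 else if k == m.-1 then 2 + pat s m.-2 else 1 + pat s k.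
Definition up_col s k := if (k == 0) || (k == m.-1) then down_col s k else 3 + pat s k.

(** Wires and links are given in one direction, and [strip_arc] adds the other, so
    they are digons; [link] makes two neighbouring wires carry opposite values. *)
Definition wire_arc r c r' c' := [&& r == r', c' == c.+1 & ~~ ((c %% 6 == 5) && cut (c %/ 6) r)].
Definition link_arc r c r' c' := [&& c == c', c %% 6 == 0, r' == r.+1 & link (c %/ 6) r].
Definition down_arc s r c r' c' :=
  [&& r' == r.+1, c == down_col s (r - base s) & c' == down_col s (r' - base s)].
Definition up_arc s r c r' c' :=
  [&& r == r'.+1, c == up_col s (r - base s) & c' == up_col s (r' - base s)].
Definition clause_arc r c r' c' :=
  [&& c %/ 6 == c' %/ 6, present (c %/ 6), base (c %/ 6) <= minn r r', maxn r r' < base (c %/ 6) + m &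
      down_arc (c %/ 6) r (c %% 6) r' (c' %% 6) || up_arc (c %/ 6) r (c %% 6) r' (c' %% 6)].
Definition strip_arc r c r' c' :=
  [|| wire_arc r c r' c', wire_arc r' c' r c, link_arc r c r' c', link_arc r' c' r c | clause_arc r c r' c'].

Hypothesis m_ge : 3 < m.
Hypothesis pat_ends : forall s, present s -> pat s 0 != pat s 1 /\ pat s m.-1 != pat s m.-2.
Hypothesis base_le : forall s, s < S -> present s -> base s + m <= H.

Lemma down_step s k : k.+1 < m ->
  adjacent_nat (down_col s k) (down_col s k.+1) && adjacent_nat (up_col s k) (up_col s k.+1).
Proof.
move=> km; rewrite /up_col /down_col /adjacent_nat /=.
case: (eqVneq k 0) => [->|k0] /=.
  have -> : (1 == m.-1) = false by lia.
  by case: (pat s 1).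
have -> : (k == m.-1) = false by lia.
case: eqVneq => [e|_]; last by case: (pat s k); case: (pat s k.+1).
have -> : m.-2 = k by lia.
by case: (pat s k).
Qed.

Lemma down_up s k : k < m -> up_col s k = down_col s k \/ up_col s k = down_col s k + 2.
Proof.
move=> km; rewrite /up_col /down_col.
case: (eqVneq k 0) => [_|k0]; first by left.
by case: (eqVneq k m.-1) => [_|k1] /=; [left|right; lia].
Qed.

Lemma col_lt s k : down_col s k < 6 /\ up_col s k < 6.
Proof. by rewrite /up_col /down_col; split; repeat case: ifP => _; lia. Qed.

Lemma clause_colour s k : present s -> k < m ->
  odd (down_col s k) = ~~ (pat s k) /\ odd (up_col s k) = ~~ (pat s k).
Proof.
move=> /pat_ends[h1 h2] km; rewrite /up_col /down_col.
case: (eqVneq k 0) => [->|k0] /=; first by move: h1; case: (pat s 0); case: (pat s 1).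
case: (eqVneq k m.-1) => [->|k1] /=; first by move: h2; case: (pat s _); case: (pat s _).
by case: (pat s k).
Qed.

Lemma strip_arc_irr r c : strip_arc r c r c = false.
Proof.
rewrite /strip_arc /wire_arc /link_arc /clause_arc /down_arc /up_arc.
by rewrite !(ltn_eqF (ltnSn _)) !andbF.
Qed.

Definition strip_adj r c r' c' := strip_arc r c r' c' || strip_arc r' c' r c.

(** For planarity only positions matter; directions, cuts and absent clauses are
    forgotten. *)
Lemma strip_adjP r c r' c' : strip_adj r c r' c' ->
  [\/ r = r' /\ (c' = c.+1 \/ c = c'.+1), c = c' /\ (r' = r.+1 \/ r = r'.+1) |
   c %/ 6 = c' %/ 6 /\ exists k, k.+1 < m /\ exists r0,
     exists2 f, f = down_col (c %/ 6) \/ f = up_col (c %/ 6) &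
     (r = r0 /\ r' = r0.+1 /\ r0 = base (c %/ 6) + k /\ c %% 6 = f k /\ c' %% 6 = f k.+1) \/
     (r' = r0 /\ r = r0.+1 /\ r0 = base (c %/ 6) + k /\ c' %% 6 = f k /\ c %% 6 = f k.+1)].
Proof.
have cl a b a' b' : clause_arc a b a' b' -> b %/ 6 = b' %/ 6 /\ exists k, k.+1 < m /\ exists r0,
     exists2 f, f = down_col (b %/ 6) \/ f = up_col (b %/ 6) &
     (a = r0 /\ a' = r0.+1 /\ r0 = base (b %/ 6) + k /\ b %% 6 = f k /\ b' %% 6 = f k.+1) \/
     (a' = r0 /\ a = r0.+1 /\ r0 = base (b %/ 6) + k /\ b' %% 6 = f k /\ b %% 6 = f k.+1).
  case/and5P=> /eqP e _ b1 b2 /orP[]/and3P[/eqP ra /eqP h1 /eqP h2]; split=> //.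
    move: ra h1 h2 b1 b2 => -> h1 h2 b1 b2; exists (a - base (b %/ 6)); split; first lia.
    exists a; exists (down_col (b %/ 6)); first by left.
    by left; rewrite h1 h2; do !split=> //; [lia|congr down_col; lia].
  move: ra h1 h2 b1 b2 => -> h1 h2 b1 b2; exists (a' - base (b %/ 6)); split; first lia.
  exists a'; exists (up_col (b %/ 6)); first by right.
  by right; rewrite h1 h2; do !split=> //; [lia|congr up_col; lia].
case/orP=> /or4P[|||/orP[]].
- by case/and3P=> /eqP -> /eqP -> _; constructor 1; auto.
- by case/and3P=> /eqP -> /eqP -> _; constructor 1; auto.
- by case/and4P=> /eqP -> _ /eqP -> _; constructor 2; auto.
- by case/and4P=> /eqP -> _ /eqP -> _; constructor 2; auto.
- by move/cl => h; constructor 3.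
- by case/and3P=> /eqP -> /eqP -> _; constructor 1; auto.
- by case/and3P=> /eqP -> /eqP -> _; constructor 1; auto.
- by case/and4P=> /eqP -> _ /eqP -> _; constructor 2; auto.
- by case/and4P=> /eqP -> _ /eqP -> _; constructor 2; auto.
move/cl=> [e [k [km [r0 [f fE h]]]]]; constructor 3; rewrite -e; split=> //.
by exists k; split=> //; exists r0; exists f => //; tauto.
Qed.

Lemma strip_king r c r' c' : strip_adj r c r' c' -> adjacent_nat r r' && adjacent_nat c c'.
Proof.
case/strip_adjP=> [[-> [->|->]]|[-> [->|->]]|[e [k [km [r0 [f fE h]]]]]];
  try by rewrite /adjacent_nat !leqnn ?leqnSn ?leqW.
have fs : adjacent_nat (f k) (f k.+1) by case/andP: (down_step (c %/ 6) km) => d u; case: fE => ->.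
have ec := divn_eq c 6; have ec' := divn_eq c' 6; rewrite -e in ec'.
move: fs; rewrite /adjacent_nat => fs; apply/andP; split.
  by case: h => [[-> [-> _]]|[-> [-> _]]]; rewrite leqnn leqW ?leqW.
case: h => [[_ [_ [_ [h1 h2]]]]|[_ [_ [_ [h1 h2]]]]]; rewrite ec ec' h1 h2 -!addnS !leq_add2l //.
by rewrite andbC.
Qed.

Lemma strip_cross r c r' c' : strip_adj r c r' c' -> strip_adj r c' r' c -> r = r' \/ c = c'.
Proof.
case/strip_adjP=> [[-> _]|[-> _]|]; try by auto.
move=> [e [k [km [r0 [f fE h]]]]] /strip_adjP[[-> _]|[-> _]|]; try by auto.
move=> [_ [l [lm [r1 [g gE h']]]]]; rewrite -e in gE h'; right.
have ec := divn_eq c 6; have ec' := divn_eq c' 6; rewrite -e in ec'; rewrite ec ec'; congr (_ + _).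
clear ec ec' e.
have kl : k = l by case: h => [[? [? [? _]]]|[? [? [? _]]]]; case: h' => [[? [? [? _]]]|[? [? [? _]]]]; lia.
subst l; have [d1 d2] : (f k = g k.+1) /\ (f k.+1 = g k).
  by case: h => [[? [? [? [? ?]]]]|[? [? [? [? ?]]]]]; case: h' => [[? [? [? [? ?]]]]|[? [? [? [? ?]]]]];
    split; congruence || lia.
suff fk : f k = f k.+1 by case: h => [[_ [_ [_ [-> ->]]]]|[_ [_ [_ [-> ->]]]]]; rewrite fk.
have dk := down_up (c %/ 6) (ltnW km); have dk1 := down_up (c %/ 6) km.
case/andP: (down_step (c %/ 6) km); rewrite /adjacent_nat => /andP[s1 s2] /andP[s3 s4].
case: fE d1 d2 => ->; case: gE => -> d1 d2; lia.
Qed.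

Lemma clause_arcP r c r' c' : clause_arc r c r' c' ->
  [/\ c' %/ 6 = c %/ 6, present (c %/ 6) & exists k, r = base (c %/ 6) + k /\
    ((c %% 6 = down_col (c %/ 6) k /\ k.+1 < m /\ r' = base (c %/ 6) + k.+1 /\ c' %% 6 = down_col (c %/ 6) k.+1) \/
     (c %% 6 = up_col (c %/ 6) k /\ 0 < k < m /\ r' = base (c %/ 6) + k.-1 /\ c' %% 6 = up_col (c %/ 6) k.-1))].
Proof.
case/and5P=> /eqP e ps b1 b2 arc; split=> //; exists (r - base (c %/ 6)).
move: b1 b2; rewrite leq_min gtn_max => /andP[b1 b1'] /andP[b2 b2']; split; first by rewrite subnKC.
case/orP: arc => /and3P[/eqP ra /eqP -> /eqP ->]; [left|right]; subst; do !split=> //;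
  rewrite -?addnS ?subnKC //; try (congr down_col || congr up_col); nlia.
Qed.

Lemma slot_div s k : k < 6 -> (6 * s + k) %/ 6 = s /\ (6 * s + k) %% 6 = k.
Proof. by move=> k6; rewrite mulnC divnMDl // modnMDl divn_small // addn0 modn_small. Qed.

Lemma clause_arc_steps s k : present s -> k.+1 < m ->
  clause_arc (base s + k) (6 * s + down_col s k) (base s + k.+1) (6 * s + down_col s k.+1) /\
  clause_arc (base s + k.+1) (6 * s + up_col s k.+1) (base s + k) (6 * s + up_col s k).
Proof.
move=> ps km; have [d6 u6] := col_lt s k; have [d6' u6'] := col_lt s k.+1.
rewrite /clause_arc; have [-> ->] := slot_div s d6; have [-> ->] := slot_div s d6'.
have [-> ->] := slot_div s u6; have [-> ->] := slot_div s u6'.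
rewrite [minn (base s + k.+1) _]minnC [maxn (base s + k.+1) _]maxnC.
have -> : base s <= minn (base s + k) (base s + k.+1) by nlia.
have -> : maxn (base s + k) (base s + k.+1) < base s + m by nlia.
by rewrite /down_arc /up_arc !addKn !addnS !eqxx ps /= !orbT.
Qed.

Definition strip_width := 6 * S.

Definition strip : digraph := @Digraph (H * strip_width)
  (fun u v => strip_arc (u %/ strip_width) (u %% strip_width) (v %/ strip_width) (v %% strip_width))
  (fun u => strip_arc_irr _ _).

Local Notation W := strip_width.

Lemma strip_vertex r c : r < H -> c < W ->
  exists u : 'I_(nvert strip), u %/ W = r /\ u %% W = c.
Proof.
move=> rH cW; have h : r * W + c < nvert strip.
  by rewrite /= (@leq_trans (r.+1 * W)) ?leq_mul2r ?rH ?orbT // mulSn addnC ltn_add2r.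
exists (Ordinal h) => /=; rewrite divnMDl ?(leq_ltn_trans _ cW) // divn_small // addn0.
by rewrite modnMDl modn_small.
Qed.

Lemma strip_pos_inj (u v : 'I_(nvert strip)) : u %/ W = v %/ W -> u %% W = v %% W -> u = v.
Proof. by move=> h1 h2; apply: val_inj; rewrite /= (divn_eq u W) (divn_eq v W) h1 h2. Qed.

Lemma strip_pos_lt (u : 'I_(nvert strip)) : u %/ W < H /\ u %% W < W.
Proof.
have W0 : 0 < W.
  by have h : u < H * W := ltn_ord u; rewrite lt0n; apply: contraTneq h => ->; rewrite muln0.
by rewrite ltn_divLR // ltn_pmod.
Qed.

Theorem strip_planar (R : realType) : planar R strip.
Proof.
apply: (@king_planar R _ _ (fun u : 'I_(nvert strip) => (u %/ W, u %% W))) => /=.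
- by move=> u v [] /strip_pos_inj h /h.
- by move=> u; rewrite /underlying /= strip_arc_irr.
- by move=> u v; exact: strip_king.
- move=> u v x y uv + h1 h2 h3 h4; rewrite /underlying /= h1 h2 h3 h4; exact: strip_cross uv.
- by move=> u v; rewrite /underlying orbC.
Qed.

(** The wire of row [r] carries the value [b s r] in slot [s]. *)
Definition wiring (b : nat -> nat -> bool) : Prop :=
  [/\ forall s r, s.+1 < S -> r < H -> ~~ cut s r -> b s r = b s.+1 r,
      forall s r, s < S -> r.+1 < H -> link s r -> b s r != b s r.+1 &
      forall s g, s < S -> present s -> ~ forall k, k < m -> b s (base s + k) = pat s k (+) g].

Lemma slot_lt s k : s < S -> k < 6 -> 6 * s + k < W.
Proof. by rewrite /W; lia. Qed.

(** The value of a wire in a slot is the colour of its first vertex there; within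
    the slot it alternates with the column. If the values around a clause match
    its pattern, the order that contains the arcs of one colour would increase all
    the way down and back up. *)
Lemma dicolourable_wiring : dicolourable 2 strip -> exists b, wiring b.
Proof.
case=> c acy; pose K r j := if insub (r * W + j) is Some u then c u == ord_max else false.
have KE (u : 'I_(nvert strip)) : K (u %/ W) (u %% W) = (c u == ord_max).
  by rewrite /K -divn_eq valK.
have c2 (u v : 'I_(nvert strip)) : (c u == ord_max) = (c v == ord_max) -> c u = c v.
  by case: (c u) (c v) => [[|[|//]] p] [[|[|//]] q] //= _; apply: val_inj.
have order i : exists T : rel 'I_(nvert strip), [/\ irreflexive T, transitive T &
    forall u v, c u == i -> c v == i -> darc u v -> T u v].
  apply: acyclic_order => -[p [p0 ps pc]]; apply: (acy i); exists p; split=> // u /ps.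
  by rewrite inE.
have digon r j r' j' : r < H -> j < W -> r' < H -> j' < W -> strip_arc r j r' j' -> strip_arc r' j' r j ->
    K r j = ~~ K r' j'.
  move=> rH jW rH' jW' a1 a2.
  have [u [ur uj]] := strip_vertex rH jW; have [v [vr vj]] := strip_vertex rH' jW'.
  rewrite -ur -uj -vr -vj !KE; case: (eqVneq (c u == ord_max) (c v == ord_max)) => [/c2 cuv|]; last first.
    by case: (c u == _); case: (c v == _).
  have [T [Ti Tt Ta]] := order (c u).
  have := Ti u; rewrite (Tt v) //; apply: Ta; rewrite ?cuv //= ?ur ?uj ?vr ?vj //.
have wire r j : r < H -> j.+1 < W -> ~~ ((j %% 6 == 5) && cut (j %/ 6) r) -> K r j.+1 = ~~ K r j.
  move=> rH jW nc; apply: digon => //; [exact: ltnW|..]; rewrite /strip_arc /wire_arc !eqxx nc ?orbT //.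
exists (fun s r => K r (6 * s)).
have inslot s r k : s < S -> r < H -> k < 6 -> K r (6 * s + k) = K r (6 * s) (+) odd k.
  move=> sS rH; elim: k => [|k IH] k6; first by rewrite addn0 addbF.
  rewrite addnS wire //; last first.
  - by have [_ ->] := slot_div s (ltnW k6); rewrite (_ : (k == 5) = false) //; lia.
  - by rewrite -addnS slot_lt.
  by rewrite IH ?(ltnW k6) //= addbN.
split.
- move=> s r sS rH nc; have s5 := inslot s r 5 (ltnW sS) rH isT.
  have -> : 6 * s.+1 = (6 * s + 5).+1 by rewrite mulnS; lia.
  have [d1 d2] := @slot_div s 5 isT.
  rewrite wire // ?s5 ?d1 ?(negbTE nc) ?andbF //; first by rewrite addbT negbK.
  by have := slot_lt sS (isT : 0 < 6); lia.
- move=> s r sS rH l; rewrite (digon r _ r.+1 (6 * s)) ?negb_eqb ?addNb ?addbb //; try exact: ltnW;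
    try by have := slot_lt sS (isT : 0 < 6); rewrite addn0.
    by rewrite /strip_arc /link_arc !eqxx mulKn // modnMr eqxx l !orbT.
  by rewrite /strip_arc /link_arc !eqxx mulKn // modnMr eqxx l !orbT.
move=> s g sS ps bg; have bH := base_le sS ps.
have vert col k : (forall k, col k < 6) -> k < m -> exists u : 'I_(nvert strip),
    u %/ W = base s + k /\ u %% W = 6 * s + col k.
  by move=> c6 km; apply: strip_vertex; [lia|exact: slot_lt].
have d6 k : down_col s k < 6 := (col_lt s k).1.
have u6 k : up_col s k < 6 := (col_lt s k).2.
have colour (u : 'I_(nvert strip)) k col : col = down_col s \/ col = up_col s -> k < m ->
    u %/ W = base s + k -> u %% W = 6 * s + col k -> (c u == ord_max) = ~~ g.
  move=> cE km ur uc; have c6 : col k < 6 by case: cE => ->.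
  rewrite -KE ur uc inslot //; last by lia.
  rewrite bg //; have [h1 h2] := clause_colour ps km.
  have -> : odd (col k) = ~~ pat s k by case: cE => ->.
  by case: (pat s k); case: (g).
pose i : 'I_2 := if g then ord0 else ord_max.
have colour' (u : 'I_(nvert strip)) k col : col = down_col s \/ col = up_col s -> k < m ->
    u %/ W = base s + k -> u %% W = 6 * s + col k -> c u == i.
  move=> cE km ur uc; have := colour u k col cE km ur uc; rewrite /i; case: (g) => //=.
  by case: (c u) => [[|[|//]] p].
have [T [Ti Tt Ta]] := order i.
have step (u v : 'I_(nvert strip)) k : k.+1 < m -> u %/ W = base s + k -> v %/ W = base s + k.+1 ->
    (u %% W = 6 * s + down_col s k -> v %% W = 6 * s + down_col s k.+1 -> T u v) /\
    (u %% W = 6 * s + up_col s k -> v %% W = 6 * s + up_col s k.+1 -> T v u).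
  move=> km ur vr; split=> uc vc.
    apply: Ta; [apply: (colour' u k (down_col s))|apply: (colour' v k.+1 (down_col s))|] => //; try lia; try by left.
    by rewrite /= /strip_arc ur vr uc vc (clause_arc_steps ps km).1 !orbT.
  apply: Ta; [apply: (colour' v k.+1 (up_col s))|apply: (colour' u k (up_col s))|] => //; try lia; try by right.
  by rewrite /= /strip_arc ur vr uc vc (clause_arc_steps ps km).2 !orbT.
have [top [tr tc]] := vert (down_col s) 0 d6 ltac:(lia).
have downs k : k < m -> forall u : 'I_(nvert strip), u %/ W = base s + k -> u %% W = 6 * s + down_col s k ->
    u = top \/ T top u.
  elim: k => [|k IH] km u ur uc; first by left; apply: strip_pos_inj; rewrite ?ur ?uc.
  have [v [vr vc]] := vert (down_col s) k d6 (ltnW km); right.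
  have vu := (step v u k km vr ur).1 vc uc.
  by case: (IH (ltnW km) v vr vc) => [<-//|tv]; exact: Tt tv vu.
have ups k : k < m -> forall u : 'I_(nvert strip), u %/ W = base s + k -> u %% W = 6 * s + up_col s k ->
    u = top \/ T u top.
  elim: k => [|k IH] km u ur uc; first by left; apply: strip_pos_inj; rewrite ?ur ?uc ?tr ?tc.
  have [v [vr vc]] := vert (up_col s) k u6 (ltnW km); right.
  have uv := (step v u k km vr ur).2 vc uc.
  by case: (IH (ltnW km) v vr vc) => [<-//|vt]; exact: Tt uv vt.
have ml : m.-1 < m by lia.
have [bot [br bc]] := vert (down_col s) m.-1 d6 ml.
have nb : bot <> top by move=> e; have := br; rewrite e tr; lia.
case: (downs _ ml bot br bc) => [//|h1].
have bc' : bot %% W = 6 * s + up_col s m.-1 by rewrite bc /up_col eqxx orbT.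
case: (ups _ ml bot br bc') => [//|h2].
by have := Ti top; rewrite (Tt _ _ _ h1 h2).
Qed.

(** Wires and links join vertices of different colours, so a monochromatic cycle
    consists of clause arcs. Then it stays in one slot and, as an inner vertex of
    a clause has a single clause arc leaving it, goes once around the clause. *)
Lemma wiring_dicolourable b : wiring b -> dicolourable 2 strip.
Proof.
case=> persist linked clauses.
pose col (u : 'I_(nvert strip)) := b (u %% W %/ 6) (u %/ W) (+) odd (u %% W).
exists (fun u => if col u then ord_max else ord0) => i -[p [p0 ps pc]].
have [x0 x0p] : exists x, x \in p by case: (p) p0 => // x q _; exists x; rewrite mem_head.
pose g := col x0.
have colp x : x \in p -> col x = g.
  move=> xp; have := ps x xp; have := ps x0 x0p; rewrite !inE -/g => /eqP <-.
  by case: (col x); case: (g).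
have slotS (x : 'I_(nvert strip)) : x %% W %/ 6 < S.
  have [_ h] := strip_pos_lt x; rewrite ltn_divLR //; move: h; rewrite /W; nlia.
have wire_ne (x y : 'I_(nvert strip)) : wire_arc (x %/ W) (x %% W) (y %/ W) (y %% W) -> col x != col y.
  case/and3P=> /eqP rE /eqP cE nc; rewrite /col cE -rE /=.
  suff -> : b ((x %% W).+1 %/ 6) (x %/ W) = b (x %% W %/ 6) (x %/ W) by case: (b _ _); case: (odd _).
  have xs := divn_eq (x %% W) 6; have := ltn_pmod (x %% W) (isT : 0 < 6).
  set q := x %% W %/ 6 in xs nc *; set k := x %% W %% 6 in xs nc * => k6; rewrite xs mulnC.
  case: (ltnP k 5) => k5; first by rewrite -addnS !(slot_div _ _).1.
  have k_5 : k = 5 by nlia.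
  rewrite k_5 /= in nc; have -> : (6 * q + k).+1 = 6 * q.+1 + 0 by rewrite k_5 mulnS; nlia.
  rewrite (slot_div _ _).1 // [RHS]persist //; last by have [] := strip_pos_lt x.
  by have := slotS y; rewrite cE xs k_5 -addnS (_ : q * 6 + 6 = 6 * q.+1 + 0) ?(slot_div _ _).1 // mulnS; nlia.
have link_ne (x y : 'I_(nvert strip)) : link_arc (x %/ W) (x %% W) (y %/ W) (y %% W) -> col x != col y.
  case/and4P=> /eqP cE _ /eqP rE lk; have := linked _ _ (slotS x) _ lk; rewrite /col -cE -rE.
  by move=> /(_ (strip_pos_lt y).1); case: (b _ _); case: (b _ _); case: (odd _).
have succ x : x \in p -> exists2 y : 'I_(nvert strip), y \in p & clause_arc (x %/ W) (x %% W) (y %/ W) (y %% W).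
  move=> xp; case/andP: pc => cyc _; exists (next p x); first by rewrite mem_next.
  have := next_cycle cyc xp; set y := next p x => xy.
  have exy : col x = col y by rewrite !colp // /y mem_next.
  case/orP: xy => [/wire_ne|/or4P[/wire_ne|/link_ne|/link_ne|//]]; by rewrite exy eqxx.
pose s := x0 %% W %/ 6.
pose at_col f k := exists x : 'I_(nvert strip), [/\ x \in p, x %% W %/ 6 = s, x %/ W = base s + k & x %% W %% 6 = f s k].
have d_u k : 0 < k -> k < m.-1 -> down_col s k != up_col s k.
  move=> k0 km; have n0 : (k == 0) = false by nlia.
  have n1 : (k == m.-1) = false by nlia.
  by rewrite /up_col /down_col n0 n1 eqn_add2r.
have move x : x \in p -> x %% W %/ 6 = s -> present s /\ exists k, x %/ W = base s + k /\
    ((x %% W %% 6 = down_col s k /\ k.+1 < m /\ at_col down_col k.+1) \/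
     (x %% W %% 6 = up_col s k /\ 0 < k < m /\ at_col up_col k.-1)).
  move=> xp xs; have [y yp] := succ x xp; case/clause_arcP; rewrite xs => ys ps' [k [xk h]].
  split=> //; exists k; split=> //; case: h => [[h1 [h2 [h3 h4]]]|[h1 [h2 [h3 h4]]]]; [left|right];
    do !split=> //; by exists y.
have ps0 : present s by have [] := move x0 x0p erefl.
have down_next k : k.+1 < m -> at_col down_col k -> at_col down_col k.+1.
  move=> km [x [xp xs xr xc]]; have [_ [l [lr [[_ [_ h]]|[uc [/andP[l0 lm] _]]]]]] := move x xp xs.
    by have -> : k = l by apply/(@addnI (base s)); rewrite -xr -lr.
  have lk : l = k by apply/(@addnI (base s)); rewrite -xr -lr.
  subst l; have := d_u k l0; rewrite -uc xc eqxx => h; by have /h : k < m.-1 by nlia.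
have up_next k : 0 < k -> k < m -> at_col up_col k -> at_col up_col k.-1.
  move=> k0 km [x [xp xs xr xc]]; have [_ [l [lr [[dc [lm _]]|[_ [_ h]]]]]] := move x xp xs; last first.
    by have -> : k = l by apply/(@addnI (base s)); rewrite -xr -lr.
  have lk : l = k by apply/(@addnI (base s)); rewrite -xr -lr.
  subst l; have := d_u k k0; rewrite -dc xc eqxx => h; by have /h : k < m.-1 by nlia.
have up_top k : k < m -> at_col up_col k -> at_col up_col 0.
  by elim: k => [//|k IH] km h; apply: IH (ltnW km) _; exact: up_next h.
have down_bottom k : k < m -> at_col down_col k -> at_col down_col m.-1.
  move=> km h; have : forall d, k + d < m -> at_col down_col (k + d).
    by elim=> [|d IH]; rewrite ?addn0 // addnS => kd; apply: down_next => //; apply: IH; exact: ltnW.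
  by move/(_ (m.-1 - k)); rewrite subnKC; [apply|]; nlia.
have bottom_up : at_col down_col m.-1 -> at_col up_col m.-1.
  by move=> [x [h1 h2 h3 h4]]; exists x; split=> //; rewrite h4 /up_col eqxx orbT.
have top_down : at_col up_col 0 -> at_col down_col 0.
  by move=> [x [h1 h2 h3 h4]]; exists x; split=> //; rewrite h4 /up_col eqxx.
have top0 : at_col down_col 0.
  apply: top_down; have [_ [k [xr [[_ [km h]]|[_ [/andP[k0 km] h]]]]]] := move x0 x0p erefl.
    by apply: (up_top m.-1) => //; [nlia|apply: bottom_up; exact: down_bottom h].
  by apply: up_top h; nlia.
have all_down k : k < m -> at_col down_col k.
  by elim: k => // k IH km; apply: down_next => //; apply: IH; exact: ltnW.
apply: (clauses s (~~ g) (slotS x0) ps0) => k km.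
have [x [xp xs xr xc]] := all_down k km; have := colp x xp; rewrite /col xs xr.
have [h _] := clause_colour ps0 km; rewrite -(@odd_mod (x %% W) 6) // xc h => <-.
by case: (b _ _); case: (pat s k).
Qed.

Theorem strip_dicolourable : dicolourable 2 strip <-> exists b, wiring b.
Proof. by split=> [/dicolourable_wiring|[b /wiring_dicolourable]]. Qed.

End Strip.

(** * Tableaux *)

Section Tableau.
Variables (Q : finType) (TT JJ : nat) (allowed : nat -> nat -> Q -> Q -> Q -> Q -> bool).

Definition tableau (s : nat -> nat -> Q) : Prop := forall t j, t < TT -> j < JJ ->
  allowed t j (s t j) (s t j.+1) (s t.+1 j) (s t.+1 j.+1).

Definition code_length := #|Q| + 4.
Local Notation h := code_length.
(** A state is coded in unary, between two pairs of unequal bits. The first bit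
    tells a code from the complement of a code; because of the pairs, a block of
    codes changes at both ends, so that links can demand this of all blocks. *)
Definition code (q : Q) (k : nat) : bool :=
  nth false ([:: false; true] ++ [seq q == x | x <- enum Q] ++ [:: false; true]) k.
Definition window_length := 4 * h.
Local Notation m := window_length.

Lemma h_ge : 3 < h. Proof. by rewrite /code_length addn4. Qed.
Lemma m_ge : 3 < m. Proof. by rewrite /window_length; have := h_ge; lia. Qed.

Lemma code0 q : code q 0 = false. Proof. by []. Qed.
Lemma code1 q : code q 1 = true. Proof. by []. Qed.

Lemma code_last q : code q (h - 2) = false /\ code q (h - 1) = true.
Proof.
have e k : code q (#|Q| + 2 + k) = nth false [:: false; true] k.
  by rewrite /code addnC addnA addn2 /= nth_cat size_map -cardE ltnNge leq_addl /= addnK.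
have -> : h - 2 = #|Q| + 2 + 0 by rewrite /code_length; lia.
have -> : h - 1 = #|Q| + 2 + 1 by rewrite /code_length; lia.
by rewrite !e.
Qed.

Lemma code_rank q q' : code q (2 + enum_rank q') = (q == q').
Proof.
have -> : code q (2 + enum_rank q') = nth false ([seq q == x | x <- enum Q] ++ [:: false; true]) (enum_rank q') by [].
by rewrite nth_cat size_map -cardE ltn_ord (nth_map q') -?cardE // nth_enum_rank.
Qed.

Lemma code_inj q q' g g' : (forall k, k < h -> code q k (+) g = code q' k (+) g') -> q = q'.
Proof.
move=> e; have gg : g = g' by have := e 0 (ltn_trans (isT : 0 < 3) h_ge); rewrite !code0.
have := e (2 + enum_rank q); rewrite !code_rank eqxx gg => /(_ _)/addIb/esym/eqP -> //.
by rewrite /code_length addnC -addSn; apply: leq_add (ltn_ord _) _.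
Qed.

Definition patterns := enum {ffun 'I_m -> bool}.
Local Notation P := (size patterns).
Definition pattern (a k : nat) : bool :=
  if insub k is Some i then nth [ffun=> false] patterns a i else false.

Lemma patternP (f : nat -> bool) : exists2 a, a < P & forall k, k < m -> pattern a k = f k.
Proof.
pose g := [ffun k : 'I_m => f k]; exists (index g patterns).
  by rewrite index_mem mem_enum.
by move=> k km; rewrite /pattern insubT nth_index ?mem_enum // ffunE.
Qed.

Lemma patterns_gt0 : 0 < P.
Proof. by have [a aP _] := patternP (fun=> false); exact: leq_ltn_trans aP. Qed.

(** Of the two rows of a window, the one at an even time has the even groups of
    wires. *)
Definition window_code (o : bool) q1 q2 q3 q4 (k : nat) : bool :=
  code (nth q1 (if o then [:: q3; q1; q4; q2] else [:: q1; q3; q2; q4]) (k %/ h)) (k %% h).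

(** A common complement is allowed for, as clauses do not distinguish a pattern
    from its complement. *)
Definition good t j (f : nat -> bool) : bool :=
  [exists q1, [exists q2, [exists q3, [exists q4, allowed t j q1 q2 q3 q4 &&
    [exists g : bool, [forall k : 'I_m, f k == window_code (odd t) q1 q2 q3 q4 k (+) g]]]]]].

Lemma goodP t j f : reflect (exists q1 q2 q3 q4 g, allowed t j q1 q2 q3 q4 /\
    forall k, k < m -> f k = window_code (odd t) q1 q2 q3 q4 k (+) g) (good t j f).
Proof.
apply: (iffP idP) => [/existsP[q1 /existsP[q2 /existsP[q3 /existsP[q4 /andP[al /existsP[g /forallP fg]]]]]]|].
  by exists q1, q2, q3, q4, g; split=> // k km; apply/eqP; apply: (fg (Ordinal km)).
case=> q1 [q2 [q3 [q4 [g [al fg]]]]].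
apply/existsP; exists q1; apply/existsP; exists q2; apply/existsP; exists q3; apply/existsP; exists q4; rewrite al; apply/existsP; exists g; apply/forallP => k.
by rewrite fg.
Qed.

(** There is a slot for each time, window and pattern, numbered in this
    lexicographic order. *)
Definition slot_time s := s %/ (JJ * P).
Definition slot_cell s := (s %/ P) %% JJ.
Definition slot_pattern s := pattern (s %% P).
Definition slot_present s :=
  [&& slot_pattern s 0 != slot_pattern s 1, slot_pattern s m.-1 != slot_pattern s m.-2 &
      ~~ good (slot_time s) (slot_cell s) (slot_pattern s)].
Definition slot_base s := 2 * slot_cell s * h.
(** After the last slot of a time its own row has served, and the wires of its
    parity are released for the row two steps later. *)
Definition slot_cut s r := (s.+1 %% (JJ * P) == 0) && (odd (r %/ h) == odd (slot_time s)).
(** A window starts with an even group and stops with an odd one. The links make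
    the first two wires of a window differ, and the last two, so that the
    patterns for which there can be no clause do not occur. *)
Definition slot_link (s r : nat) :=
  (r %% h == 0) && ~~ odd (r %/ h) || (r %% h == h - 2) && odd (r %/ h).
Definition slots := TT * (JJ * P).
Definition rows := 2 * h * JJ.+1.

Hypotheses (T0 : 0 < TT) (J0 : 0 < JJ).

Lemma slot_pattern_ends s : slot_present s ->
  slot_pattern s 0 != slot_pattern s 1 /\ slot_pattern s m.-1 != slot_pattern s m.-2.
Proof. by case/and3P. Qed.

Lemma slot_base_le s : s < slots -> slot_present s -> slot_base s + m <= rows.
Proof.
move=> _ _; rewrite /slot_base /rows /window_length; have : slot_cell s < JJ by rewrite ltn_pmod.
move: (slot_cell s) => c cJ; have : c.+1 * h <= JJ * h by rewrite leq_mul2r cJ orbT.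
nlia.
Qed.

Lemma row_div g k : k < h -> (g * h + k) %/ h = g /\ (g * h + k) %% h = k.
Proof.
by move=> kh; rewrite divnMDl ?modnMDl ?(leq_ltn_trans _ kh) // divn_small // modn_small // addn0.
Qed.

Lemma slot_timeS s : slot_time s.+1 = (s.+1 %% (JJ * P) == 0) + slot_time s.
Proof. by rewrite /slot_time divnS // muln_gt0 J0 patterns_gt0. Qed.

Lemma slotE t j a : j < JJ -> a < P -> let s := (t * JJ + j) * P + a in
  [/\ slot_time s = t, slot_cell s = j & s %% P = a].
Proof.
move=> jJ aP /=; have P0 := patterns_gt0.
have e : ((t * JJ + j) * P + a) %/ P = t * JJ + j by rewrite divnMDl // divn_small // addn0.
rewrite /slot_time [JJ * P]mulnC divnMA e /slot_cell e divnMDl // divn_small // addn0 !modnMDl.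
by rewrite !modn_small.
Qed.

Local Notation wires b := (wiring rows slots m slot_cut slot_link slot_present slot_base slot_pattern b).

(** In the slots of the time [t] the groups of its parity carry the row [t], the
    others the row [t.+1]. *)
Lemma tableau_wiring s : tableau s -> exists b, wires b.
Proof.
move=> tab; pose b σ r := let t := slot_time σ in
  code (s (if odd (r %/ h) == odd t then t else t.+1) (r %/ h)./2) (r %% h).
exists b; split.
- move=> σ r _ _; rewrite /slot_cut /b slot_timeS; case: eqP => _ //= ne.
  by move: ne; rewrite add1n /=; case: (odd _); case: (odd _).
- move=> σ r _ _ lk; rewrite /b /=; have hg := h_ge.
  have er := divn_eq r h; have kh : r %% h < h by rewrite ltn_pmod //; nlia.
  rewrite /slot_link in lk; set g := r %/ h in er lk *; set k := r %% h in er lk kh *.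
  case/orP: lk => /andP[/eqP k0 _].
    have [-> ->] : r.+1 %/ h = g /\ r.+1 %% h = 1 by rewrite er k0 -addnS; apply: row_div; nlia.
    by rewrite k0 code0 code1.
  have [-> ->] : r.+1 %/ h = g /\ r.+1 %% h = h - 1.
    have -> : r.+1 = g * h + (h - 1) by rewrite er k0; nlia.
    by apply: row_div; nlia.
  by rewrite k0 (code_last _).1 (code_last _).2.
move=> σ g σS /and3P[_ _ /goodP ng] bg; apply: ng.
set t := slot_time σ; set j := slot_cell σ.
have tT : t < TT.
  by rewrite /t /slot_time ltn_divLR // muln_gt0 J0 patterns_gt0.
have jJ : j < JJ by rewrite /j /slot_cell ltn_pmod.
exists (s t j), (s t j.+1), (s t.+1 j), (s t.+1 j.+1), g; split; first exact: tab.
move=> k km; have := bg k km; rewrite /b /slot_base -/t -/j /window_code.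
have h0 : 0 < h by have := h_ge; nlia.
have -> : (2 * j * h + k) %/ h = 2 * j + k %/ h by rewrite divnMDl.
have -> : (2 * j * h + k) %% h = k %% h by rewrite modnMDl.
have k4 : k %/ h < 4 by rewrite ltn_divLR.
rewrite oddD mul2n odd_double halfD odd_double doubleK /=.
move: (k %/ h) k4 => [|[|[|[|//]]]] _ /=; rewrite ?addn0 ?addn1; case: (odd t) => /= ->;
  by case: (slot_pattern _ _); case: (g).
Qed.

(** In each window the pattern that the wires carry is the pattern of some slot,
    whose clause must be absent: the wires carry codes there, all complemented or
    none. Decoding does not depend on the complement, so that overlapping windows
    agree on the states they share. *)
Lemma wiring_tableau (q0 : Q) b : wires b -> exists s, tableau s.
Proof.
case=> persist linked clauses.
have P0 := patterns_gt0; pose B := JJ * P.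
have B0 : 0 < B by rewrite muln_gt0 J0.
have hg := h_ge.
pose bt t r := b (t * B) r.
have block t e r : t < TT -> e < B -> r < rows -> b (t * B + e) r = bt t r.
  move=> tT eB rH; elim: e eB => [|e IH] eB; first by rewrite addn0.
  rewrite addnS -persist ?IH ?(ltnW eB) //.
    rewrite -addnS /slots -/B (@leq_trans (t.+1 * B)) ?leq_mul2r ?tT ?orbT //.
    by rewrite mulSn addnC ltn_add2r.
  by rewrite /slot_cut -/B -addnS modnMDl modn_small.
have next t r : t.+1 < TT -> r < rows -> odd (r %/ h) != odd t -> bt t r = bt t.+1 r.
  move=> tT rH ne; have e : t.+1 * B = (t * B + B.-1).+1 by rewrite mulSn; nlia.
  rewrite -(block t B.-1) ?(ltnW tT) //; last by nlia.
  rewrite /bt e; apply: persist => //; first by rewrite -e ltn_mul2r B0.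
  rewrite /slot_cut /slot_time -/B divnMDl // (@divn_small B.-1 B) ?addn0; last by nlia.
  by rewrite (negbTE ne) andbF.
pose dec f := odflt q0 [pick q | [exists g : bool, [forall k : 'I_h, f (val k) == code q k (+) g]]].
have decE f q g : (forall k, k < h -> f k = code q k (+) g) -> dec f = q.
  move=> fq; rewrite /dec; case: pickP => [q' /existsP[g' /forallP fq']|/(_ q)/existsP[]] /=.
    by apply: (@code_inj _ _ g' g) => k kh; rewrite -fq //; have /eqP <- := fq' (Ordinal kh).
  by exists g; apply/forallP => k; rewrite fq.
(* The last row has no slots of its own and is read in those of the time before. *)
pose rb t i k := bt (minn t TT.-1) ((2 * i + odd t) * h + k).
exists (fun t i => dec (rb t i)) => t j tT jJ.
have rowH i k : i < 4 -> k < h -> (2 * j + i) * h + k < rows.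
  move=> i4 kh; apply: (@leq_trans ((2 * j + i).+1 * h)); first by rewrite mulSn addnC ltn_add2r.
  by rewrite /rows -mulnA [h * _]mulnC mulnA leq_mul2r; apply/orP; right; nlia.
have rb0 i k : i <= 1 -> k < h -> rb t (j + i) k = bt t ((2 * j + (2 * i + odd t)) * h + k).
  by move=> i1 kh; rewrite /rb (_ : minn t TT.-1 = t) ?mulnDr ?addnA //; nlia.
have rb1 i k : i <= 1 -> k < h -> rb t.+1 (j + i) k = bt t ((2 * j + (2 * i + odd t.+1)) * h + k).
  move=> i1 kh; rewrite /rb mulnDr -addnA; case: (ltnP t.+1 TT) => tT'.
    rewrite (_ : minn t.+1 TT.-1 = t.+1); last by nlia.
    rewrite -next //; first by apply: rowH => //; case: (odd t.+1); nlia.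
    have [-> _] := row_div (2 * j + (2 * i + odd t.+1)) kh.
    have -> : odd (2 * j + (2 * i + odd t.+1)) = odd t.+1 by lia.
    by rewrite /=; case: (odd t).
  by rewrite (_ : minn t.+1 TT.-1 = t) //; nlia.
have [a aP pa] := patternP (fun k => bt t (2 * j * h + k)).
pose σ := (t * JJ + j) * P + a; have [st sc sa] := slotE t jJ aP.
have spa k : k < m -> slot_pattern σ k = bt t (2 * j * h + k) by move=> km; rewrite /slot_pattern sa pa.
have bσ r : r < rows -> b σ r = bt t r.
  move=> rH; rewrite -(block t (j * P + a)) //; last first.
    by rewrite /B (@leq_trans (j.+1 * P)) ?leq_mul2r ?jJ ?orbT // mulSn addnC ltn_add2r.
  by rewrite /σ /B mulnDl mulnA addnA.
have σS : σ < slots.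
  apply: (@leq_trans ((t * JJ + j).+1 * P)); first by rewrite /σ mulSn [P + _]addnC ltn_add2l.
  rewrite /slots mulnA leq_mul2r; apply/orP; right.
  by rewrite (@leq_trans (t.+1 * JJ)) ?leq_mul2r ?tT ?orbT // mulSn addnC ltn_add2r.
have mE k i : i < 4 -> k < h -> i * h + k < m.
  move=> i4 kh; rewrite /window_length (@leq_trans (i.+1 * h)) ?leq_mul2r ?i4 ?orbT //.
  by rewrite mulSn addnC ltn_add2r.
have rE i k : (2 * j + i) * h + k = 2 * j * h + (i * h + k) by rewrite mulnDl addnA.
have g_ok : good t j (slot_pattern σ).
  case g_eq: (good t j (slot_pattern σ)) => //; have ng := negbT g_eq; exfalso; apply: (clauses σ false σS); last first.
    move=> k km; rewrite addbF spa // /slot_base sc bσ //.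
    have kd := divn_eq k h; have k4 : k %/ h < 4 by rewrite ltn_divLR //; nlia.
    rewrite kd -rE; apply: rowH => //; rewrite ltn_pmod //; nlia.
  have end_link i k : i < 4 -> k.+1 < h -> slot_link σ ((2 * j + i) * h + k) ->
      slot_pattern σ (i * h + k) != slot_pattern σ (i * h + k.+1).
    move=> i4 kh lk; have := linked σ _ σS _ lk; rewrite -addnS => /(_ (rowH _ _ i4 kh)).
    by rewrite !bσ ?rowH // ?(ltnW kh) // !rE -!spa ?mE // ltnW.
  apply/and3P; split; last by rewrite st sc.
    apply: (end_link 0 0 isT (ltnW (ltnW hg))); rewrite /slot_link; have [-> ->] := @row_div (2 * j + 0) 0 ltac:(nlia).
    by rewrite eqxx addn0 mul2n odd_double.
  have -> : m.-1 = 3 * h + (h - 2).+1 by rewrite /window_length; nlia.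
  have -> : (3 * h + (h - 2).+1).-1 = 3 * h + (h - 2) by nlia.
  have h2 : (h - 2).+1 < h by nlia.
  rewrite eq_sym; apply: (end_link 3 (h - 2) isT h2).
  rewrite /slot_link; have [-> ->] := @row_div (2 * j + 3) (h - 2) ltac:(nlia).
  by rewrite eqxx oddD mul2n odd_double orbT.
case/goodP: g_ok => q1 [q2 [q3 [q4 [g [al gk]]]]].
have gk' i k : i < 4 -> k < h -> bt t ((2 * j + i) * h + k) =
    code (nth q1 (if odd t then [:: q3; q1; q4; q2] else [:: q1; q3; q2; q4]) i) k (+) g.
  move=> i4 kh; rewrite rE -spa ?mE // gk ?mE // /window_code.
  by have [-> ->] := row_div i kh.
have e1 : dec (rb t j) = q1.
  by apply: (decE _ _ g) => k kh; rewrite -[j]addn0 rb0 // gk' //; case: (odd t).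
have e2 : dec (rb t j.+1) = q2.
  by apply: (decE _ _ g) => k kh; rewrite -[j.+1]addn1 rb0 // gk' //; case: (odd t).
have e3 : dec (rb t.+1 j) = q3.
  by apply: (decE _ _ g) => k kh; rewrite -[j]addn0 rb1 // gk' //=; case: (odd t).
have e4 : dec (rb t.+1 j.+1) = q4.
  by apply: (decE _ _ g) => k kh; rewrite -[j.+1]addn1 rb1 // gk' //=; case: (odd t).
by rewrite e1 e2 e3 e4.
Qed.

Definition tableau_digraph :=
  strip rows slots m slot_cut slot_link slot_present slot_base slot_pattern.

Theorem tableau_dicolourable (R : realType) (q0 : Q) :
  (planar R tableau_digraph /\ dicolourable 2 tableau_digraph) <-> exists s, tableau s.
Proof.
have E := @strip_dicolourable rows slots m slot_cut slot_link slot_present slot_base slot_pattern m_ge slot_pattern_ends slot_base_le.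
split=> [[_ /E[b w]]|[s tab]]; first exact: wiring_tableau q0 b w.
split; first exact: strip_planar m_ge R.
by apply/E; exact: tableau_wiring tab.
Qed.
End Tableau.

(** * Computations as tableaux *)

Section Runs.
Variable M : tm.
Local Notation tape_index := 'I_(ntapes M).+1.
Local Notation C := (option (bool + aux M)).

Definition next_config (c : config M) : config M := odflt c (step c).

Lemma next_halted n (c : config M) : step c = None -> iter n next_config c = c.
Proof. by move=> h; elim: n => //= n ->; rewrite /next_config h. Qed.

Lemma run_iter n c c' : run n c = Some c' -> c' = iter n next_config c /\ step c' = None.
Proof.
elim: n c => [|n IH] c /=; case E: (step c) => [c1|] //.
- by move=> [<-].
- by rewrite -iterS iterSr {2}/next_config E => /IH.
- by move=> [<-]; rewrite -iterS next_halted.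
Qed.

(** The columns of a tableau do not move with the heads, so heads and cells get
    absolute positions. *)
Definition placed : Type := (state M * (tape_index -> nat) * (tape_index -> nat -> C))%type.

Definition tape_at (t : tape M) (h : nat) (f : nat -> C) : Prop :=
  [/\ t.1.2 = f h, forall d, d < h -> nth None t.1.1 d = f (h.-1 - d) &
      forall d, nth None t.2 d = f (h.+1 + d)].

Definition places (c : config M) (p : placed) : Prop :=
  c.1 = p.1.1 /\ forall i, tape_at (c.2 i) (p.1.2 i) (p.2 i).

Definition moved (mv : move) (h : nat) : nat :=
  match mv with MoveLeft => h.-1 | Stay => h | MoveRight => h.+1 end.

Definition next_placed (p : placed) : placed :=
  if delta p.1.1 [ffun i => p.2 i (p.1.2 i)] is Some (q, acts) then
    (q, fun i => moved (acts i).2 (p.1.2 i),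
     fun i j => if j == p.1.2 i then (acts i).1 else p.2 i j)
  else p.

Lemma tape_at_write (t : tape M) h f a mv : 0 < h -> tape_at t h f ->
  tape_at (write_move (a, mv) t) (moved mv h) (fun j => if j == h then a else f j).
Proof.
case: t => [[l b] r] h0 [/= bE lE rE]; case: mv => /=; split=> //=.
- by rewrite -nth0 lE // subn0 ifN // neq_ltn prednK // leqnn.
- by move=> d dh; rewrite nth_behead lE; [rewrite ifN; [congr f|]|]; nlia.
- move=> [|d] /=; first by rewrite addn0 prednK // eqxx.
  by rewrite rE ifN; [congr f|]; nlia.
- by rewrite eqxx.
- by move=> d dh; rewrite lE // ifN //; nlia.
- by move=> d; rewrite rE ifN //; nlia.
- by rewrite -nth0 rE addn0 ifN //; nlia.
- move=> [|d] dh /=; first by rewrite subn0 eqxx.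
  by rewrite lE; [rewrite ifN; [congr f|]|]; nlia.
- by move=> d; rewrite nth_behead rE ifN; [congr f|]; nlia.
Qed.

Lemma places_scanned c p : places c p -> [ffun i => scanned (c.2 i)] = [ffun i => p.2 i (p.1.2 i)].
Proof.
by case=> _ h; apply/ffunP => i; rewrite !ffunE; have [<- _ _] := h i; case: (c.2 i) => [[]].
Qed.

Lemma places_step c p : places c p ->
  step c = None <-> delta p.1.1 [ffun i => p.2 i (p.1.2 i)] = None.
Proof.
move=> pl; rewrite -(places_scanned pl) -pl.1; case: c pl => q ts /= _.
by case: (delta _ _) => [[]|].
Qed.

Lemma places_next c p : places c p -> (forall i, 0 < p.1.2 i) -> places (next_config c) (next_placed p).
Proof.
move=> pl h0; have e := places_scanned pl; case: pl => pq pt.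
case: c pq pt e => q ts /= pq pt e; rewrite /next_config /next_placed /= -pq -e.
case: (delta _ _) => [[q' acts]|] //=; split=> // i; rewrite ffunE /=.
by case: (acts i) => a mv; apply: tape_at_write.
Qed.

(** The heads start at the cell [c0], far enough from the cell 0. *)
Definition placed_word (c0 : nat) (w : word) (j : nat) : C :=
  if c0 <= j < c0 + size w then Some (inl (nth false w (j - c0))) else None.

Definition start_placed (c0 : nat) (x y : word) : placed :=
  (start M, fun=> c0, fun i : tape_index => placed_word c0 (nth [::] [:: x; y] i)).

Lemma places_start c0 x y : places (init M [:: x; y]) (start_placed c0 x y).
Proof.
split=> // i; rewrite /init ffunE /=; set w := nth _ _ _.
have nE d : nth None [seq Some (inl b) | b <- w] d = placed_word c0 w (c0 + d) :> C.
  rewrite /placed_word leq_addr ltn_add2l addKn; case: ltnP => dw; first by rewrite (nth_map false).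
  by rewrite nth_default // size_map.
split=> /=; first by rewrite -nth0 nE addn0.
  by move=> d dc; rewrite nth_nil /placed_word ifN //; nlia.
by move=> d; rewrite nth_behead nE addnS.
Qed.

Lemma head_near n c0 x y i : let p := iter n next_placed (start_placed c0 x y) in
  p.1.2 i <= c0 + n /\ c0 <= p.1.2 i + n.
Proof.
elim: n => /= [|n []]; first by rewrite addn0.
set p := iter _ _ _; rewrite /next_placed; case: (delta _ _) => [[q acts]|] /=;
  move: (p.1.2 i) => h; [case: (acts i).2|] => /=; lia.
Qed.

Lemma places_run n c0 x y : n <= c0 ->
  places (iter n next_config (init M [:: x; y])) (iter n next_placed (start_placed c0 x y)).
Proof.
elim: n => [|n IH] nc; first exact: places_start.
rewrite !iterS; apply: places_next; first by apply: IH; exact: ltnW.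
by move=> i; have [_] := head_near n c0 x y i; nlia.
Qed.

(** * Rows *)

Definition side_of (j h : nat) : option bool := if j == h then None else Some (h < j).

Definition row_state : finType :=
  ({ffun tape_index -> C * option bool} * state M * {ffun tape_index -> C})%type.

Implicit Types (s : row_state) (p : placed).
Definition content s i : C := (s.1.1 i).1.
Definition side s i : option bool := (s.1.1 i).2.
Definition control s : state M := s.1.2.
Definition visible s : {ffun tape_index -> C} := s.2.

(** Every cell of a row knows the control state and the symbols under all heads, so
    that one step is a local rule even with several heads far apart. *)
Definition row p (j : nat) : row_state :=
  ([ffun i => (p.2 i j, side_of j (p.1.2 i))], p.1.1, [ffun i => p.2 i (p.1.2 i)]).

(** Along a row the sides read: right of the cell, at the cell, left of the cell. *)
Definition side_ok (a b : option bool) : bool :=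
  match a, b with
  | Some false, Some true | None, None | None, Some false | Some true, None | Some true, Some false => false
  | _, _ => true
  end.

Definition seen s : bool := [forall i, (side s i == None) ==> (visible s i == content s i)].

Definition neighbours s1 s2 : bool :=
  [&& control s1 == control s2, visible s1 == visible s2, seen s1, seen s2 &
      [forall i, side_ok (side s1 i) (side s2 i)]].

(** A move by one cell copies the side of the neighbour. A window sees this for one
    of its two cells; the other cell is seen by the window beside it. *)
Definition evolves s1 s2 s3 s4 : bool :=
  if delta (control s1) (visible s1) is Some (q, acts) then
    (control s3 == q) && [forall i,
      [&& content s3 i == (if side s1 i == None then (acts i).1 else content s1 i),
          content s4 i == (if side s2 i == None then (acts i).1 else content s2 i) &
          match (acts i).2 with
          | MoveLeft => side s3 i == side s2 i
          | Stay => (side s3 i == side s1 i) && (side s4 i == side s2 i)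
          | MoveRight => side s4 i == side s1 i
          end]]
  else (s3 == s1) && (s4 == s2).

Lemma side_of_none j h : (side_of j h == None) = (j == h).
Proof. by rewrite /side_of; case: (j == h). Qed.

Lemma side_ofE j h : side_of j h = if j == h then None else Some (~~ (j < h)).
Proof. by rewrite /side_of; case: ltngtP. Qed.

Lemma row_neighbours p j : neighbours (row p j) (row p j.+1).
Proof.
have se k : seen (row p k).
  apply/forallP => i; rewrite /seen /side /content /visible /= !ffunE /= side_of_none.
  by apply/implyP => /eqP ->.
rewrite /neighbours !eqxx !se; apply/forallP => i; rewrite /side /= !ffunE /= /side_of.
by case: (ltngtP j (p.1.2 i)) => h; case: (ltngtP j.+1 (p.1.2 i)) => h' //=; nlia.
Qed.

Lemma row_evolves p j : (forall i, 0 < p.1.2 i) ->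
  evolves (row p j) (row p j.+1) (row (next_placed p) j) (row (next_placed p) j.+1).
Proof.
move=> h0; rewrite /evolves /control /visible /=; rewrite /next_placed.
case: (delta _ _) => [[q acts]|] //=; last by rewrite !eqxx.
rewrite eqxx; apply/forallP => i; rewrite /content /side /= !ffunE /= !side_of_none !eqxx /=.
have := h0 i; rewrite /side_of; case: (acts i).2 => /= hi; rewrite ?eqxx //; apply/eqP.
by rewrite -[p.1.2 i in RHS]prednK // eqSS ltnS.
Qed.

Section Unique.
Variables (J : nat) (s : nat -> row_state).

(** The symbol under a head is known at the head, and from there along the row. *)
Lemma row_unique p : (forall i, p.1.2 i <= J) -> 0 < J ->
  (forall j, j < J -> neighbours (s j) (s j.+1)) ->
  (forall j, j <= J -> control (s j) = p.1.1 /\ forall i, content (s j) i = p.2 i j /\ side (s j) i = side_of j (p.1.2 i)) ->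
  forall j, j <= J -> s j = row p j.
Proof.
move=> hJ J0 nb cs; have vis j : j <= J -> visible (s j) = visible (s 0).
  elim: j => // j IH jJ; have /and5P[_ /eqP <- _ _ _] := nb j jJ; exact/IH/ltnW.
have see j : j <= J -> seen (s j).
  case: j => [_|j jJ]; first by have /and5P[] := nb 0 J0.
  by have /and5P[] := nb j jJ.
move=> j jJ; have [cq ci] := cs j jJ; rewrite [LHS]surjective_pairing [(s j).1]surjective_pairing.
rewrite /row -cq; congr (_, _, _).
  by apply/ffunP => i; rewrite !ffunE; have [<- <-] := ci i; rewrite [LHS]surjective_pairing.
apply/ffunP => i; rewrite ffunE -/(visible (s j)) vis // -(vis _ (hJ i)).
have /forallP/(_ i)/implyP := see _ (hJ i); have [_ /(_ i)[-> ->]] := cs _ (hJ i).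
by rewrite side_of_none eqxx => /(_ isT)/eqP.
Qed.
End Unique.

(** After a move, one cell at an end of the row is seen by no window; its side
    follows from that of its neighbour by [side_ok]. *)
Lemma row_next J (s s' : nat -> row_state) p : (forall i, 0 < p.1.2 i < J) -> 0 < J ->
  (forall j, j < J -> neighbours (s' j) (s' j.+1)) ->
  (forall j, j < J -> evolves (s j) (s j.+1) (s' j) (s' j.+1)) ->
  (forall j, j <= J -> s j = row p j) -> forall j, j <= J -> s' j = row (next_placed p) j.
Proof.
move=> hJ J0 nb ev sE.
have ctl j : j < J -> control (s j) = p.1.1 /\ visible (s j) = [ffun i => p.2 i (p.1.2 i)].
  by move=> jJ; rewrite sE // ltnW.
have lastJ : J = J.-1.+1 by nlia.
case E: (delta p.1.1 [ffun i => p.2 i (p.1.2 i)]) => [[q acts]|]; last first.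
  move=> j jJ; rewrite /next_placed E -sE //; have ev' k : k < J -> s' k = s k /\ s' k.+1 = s k.+1.
    by move=> kJ; have := ev k kJ; rewrite /evolves; have [-> ->] := ctl k kJ; rewrite E => /andP[/eqP -> /eqP ->].
  case: (ltnP j J) => h; first by have [] := ev' j h.
  have jE : j = J.-1.+1 by nlia.
  by rewrite jE; apply: (ev' J.-1 _).2; nlia.
have ev' k : k < J -> control (s' k) = q /\ forall i,
    [/\ content (s' k) i = (if k == p.1.2 i then (acts i).1 else p.2 i k),
        content (s' k.+1) i = (if k.+1 == p.1.2 i then (acts i).1 else p.2 i k.+1) &
        match (acts i).2 with
        | MoveLeft => side (s' k) i = side_of k.+1 (p.1.2 i)
        | Stay => side (s' k) i = side_of k (p.1.2 i) /\ side (s' k.+1) i = side_of k.+1 (p.1.2 i)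
        | MoveRight => side (s' k.+1) i = side_of k (p.1.2 i)
        end].
  move=> kJ; have := ev k kJ; rewrite /evolves; have [-> ->] := ctl k kJ.
  rewrite E => /andP[/eqP -> /forallP h]; split=> // i; have := h i.
  rewrite (sE k (ltnW kJ)) (sE k.+1 kJ) /side /content /= !ffunE /= !side_of_none => /and3P[/eqP -> /eqP -> h'].
  by split=> //; move: h'; case: (acts i).2 => [/eqP|/andP[/eqP -> /eqP]|/eqP].
apply: row_unique => //.
  move=> i; rewrite /next_placed E /=; have /andP[h1 h2] := hJ i.
  by case: (acts i).2 => /=; nlia.
move=> j jJ; split.
  rewrite /next_placed E /=; case: (ltnP j J) => h; first by have [] := ev' j h.
  have jE : j = J.-1.+1 by nlia.
  have kJ : J.-1 < J by nlia.
  by rewrite jE; have /and5P[/eqP <- _ _ _ _] := nb _ kJ; have [] := ev' _ kJ.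
move=> i; rewrite /next_placed E /=; have /andP[h1 h2] := hJ i; split.
  case: (ltnP j J) => h; first by have [_ /(_ i)[]] := ev' j h.
  have kJ : J.-1 < J by nlia.
  have -> : j = J.-1.+1 by nlia.
  by have [_ /(_ i)[]] := ev' _ kJ.
case mE: (acts i).2 => /=.
- case: (ltnP j J) => h.
    have [_ /(_ i)[_ _]] := ev' j h; rewrite mE => ->; rewrite /side_of.
    by rewrite -[p.1.2 i in LHS]prednK // eqSS ltnS.
  have kJ : J.-1 < J by nlia.
  have jE : j = J.-1.+1 by nlia.
  have [_ /(_ i)[_ _]] := ev' _ kJ; rewrite mE -lastJ /side_of => sE'.
  have /and5P[_ _ _ _ /forallP/(_ i)] := nb _ kJ; rewrite -jE sE' ifN; last by nlia.
  rewrite h2 /side_ok; case: (side (s' j) i) => [[]|] //= _.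
  by rewrite ifN; [congr Some|]; nlia.
- case: (ltnP j J) => h; first by have [_ /(_ i)[_ _]] := ev' j h; rewrite mE => -[].
  have kJ : J.-1 < J by nlia.
  have -> : j = J.-1.+1 by nlia.
  by have [_ /(_ i)[_ _]] := ev' _ kJ; rewrite mE => -[].
- case: j jJ => [_|j jJ].
    have [_ /(_ i)[_ _]] := ev' 0 J0; rewrite mE /side_of => sE'.
    have /and5P[_ _ _ _ /forallP/(_ i)] := nb 0 J0; rewrite sE' ifN; last by nlia.
    rewrite ltn0 /side_ok; case: (side (s' 0) i) => [[]|] //= _.
  by have [_ /(_ i)[_ _]] := ev' j jJ; rewrite mE /side_of eqSS ltnS.
Qed.

End Runs.

Lemma horner_le (p : {poly nat}) a b : a <= b -> p.[a]%R <= p.[b]%R.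
Proof.
move=> ab; rewrite !horner_coef; apply: (big_ind2 (fun u v : nat => u <= v)) => // [u u' v v'|i _]; first exact: leq_add.
by rewrite !natrXE; apply: leq_mul => //; case: (val i) => // k; rewrite leq_exp2r.
Qed.

(** * Accepting computations *)

Section Accepting.
Variables (M : tm) (p q : {poly nat}) (V : word -> word -> bool).
Hypothesis M_V : forall x y, result_within M p.[size x + size y]%R [:: x; y] = Some [:: V x y].
Local Notation tape_index := 'I_(ntapes M).+1.
Local Notation C := (option (bool + aux M)).
Implicit Types s : row_state M.

Definition is_bit (a : C) : bool := if a is Some (inl _) then true else false.

(** A cell of the first row, given how it lies to the start of the heads
    ([lt], [eq]), the symbol of the input there ([inx], [bit]), and whether the
    certificate may extend to it ([inz]). *)
Definition start_cell (lt eq inx bit inz : bool) s : bool :=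
  (control s == start M) && [forall i,
    (side s i == if eq then None else Some (~~ lt)) &&
    (if val i == 0 then content s i == if ~~ lt && inx then Some (inl bit) else None
     else if val i == 1 then (content s i == None) || is_bit (content s i) && (~~ lt && inz)
     else content s i == None)].

(** The certificate is a word: a bit right of the head start has a bit before it. *)
Definition start_pair s1 s2 : bool :=
  [forall i, (side s2 i == Some true) && is_bit (content s2 i) ==> is_bit (content s1 i)].

Definition accepting s : bool :=
  (if delta (control s) (visible s) is None then true else false) &&
  (visible s ord0 == Some (inl true)).

Definition allowed_states (first last lt eq inx bit inz lt' eq' inx' bit' inz' : bool) s1 s2 s3 s4 : bool :=
  [&& neighbours s1 s2, neighbours s3 s4, evolves s1 s2 s3 s4,
    first ==> [&& start_cell lt eq inx bit inz s1, start_cell lt' eq' inx' bit' inz' s2 & start_pair s1 s2] &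
    last ==> accepting s3].

Section Input.
Variable x : word.
Definition steps := p.[size x + q.[size x]]%R.+1.
Definition origin := steps.+1.
Definition windows := steps.*2.+2.

Definition allowed_at t j : row_state M -> row_state M -> row_state M -> row_state M -> bool :=
  allowed_states (t == 0) (t.+1 == steps)
    (j < origin) (j == origin) (j < origin + size x) (nth false x (j - origin)) (j < origin + q.[size x]%R)
    (j.+1 < origin) (j.+1 == origin) (j.+1 < origin + size x) (nth false x (j.+1 - origin)) (j.+1 < origin + q.[size x]%R).

Definition start_at j s := start_cell (j < origin) (j == origin) (j < origin + size x)
  (nth false x (j - origin)) (j < origin + q.[size x]%R) s.

Lemma start_row y j : size y <= q.[size x]%R -> start_at j (row (start_placed M origin x y) j).
Proof.
move=> yq; rewrite /start_at /start_cell /control /= eqxx; apply/forallP => i.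
rewrite /side /content /= !ffunE /= side_ofE eqxx /=.
rewrite /placed_word -!leqNgt; case: i => [[|[|i]] hi] /=; rewrite ?nth_nil //.
  by case: ifP => //= /andP[-> h]; apply: leq_trans h _; rewrite leq_add2l.
by rewrite ifN //= addn0; nlia.
Qed.

Lemma start_pair_row y j :
  start_pair (row (start_placed M origin x y) j) (row (start_placed M origin x y) j.+1).
Proof.
apply/forallP => i; rewrite /side /content /= !ffunE /= /side_of /placed_word.
apply/implyP; case: (eqVneq j.+1 origin) => //= ne; case: ltngtP ne => // h _ /=.
case: (ltnP j.+1) => // h' _; rewrite (_ : (origin <= j < _) = true) //.
by apply/andP; split; [rewrite -ltnS|exact: ltnW].
Qed.

Lemma heads_inside y t i : t <= steps ->
  0 < (iter t (@next_placed M) (start_placed M origin x y)).1.2 i < windows.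
Proof.
by move=> tT; have := @head_near M t origin x y i => /=; rewrite /windows /origin; nlia.
Qed.

Lemma halts_in_time y : size y <= q.[size x]%R ->
  let c := iter steps (@next_config M) (init M [:: x; y]) in step c = None /\ output c = [:: V x y].
Proof.
move=> yq; have le : p.[size x + size y]%R <= steps by rewrite leqW // horner_le // leq_add2l.
move: steps le => n le /=; have := M_V x y; rewrite /result_within; case E: (run _ _) => [c|] //= [oE].
have [cE cN] := run_iter E.
by rewrite -(subnK le) iterD -cE next_halted.
Qed.

Lemma read_bits_nth (u : seq C) : let w := @read_bits M u in
  [/\ size w <= size u, forall d, d < size w -> nth None u d = Some (inl (nth false w d)) &
      ~~ is_bit (nth None u (size w))].
Proof.
elim: u => [|[[b|a]|] u IH] /=; try by split.
have [h1 h2 h3] := IH; split=> // -[|d] //=; exact: h2.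
Qed.

Lemma output_true (c : config M) b : output c = [:: b] -> scanned (c.2 ord0) = Some (inl b).
Proof. by rewrite /output; case: (c.2 ord0) => [[l a] r] /=; case: a => [[a|]|] // [->]. Qed.

(** The certificate of an accepting run is read off the first row of a tableau; the
    rows after it have no freedom. *)
Theorem accepting_tableau :
  (exists y, size y <= q.[size x]%R /\ V x y) <->
  exists s : nat -> nat -> row_state M, tableau steps windows allowed_at s.
Proof.
have W0 : 0 < windows by [].
pose pc y t := iter t (@next_placed M) (start_placed M origin x y).
have pcc y : places (iter steps (@next_config M) (init M [:: x; y])) (pc y steps).
  by apply: places_run; rewrite /origin.
split=> [[y [yq Vxy]]|[s tab]].
  exists (fun t => row (pc y t)) => t j tT jW; rewrite /allowed_at /allowed_states.
  have h0 i : 0 < (pc y t).1.2 i by have /andP[] := heads_inside y i (ltnW tT).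
  rewrite !row_neighbours (row_evolves _ h0) /=; apply/andP; split.
    by apply/implyP => /eqP ->; rewrite /pc -/(start_at j _) -/(start_at j.+1 _) !start_row // start_pair_row.
  apply/implyP => /eqP tE; have -> : next_placed (pc y t) = pc y steps by rewrite -tE.
  have [hN hO] := halts_in_time yq.
  have := (places_step (pcc y)).1 hN; rewrite /accepting /control /visible /row /= => ->.
  by rewrite -(places_scanned (pcc y)) ffunE (output_true hO) Vxy.
have al t j : t < steps -> j < windows -> allowed_at t j (s t j) (s t j.+1) (s t.+1 j) (s t.+1 j.+1) := tab t j.
have nb t j : t <= steps -> j < windows -> neighbours (s t j) (s t j.+1).
  case: t => [|t] tT jW; first by have /and5P[] := al 0 j isT jW.
  by have /and5P[] := al t j tT jW.
have st j : j <= windows -> start_at j (s 0 j).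
  case: j => [_|j jW]; first by have /and5P[_ _ _ /and3P[]] := al 0 0 isT isT.
  by have /and5P[_ _ _ /and3P[_ h _] _] := al 0 j isT jW.
have sp j : j < windows -> start_pair (s 0 j) (s 0 j.+1).
  by move=> jW; have /and5P[_ _ _ /and3P[_ _ h] _] := al 0 j isT jW.
pose cert j : C := if insub 1 is Some i then content (s 0 j) (i : tape_index) else None.
pose u := [seq (if origin + d <= windows then cert (origin + d) else None) | d <- iota 0 q.[size x]%R].
pose y := @read_bits M u; have [yu yE yN] := read_bits_nth u.
have yq : size y <= q.[size x]%R by rewrite (leq_trans yu) // size_map size_iota.
have uE d : nth None u d = if (d < q.[size x]%R) && (origin + d <= windows) then cert (origin + d) else None.
  case: (ltnP d q.[size x]%R) => h; last by rewrite nth_default // size_map size_iota.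
  by rewrite (nth_map 0) ?size_iota // nth_iota.
have oW : origin <= windows by rewrite /origin /windows; nlia.
have certE (i : tape_index) j : val i = 1 -> j <= windows -> content (s 0 j) i = placed_word M origin y j.
  move=> i1 jW; have cE k : cert k = content (s 0 k) i.
    by rewrite /cert; case: insubP => [i' _ e|]; [congr content; apply: val_inj; rewrite i1|rewrite -i1 ltn_ord].
  have stc k : k <= windows -> (content (s 0 k) i == None) || is_bit (content (s 0 k) i) && (~~ (k < origin) && (k < origin + q.[size x]%R)).
    by move=> kW; have := st k kW => /andP[_ /forallP/(_ i)/andP[_]]; rewrite i1.
  rewrite /placed_word; case: (ltnP j origin) => /= jo.
    by move: (stc j jW); rewrite jo /= andbF orbF => /eqP.
  case: (ltnP j (origin + size y)) => jy.
    have dy : j - origin < size y by nlia.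
    have := yE _ dy; rewrite uE (leq_trans dy yq) /= subnKC // jW -cE => -> //.
  have nobit k : origin + size y <= k -> k <= windows -> ~~ is_bit (content (s 0 k) i).
    move=> yk; rewrite -(subnKC yk); elim: (k - _) => [|d IH] kW.
      rewrite addn0 in kW *; move: yN; rewrite uE kW andbT -cE.
      case: ltnP => // qy _; move: (stc _ kW); rewrite -cE => /orP[/eqP -> //|/andP[_ /andP[_]]].
      by rewrite ltn_add2l ltnNge qy.
    rewrite addnS in kW *; apply/negP => b.
    have := sp _ kW => /forallP/(_ i)/implyP; rewrite b andbT.
    have := st _ kW => /andP[_ /forallP/(_ i)/andP[/eqP -> _]].
    have -> : ((origin + size y + d).+1 == origin) = false by nlia.
    have -> : ((origin + size y + d).+1 < origin) = false by nlia.
    by move=> /(_ isT); apply/negP/IH; exact: ltnW.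
  by move: (stc j jW) (nobit j jy jW) => /orP[/eqP //|/andP[-> _]].
have row0 j : j <= windows -> s 0 j = row (pc y 0) j.
  apply: (row_unique (J := windows) (s := s 0) (p := pc y 0)) => //; first by move=> k; exact: nb.
  move=> k kW; have /andP[/eqP -> /forallP h] := st k kW; split=> // i.
  have /andP[/eqP sE cE] := h i; split; last first.
    by rewrite sE side_ofE.
  move: cE; rewrite /=; case i0: (val i == 0).
    by move/eqP: i0 => ->; rewrite /placed_word -leqNgt => /eqP.
  case i1: (val i == 1); first by move=> _; rewrite (certE i) // (eqP i1).
  move=> /eqP ->; rewrite /placed_word (_ : nth [::] [:: x; y] i = [::]).
    by rewrite /= addn0; case: ifP => // /andP[]; nlia.
  by move: i0 i1; case: (i) => [[|[|k']] hk] //= _ _; rewrite nth_nil.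
have rows t : t <= steps -> forall j, j <= windows -> s t j = row (pc y t) j.
  elim: t => [|t IH] tT; first exact: row0.
  apply: (row_next (s := s t)) => //; [ |by move=> j; exact: nb| |exact/IH/ltnW].
    by move=> i; apply: heads_inside; exact: ltnW.
  by move=> j jW; have /and5P[] := al t j tT jW.
exists y; split=> //; have [hN hO] := halts_in_time yq.
have := al steps.-1 0 (leqnn _) isT => /and5P[_ _ _ _]; rewrite eqxx /= => /andP[_].
have -> : s steps 0 = row (pc y steps) 0 by apply: rows.
rewrite /visible /row /= -(places_scanned (pcc y)) ffunE (output_true hO).
by move=> /eqP[].
Qed.
End Input.
End Accepting.

(** * The reduction is computable *)

Section Closure.
Variable k : nat.
Implicit Types (F G : seq word -> nat) (b c : seq word -> bool).

Lemma PN_ifb b F G : PN k b -> PN k F -> PN k G -> PN k (fun a => if b a then F a else G a).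
Proof. by move=> hb hF hG; apply: PN_ext (PN_if hb hF hG) => a _; case: (b a). Qed.

Lemma PN_branch b (c d : seq word -> bool) : PN k b -> PN k c -> PN k d ->
  PN k (fun a => if b a then c a else d a : bool).
Proof. by move=> hb hc hd; apply: PN_ext (PN_ifb hb hc hd) => a _; case: (b a). Qed.

Lemma PN_and b c : PN k b -> PN k c -> PN k (fun a => b a && c a).
Proof. by move=> hb hc; apply: PN_ext (PN_mul hb hc) => a _; case: (b a); case: (c a). Qed.

Lemma PN_not b : PN k b -> PN k (fun a => ~~ b a).
Proof. by move=> hb; apply: PN_ext (PN_sub (PN_const k 1) hb) => a _; case: (b a). Qed.

Lemma PN_or b c : PN k b -> PN k c -> PN k (fun a => b a || c a).
Proof.
move=> hb hc; apply: PN_ext (PN_not (PN_and (PN_not hb) (PN_not hc))) => a _.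
by case: (b a); case: (c a).
Qed.

Lemma PN_eq F G : PN k F -> PN k G -> PN k (fun a => F a == G a).
Proof.
move=> hF hG; apply: PN_ext (PN_and (PN_leq hF hG) (PN_leq hG hF)) => a _.
by rewrite eqn_leq.
Qed.

Lemma PN_eqb b c : PN k b -> PN k c -> PN k (fun a => b a == c a).
Proof. by move=> hb hc; apply: PN_ext (PN_eq hb hc) => a _; case: (b a); case: (c a). Qed.

Lemma PN_succ F : PN k F -> PN k (fun a => (F a).+1).
Proof. exact: PN_add (PN_const k 1). Qed.

Lemma PN_pred F : PN k F -> PN k (fun a => (F a).-1).
Proof. by move=> h; apply: PN_ext (PN_sub h (PN_const k 1)) => a _; rewrite subn1. Qed.

Lemma PN_min F G : PN k F -> PN k G -> PN k (fun a => minn (F a) (G a)).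
Proof. by move=> h1 h2; apply: PN_ifb => //; apply: PN_leq => //; exact: PN_succ. Qed.

Lemma PN_max F G : PN k F -> PN k G -> PN k (fun a => maxn (F a) (G a)).
Proof. by move=> h1 h2; apply: PN_ifb => //; apply: PN_leq => //; exact: PN_succ. Qed.

Lemma PN_double F : PN k F -> PN k (fun a => (F a).*2).
Proof. by move=> h; apply: PN_ext (PN_add h h) => a _; rewrite addnn. Qed.

End Closure.

(** A quotient is a number of multiples, so division is a count. *)
Lemma count_quotients x y n : 0 < y -> x <= n ->
  count (fun i => i.+1 * y <= x) (iota 0 n) = x %/ y.
Proof.
move=> y0 xn; rewrite (eq_count (a2 := fun i => i < x %/ y)); last by move=> i; rewrite leq_divRL.
have : x %/ y <= n by apply: leq_trans xn; exact: leq_div.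
move: (x %/ y) => z; elim: n {xn} => [|n IH] zn; first by move: zn; rewrite leqn0 => /eqP ->.
rewrite -addn1 iotaD count_cat add0n /= addn0; case: (ltnP n z) => nz.
  have -> : z = n.+1 by apply/eqP; rewrite eqn_leq zn.
  rewrite (eq_in_count (a2 := predT)) ?count_predT ?size_iota ?addn1 // => i.
  by rewrite mem_iota => /andP[_ h]; rewrite ltnW.
by rewrite addn0 IH.
Qed.

Lemma PN_div k F G : PN k F -> PN k G -> PN k (fun a => F a %/ G a).
Proof.
move=> hF hG; have P : PN k.+1 (fun e => (size (nth [::] e k)).+1 * G (take k e) <= F (take k e)).
  apply: PN_leq; last exact: PT_weak1 hF.
  by apply: PN_mul; [apply/PN_succ/PN_size/PT_arg|exact: PT_weak1 hG].
apply: PN_ext (PN_mul (PN_leq (PN_const k 1) hG) (PN_countP hF P)) => a sa /=.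
case: (posnP (G a)) => [->|g0]; first by rewrite divn0.
rewrite mul1n -(count_quotients g0 (leqnn (F a))); apply: eq_count => i.
by rewrite -cats1 take_size_cat // nth_cat sa ltnn subnn /= size_ones -lt0n lt0b.
Qed.

Lemma PN_mod k F G : PN k F -> PN k G -> PN k (fun a => F a %% G a).
Proof.
move=> hF hG; apply: PN_ext (PN_sub hF (PN_mul (PN_div hF hG) hG)) => a _.
by rewrite {1}(divn_eq (F a) (G a)) addKn.
Qed.

Lemma PN_odd k F : PN k F -> PN k (fun a => odd (F a)).
Proof. by move=> h; apply: PN_ext (PN_mod h (PN_const k 2)) => a _; rewrite modn2. Qed.

Lemma PN_horner k (p : {poly nat}) F : PN k F -> PN k (fun a => p.[F a]%R).
Proof.
move=> h; elim/poly_ind: p => [|p c IH].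
  by apply: PN_ext (PN_const k 0) => a _; rewrite horner0.
apply: PN_ext (PN_add (PN_mul IH h) (PN_const k c)) => a _.
by rewrite hornerMXaddC.
Qed.

(** A function of boundedly many truth values is a finite table. *)
Lemma PN_bits k (fs : seq (seq word -> bool)) (G : seq bool -> bool) :
  (forall i, i < size fs -> PN k (fun a => nth (fun=> false) fs i a)) ->
  PN k (fun a => G [seq f a | f <- fs]).
Proof.
elim: fs G => [|f fs IH] G h; first exact: (PN_const k (G [::])).
have hs i : i < size fs -> PN k (fun a => nth (fun=> false) fs i a) by move=> hi; exact: (h i.+1).
apply: PN_ext (PN_branch (h 0 isT) (IH (fun w => G (true :: w)) hs) (IH (fun w => G (false :: w)) hs)) => a _ /=.
by case: (f a).
Qed.

(** A bounded argument can be treated case by case, by constants of the machine. *)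
Lemma PN_cases k n F (G : nat -> seq word -> bool) : PN k F ->
  (forall v, v < n -> PN k (fun a => G v a)) -> PN k (fun a => (F a < n) && G (F a) a).
Proof.
move=> hF; elim: n => [|n IH] hG; first by apply: PN_ext (PN_const k 0) => a _; rewrite ltn0.
have h1 := IH (fun v vn => hG v (ltnW vn)).
apply: PN_ext (PN_branch (PN_eq hF (PN_const k n)) (hG n (ltnSn n)) h1) => a _.
by rewrite [F a < n.+1]ltnS [F a <= n]leq_eqVlt; case: (eqVneq (F a) n) => [<-|ne].
Qed.

Lemma PN_seq k (w : word) F : PN k F -> PN k (fun a => nth false w (F a)).
Proof. by move=> h; apply: PN_bit (PT_const k w) h. Qed.

Ltac pn := repeat lazymatch goal with
  | |- PN _ (fun a => @?F a + @?G a) => apply: (@PN_add _ F G)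
  | |- PN _ (fun a => @?F a * @?G a) => apply: (@PN_mul _ F G)
  | |- PN _ (fun a => @?F a - @?G a) => apply: (@PN_sub _ F G)
  | |- PN _ (fun a => @?F a %/ @?G a) => apply: (@PN_div _ F G)
  | |- PN _ (fun a => @?F a %% @?G a) => apply: (@PN_mod _ F G)
  | |- PN _ (fun a => minn (@?F a) (@?G a)) => apply: (@PN_min _ F G)
  | |- PN _ (fun a => maxn (@?F a) (@?G a)) => apply: (@PN_max _ F G)
  | |- PN _ (fun a => (@?F a).+1) => apply: (@PN_succ _ F)
  | |- PN _ (fun a => (@?F a).-1) => apply: (@PN_pred _ F)
  | |- PN _ (fun a => (@?F a).*2) => apply: (@PN_double _ F)
  | |- PN _ (fun a => nat_of_bool (odd (@?F a))) => apply: (@PN_odd _ F)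
  | |- PN _ (fun a => nat_of_bool (@?F a <= @?G a)) => apply: (@PN_leq _ F G)
  | |- PN _ (fun a => nat_of_bool (@?F a && @?G a)) => apply: (@PN_and _ F G)
  | |- PN _ (fun a => nat_of_bool (@?F a || @?G a)) => apply: (@PN_or _ F G)
  | |- PN _ (fun a => nat_of_bool (~~ @?F a)) => apply: (@PN_not _ F)
  | |- PN _ (fun a => nat_of_bool (@?F a == @?G a)) => first [apply: (@PN_eq _ F G)|apply: (@PN_eqb _ F G)]
  | |- PN _ (fun=> ?c) => exact: PN_const
  end.

Section StripComputable.
Variables (k m : nat) (cut link : seq word -> nat -> nat -> bool) (present : seq word -> nat -> bool).
Variables (base : seq word -> nat -> nat) (pat : seq word -> nat -> nat -> bool).
Hypothesis cutP : forall F G, PN k F -> PN k G -> PN k (fun a => cut a (F a) (G a)).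
Hypothesis linkP : forall F G, PN k F -> PN k G -> PN k (fun a => link a (F a) (G a)).
Hypothesis presentP : forall F, PN k F -> PN k (fun a => present a (F a)).
Hypothesis baseP : forall F, PN k F -> PN k (fun a => base a (F a)).
Hypothesis patP : forall F G, PN k F -> PN k G -> PN k (fun a => pat a (F a) (G a)).

Lemma PN_down_col F G : PN k F -> PN k G -> PN k (fun a => down_col m (pat a) (F a) (G a)).
Proof.
move=> hF hG; have hc c i : PN k (fun a => c + pat a (F a) i) by pn; apply: patP => //; exact: PN_const.
rewrite /down_col; apply: PN_ifb (hc _ _) _; first by pn.
apply: PN_ifb (hc _ _) _; first by pn.
by pn; exact: patP.
Qed.

Lemma PN_up_col F G : PN k F -> PN k G -> PN k (fun a => up_col m (pat a) (F a) (G a)).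
Proof.
move=> hF hG; rewrite /up_col; apply: PN_ifb; first by pn => //.
  exact: PN_down_col.
by pn => //; exact: patP.
Qed.

Lemma PN_strip_arc r c r' c' : PN k r -> PN k c -> PN k r' -> PN k c' ->
  PN k (fun a => strip_arc m (cut a) (link a) (present a) (base a) (pat a) (r a) (c a) (r' a) (c' a)).
Proof.
move=> hr hc hr' hc'; rewrite /strip_arc /wire_arc /link_arc /clause_arc /down_arc /up_arc.
pn => //; try (apply: cutP || apply: linkP || apply: presentP || apply: baseP || apply: PN_down_col || apply: PN_up_col) => //; pn => //; apply: baseP; pn => //.
Qed.
End StripComputable.

Lemma encode_strip H S m cut link present base pat (n := H * strip_width S) :
  encode (strip H S m cut link present base pat) =
  mkseq (fun i => strip_arc m cut link present base pat
    (i %/ n %/ strip_width S) (i %/ n %% strip_width S) (i %% n %/ strip_width S) (i %% n %% strip_width S)) (n * n).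
Proof.
rewrite encode_table /table /= -/n /mkseq; apply/eq_in_map => i; rewrite mem_iota add0n /= => h.
have n0 : 0 < n by move: h; case: (n).
have un : i %/ n < n by rewrite ltn_divLR.
have vn : i %% n < n by rewrite ltn_pmod.
by rewrite -[i %/ n]/(val (Ordinal un)) -[i %% n]/(val (Ordinal vn)) nat_relE.
Qed.

Section Reduction.
Variables (M : tm) (p q : {poly nat}).

Definition instance (x : word) : digraph :=
  tableau_digraph (steps p q x) (windows p q x) (@allowed_at M p q x).

Local Notation P := (size (patterns (row_state M))).
Local Notation h := (code_length (row_state M)).
Local Notation m := (window_length (row_state M)).

(** The position of a window and the input matter only through the truth values in
    [w], so for each pattern number [v] this is a function of boundedly many
    bits. *)
Definition clause_needed (v : nat) (w : seq bool) : bool :=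
  let f := pattern (row_state M) v in let z := nth false w in
  [&& f 0 != f 1, f m.-1 != f m.-2 &
  ~~ [exists q1 : row_state M, [exists q2 : row_state M, [exists q3 : row_state M, [exists q4 : row_state M,
      allowed_states (z 1) (z 2) (z 3) (z 4) (z 5) (z 6) (z 7) (z 8) (z 9) (z 10) (z 11) (z 12) q1 q2 q3 q4 &&
      [exists g : bool, [forall k : 'I_m, f k == window_code (z 0) q1 q2 q3 q4 k (+) g]]]]]]].

Lemma PN_pattern k F G : PN k F -> PN k G -> PN k (fun a => pattern (row_state M) (F a %% P) (G a)).
Proof.
move=> hF hG; have hm := PN_mod hF (PN_const k P).
apply: PN_ext (PN_cases (n := P) (G := fun v a => nth false (mkseq (pattern (row_state M) v) m) (G a)) hm _).
  move=> a _; rewrite ltn_pmod ?patterns_gt0 //=; congr nat_of_bool.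
  case: (ltnP (G a) m) => h; first by rewrite nth_mkseq.
  by rewrite nth_default ?size_mkseq // /pattern insubF // ltnNge h.
by move=> v _; apply: PN_seq.
Qed.

Lemma PN_steps k F : PT k F -> PN k (fun a => steps p q (F a)).
Proof.
move=> hF; have hs := PN_size hF.
exact: PN_succ (PN_horner p (PN_add hs (PN_horner q hs))).
Qed.

(** The machine and its polynomials are fixed, so the states and the patterns are
    finitely many constants; only the numbers of times, cells and slots grow with
    the input, and a clause depends on the input through thirteen comparisons and
    bits. *)
Theorem poly_time_instance : poly_time_fun (fun x => encode (instance x)).
Proof.
pose X (a : seq word) := nth [::] a 0; pose I (a : seq word) := size (nth [::] a 1).
have hX k : PT k.+1 X by exact: PT_arg.
have hT k : PN k.+1 (fun a => steps p q (X a)) by exact: PN_steps.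
have hJ k : PN k.+1 (fun a => windows p q (X a)) by rewrite /windows; pn.
have hO k : PN k.+1 (fun a => origin p q (X a)) by rewrite /origin; pn.
have hq k : PN k.+1 (fun a => q.[size (X a)]%R) by apply: PN_horner; exact: PN_size.
have hs k : PN k.+1 (fun a => size (X a)) by exact: PN_size.
pose S a := slots (row_state M) (steps p q (X a)) (windows p q (X a)).
pose H a := rows (row_state M) (windows p q (X a)).
pose n a := H a * strip_width (S a).
have hS k : PN k.+1 S by rewrite /S /slots; pn.
have hH k : PN k.+1 H by rewrite /H /rows; pn.
have hW k : PN k.+1 (fun a => strip_width (S a)) by rewrite /strip_width; pn.
have hn k : PN k.+1 n by rewrite /n; pn.
have ht F : PN 2 F -> PN 2 (fun a => slot_time (row_state M) (windows p q (X a)) (F a)).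
  by move=> hF; rewrite /slot_time; pn.
have hc F : PN 2 F -> PN 2 (fun a => slot_cell (row_state M) (windows p q (X a)) (F a)).
  by move=> hF; rewrite /slot_cell; pn.
pose arc a := strip_arc m (slot_cut (row_state M) (windows p q (X a))) (slot_link (row_state M))
  (slot_present (windows p q (X a)) (@allowed_at M p q (X a)))
  (slot_base (row_state M) (windows p q (X a))) (slot_pattern (row_state M))
  (I a %/ n a %/ strip_width (S a)) (I a %/ n a %% strip_width (S a))
  (I a %% n a %/ strip_width (S a)) (I a %% n a %% strip_width (S a)).
have harc : PN 2 (fun a => arc a).
  have hI : PN 2 I by apply: PN_size; exact: PT_arg.
  apply: PN_strip_arc; try by pn.
  - by move=> F G hF hG; rewrite /slot_cut; pn => //; exact: ht.
  - by move=> F G hF hG; rewrite /slot_link; pn => //; exact: PN_const.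
  - move=> F hF.
    pose fs (t j : seq word -> nat) : seq (seq word -> bool) := [:: fun a => odd (t a); fun a => t a == 0;
      fun a => (t a).+1 == steps p q (X a);
      fun a => j a < origin p q (X a); fun a => j a == origin p q (X a);
      fun a => j a < origin p q (X a) + size (X a); fun a => nth false (X a) (j a - origin p q (X a));
      fun a => j a < origin p q (X a) + q.[size (X a)]%R;
      fun a => (j a).+1 < origin p q (X a); fun a => (j a).+1 == origin p q (X a);
      fun a => (j a).+1 < origin p q (X a) + size (X a); fun a => nth false (X a) ((j a).+1 - origin p q (X a));
      fun a => (j a).+1 < origin p q (X a) + q.[size (X a)]%R].
    pose t a := slot_time (row_state M) (windows p q (X a)) (F a).
    pose j a := slot_cell (row_state M) (windows p q (X a)) (F a).
    have htF : PN 2 t := ht F hF; have hjF : PN 2 j := hc F hF.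
    have hfs i : i < size (fs t j) -> PN 2 (fun a => nth (fun=> false) (fs t j) i a).
      by case: i => [|[|[|[|[|[|[|[|[|[|[|[|[|i]]]]]]]]]]]]] //= _; pn => //; apply: PN_bit => //; pn.
    have hm := PN_mod hF (PN_const 2 P).
    apply: PN_ext (PN_cases (n := P) (G := fun v a => clause_needed v [seq f a | f <- fs t j]) hm _).
      by move=> a _; rewrite ltn_pmod ?patterns_gt0.
    by move=> v _; exact: PN_bits hfs.
  - by move=> F hF; rewrite /slot_base; pn => //; exact: hc.
  - by move=> F G; exact: PN_pattern.
have hnn : PN 1 (fun a => n a * n a) by pn.
have [K [r hr]] := PT_computable (PT_mkseq hnn harc).
exists K, r => x; have := hr [:: x] erefl; rewrite /tot /= addn0 => ->; congr Some.
rewrite /instance /tableau_digraph encode_strip; apply: eq_map => i /=.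
by rewrite /arc /I /= size_ones; case: (strip_arc _ _ _ _ _ _ _ _ _ _).
Qed.
End Reduction.

(** * Hardness *)

Theorem planar_dicolourability_NP_hard (R : realType) : NP_hard (planar_dicolourability R 2).
Proof.
move=> L [V [q [[M [p M_V]] LV]]].
exists (fun x => encode (instance M p q x)); split; first exact: poly_time_instance.
move=> x; rewrite LV (@accepting_tableau M p q V M_V x).
have q0 : row_state M := ([ffun=> (None, None)], start M, [ffun=> None]).
have D := @tableau_dicolourable _ _ _ (@allowed_at M p q x) (isT : 0 < steps p q x) (isT : 0 < windows p q x) R q0.
rewrite -D; split=> [[pl col]|[D' [/encode_inj <- pl col]]]; last by split.
by exists (instance M p q x).
Qed.

Theorem theorem3p14 (R : realType) :
  NP_complete (planar_dicolourability R 2).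
Proof.
by split; [exact: planar_dicolourability_in_NP|exact: planar_dicolourability_NP_hard].
Qed.
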